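(* Let $\overline{\mathcal M}_{(g,h)(n,\mathbf m)}$ be a moduli space of stable marked bordered Riemann surfaces which is none of the following: $\overline{\mathcal M}_{(0,0)(3,0)}$; $\overline{\mathcal M}_{(0,1)(2,0)}$; $\overline{\mathcal M}_{(0,2)(1,0)}$; $\overline{\mathcal M}_{(0,3)(0,0)}$; $\overline{\mathcal M}_{(0,1)(0,m)}$ (a disk with $m$ marked points on its boundary and no punctures); $\overline{\mathcal M}_{(0,1)(1,m)}$ (a disk with one puncture and $m$ marked points on its boundary); $\overline{\mathcal M}_{(0,2)(0,\langle m,0\rangle)}$ (an annulus without punctures, with $m$ marked points all on one boundary circle). Then $\overline{\mathcal M}_{(g,h)(n,\mathbf m)}$ is not a polytope, i.e. its stratification is not identical to the face poset of a convex polytope.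
   Context: Marked bordered Riemann surfaces: a bordered Riemann surface $S$ of type $(g,h)$ is a compact connected oriented Riemann surface of genus $g\ge 0$ whose boundary consists of $h\ge 0$ disjoint ordered circles $B_1,\dots,B_h$. A marking set $M$ of type $(n,\mathbf m)$, $\mathbf m=\langle m_1,\dots,m_h\rangle$, consists of $n$ labeled marked points in the interior of $S$ (punctures) and $m_i$ labeled marked points on $B_i$ for each $i$; put $m=m_1+\cdots+m_h$. (For $h=1$ one writes $m$ for $\langle m\rangle$, and if all $m_i=0$ one writes $0$ for $\mathbf m$. The annulus with all marked points on one circle is regarded as one case irrespective of which of the two circles carries the points.) The pair $(S,M)$ is stable if its automorphism group is finite; all surfaces are assumed stable. The cyclic order of the labeled marked points on each boundary circle is fixed. Moduli space: $\overline{\mathcal M}_{(g,h)(n,\mathbf m)}$ is the compactified moduli space (in the sense of Abikoff, Seppälä and Liu, with the Fenchel–Nielsen topology) of stable marked bordered Riemann surfaces of type $(g,h)$ with marking set of type $(n,\mathbf m)$; the compactification adds the nodal surfaces obtained by contracting decomposing geodesics. It is compact Hausdorff of real dimension $6g+3h-6+2n+m$. Stratification: an arc is a simple curve on $S$ with endpoints on the boundary of $S$, disjoint from $M$, which cannot be deformed (avoiding $M$) arbitrarily close to a point of $S$ or of $M$. A loop is a simple closed curve on $S$, disjoint from $M$, which cannot be so deformed arbitrarily close to a point of $S$ or of $M$; it is a $1$-loop if it can be deformed to a boundary circle having no marked points, and a $2$-loop otherwise. Arcs and loops are taken up to isotopy, and two of them are compatible if they have representatives that do not intersect. Arcs and $1$-loops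 have weight $1$, $2$-loops have weight $2$. The strata of $\overline{\mathcal M}_{(g,h)(n,\mathbf m)}$ are indexed by sets of pairwise compatible, pairwise distinct arcs and loops on $(S,M)$, taken up to orientation-preserving homeomorphisms of $S$ that preserve each puncture, each boundary circle and each boundary marked point. A set of total weight $k$ gives a stratum of real codimension $k$ (obtained by contracting the curves of the set), and the strata are partially ordered by closure: adding arcs and loops passes to a smaller stratum. A moduli space is a polytope (is polytopal) when its poset of strata, with their dimensions, is isomorphic to the poset of nonempty faces of a convex polytope. *)

(* Defs.v *)
From HB Require Import structures.
From mathcomp Require Import all_boot all_order all_algebra complex.
From mathcomp Require Import all_classical all_reals all_analysis.

Set Implicit Arguments.
Unset Strict Implicit.
Unset Printing Implicit Defensive.

Import Order.TTheory GRing.Theory Num.Theory numFieldNormedType.Exports.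
Local Open Scope classical_set_scope.
Local Open Scope ring_scope.

(* The type is [R[i]]; the cast makes the norm topology and complex
   differentiability ([derivable] over the field [Cplx R]) available on it. *)
Definition Cplx (R : realType) : numFieldType := R[i]%C.

Definition cis (R : realType) (t : R) : Cplx R := (cos t +i* sin t)%C.

Definition half_plane (R : realType) : set (Cplx R) :=
  [set z | 0 <= complex.Im z].

Arguments half_plane R : clear implicits.

Section Curves.
Variables (R : realType) (T : topologicalType).

(* The parametrization is 1-periodic and injective modulo 1. *)
Definition circle_in (c : set T) : Prop :=
  exists gam : R -> T,
    [/\ continuous gam,
        forall s t : R, gam s = gam t <-> exists k : int, s - t = k%:~R &
        c = range gam].

(* A simple arc with both endpoints, and no other point, on [D]. *)
Definition segment_in (D c : set T) : Prop :=
  exists gam : R -> T,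
    [/\ {within `[0, 1], continuous gam},
        set_inj `[0, 1] gam,
        forall t : R, `[0, 1]%classic t -> (D (gam t) <-> t = 0 \/ t = 1) &
        c = gam @` `[0, 1]].

Definition homeo (f : T -> T) : Prop :=
  exists g : T -> T, [/\ continuous f, continuous g, cancel f g & cancel g f].

(* A (partial) chart is a domain together with a map that is only relevant on
   that domain. *)
Definition chart : Type := (set T * (T -> Cplx R))%type.

Definition is_chart (D : set T) (a : chart) : Prop :=
  [/\ open a.1,
      {within a.1, continuous a.2},
      set_inj a.1 a.2,
      forall V : set T, open V -> V `<=` a.1 ->
        exists2 W : set (Cplx R), open W & a.2 @` V = W `&` half_plane R &
      forall x, a.1 x -> (D x <-> complex.Im (a.2 x) = 0)].

(* Near boundary points, holomorphic means: extends to a holomorphic function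
   on an open subset of the plane. *)
Definition holomorphic_for (A : set chart) (f : T -> T) : Prop :=
  forall a b : chart, A a -> A b ->
    exists (W : set (Cplx R)) (G : Cplx R -> Cplx R),
      [/\ open W,
          forall z, W z -> derivable G z 1 &
          forall x, a.1 x -> b.1 (f x) ->
            W (a.2 x) /\ G (a.2 x) = b.2 (f x)].

(* In charts, [f] maps every small positively oriented circle around [x] to a
   loop of winding number +1 around [f x]. *)
Definition preserves_orientation_at (A : set chart) (f : T -> T) (x : T) :
    Prop :=
  exists a b : chart, [/\ A a, A b, a.1 x, b.1 (f x) &
    exists2 r0 : R, 0 < r0 &
    forall r : R, 0 < r -> r < r0 ->
    forall sig : R -> T,
      (forall t, a.1 (sig t) /\
         a.2 (sig t) = a.2 x + (r%:C)%C * cis (2 * pi * t)) ->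
      exists rho theta : R -> R,
        [/\ continuous theta, theta 1 = theta 0 + 2 * pi &
            forall t, `[0, 1]%classic t ->
              [/\ 0 < rho t, b.1 (f (sig t)) &
                  b.2 (f (sig t)) =
                    b.2 (f x) + (rho t)%:C%C * cis (theta t)]]].

(* [g] is the largest number of disjoint simple closed curves off the boundary
   [D] whose union does not disconnect the surface. *)
Definition cut_system (D : set T) (k : nat) (c : 'I_k -> set T) : Prop :=
  [/\ forall i, circle_in (c i),
      forall i, c i `&` D = set0,
      forall i j, i != j -> c i `&` c j = set0 &
      connected (~` (\bigcup_i c i))].

Definition has_genus (D : set T) (g : nat) : Prop :=
  (exists c : 'I_g -> set T, cut_system D c) /\
  (forall (k : nat) (c : 'I_k -> set T), cut_system D c -> (k <= g)%N).

End Curves.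

Record bordered_surface (R : realType) (g h : nat) := BorderedSurface {
  carrier :> topologicalType;
  atlas : set (chart R carrier);
  circ : 'I_h -> set carrier;
  _ : [set: carrier] !=set0;
  _ : compact [set: carrier];
  _ : hausdorff_space carrier;
  _ : connected [set: carrier];
  _ : forall i, circle_in R (circ i);
  _ : forall i j, i != j -> circ i `&` circ j = set0;
  _ : forall a, atlas a -> is_chart (\bigcup_i circ i) a;
  _ : forall x, exists2 a, atlas a & a.1 x;
  _ : holomorphic_for atlas id;
  _ : has_genus R (\bigcup_i circ i) g
}.

Arguments atlas {R g h} S : rename.
Arguments circ {R g h} S i : rename.

Definition bdry (R : realType) (g h : nat) (S : bordered_surface R g h) :
  set S := \bigcup_i circ S i.

Arguments bdry {R g h} S _ : rename.

Record marked_surface (R : realType) (g h n : nat) (m : h.-tuple nat) :=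
  MarkedSurface {
  surf :> bordered_surface R g h;
  punct : 'I_n -> surf;
  bmark : forall i : 'I_h, 'I_(tnth m i) -> surf;
  _ : injective punct;
  _ : forall k, ~ bdry surf (punct k);
  _ : forall i, injective (@bmark i);
  _ : forall i k, circ surf i (@bmark i k)
}.

Arguments punct {R g h n m} S k : rename.
Arguments bmark {R g h n m} S i k : rename.

Section Strata.
Variables (R : realType) (g h n : nat) (m : h.-tuple nat).
Variable S : marked_surface R g n m.

Definition marks : set S :=
  [set x | (exists k, x = punct S k) \/ (exists i k, x = bmark S i k)].

Definition marked_homeo (f : S -> S) : Prop :=
  [/\ homeo f,
      forall k, f (punct S k) = punct S k,
      forall i k, f (bmark S i k) = bmark S i k &
      forall i, f @` circ S i = circ S i].

Definition automorphism (f : S -> S) : Prop :=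
  marked_homeo f /\
  exists f' : S -> S,
    [/\ cancel f f', cancel f' f,
        holomorphic_for (atlas S) f &
        holomorphic_for (atlas S) f'].

(* Conformal automorphisms fixing every marked point and boundary circle. *)
Definition stable : Prop := finite_set [set f : S -> S | automorphism f].

(* Ambient isotopy relative to the marked points; arcs may slide along the
   boundary between marked points. *)
Definition isotopic (c c' : set S) : Prop :=
  exists H : R -> S -> S,
    [/\ {within `[0, 1] `*` [set: S],
           continuous (fun p : R * S => H p.1 p.2)},
        forall t : R, `[0, 1]%classic t -> marked_homeo (H t),
        H 0 = id &
        c' = H 1 @` c].

Definition deforms_near (c A : set S) : Prop :=
  forall U : set S, open U -> A `<=` U ->
    exists2 c', isotopic c c' & c' `<=` U.

Definition essential (c : set S) : Prop :=
  forall x : S, ~ deforms_near c [set x : S].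

Definition is_arc (c : set S) : Prop :=
  [/\ segment_in R (bdry S) c, c `&` marks = set0 & essential c].

Definition is_loop (c : set S) : Prop :=
  [/\ circle_in R c, c `&` bdry S = set0, c `&` marks = set0 & essential c].

(* The loop is parallel to a boundary circle without marked points. *)
Definition one_loop (c : set S) : Prop :=
  is_loop c /\ exists2 i : 'I_h, tnth m i = 0%N & deforms_near c (circ S i).

Definition two_loop (c : set S) : Prop := is_loop c /\ ~ one_loop c.

Definition isotopy_class (c : set S) : set (set S) := [set c' | isotopic c c'].

Definition curve_class (K : set (set S)) : Prop :=
  exists2 c, is_arc c \/ is_loop c & K = isotopy_class c.

Definition compatible (K L : set (set S)) : Prop :=
  exists c d : set S, [/\ K c, L d & c `&` d = set0].

Definition weight (K : set (set S)) : nat :=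
  if `[< exists2 c, K c & two_loop c >] then 2 else 1.

Definition curve_system (A : set (set (set S))) : Prop :=
  [/\ finite_set A,
      forall K, A K -> curve_class K &
      forall K L, A K -> A L -> K <> L -> compatible K L].

Definition system_weight (A : set (set (set S))) : nat :=
  \sum_(K \in A) weight K.

Definition mapping_class (f : S -> S) : Prop :=
  marked_homeo f /\
  forall x, ~ bdry S x -> preserves_orientation_at (atlas S) f x.

Definition system_image (f : S -> S) (A : set (set (set S))) :
    set (set (set S)) :=
  [set [set f @` c | c in K] | K in A].

(* A stratum is encoded as the orbit of a curve system, which is a set of
   isotopy classes, under mapping classes. *)
Definition stratum_of (A : set (set (set S))) : set (set (set (set S))) :=
  [set B | exists2 f, mapping_class f & B = system_image f A].

Definition strata : set (set (set (set (set S)))) :=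
  stratum_of @` curve_system.

(* Smaller strata have larger curve systems. *)
Definition stratum_le (X Y : set (set (set (set S)))) : Prop :=
  exists A B, [/\ X A, Y B & B `<=` A].

Definition moduli_dim : int :=
  (6 * g + 3 * h + 2 * n + \sum_(i < h) tnth m i)%N%:Z - 6.

End Strata.

Arguments strata {R g h n m} S _ : rename.

Section Polytopes.
Variables (R : realType) (d : nat).

Definition convex_polytope (P : set 'rV[R]_d) : Prop :=
  exists (k : nat) (v : 'I_k.+1 -> 'rV[R]_d),
    P = [set x | exists w : 'I_k.+1 -> R,
           [/\ forall i, 0 <= w i, \sum_i w i = 1 & x = \sum_i w i *: v i]].

(* The choice [a = 0], [b = 0] makes [P] a face of itself. *)
Definition nonempty_faces (P : set 'rV[R]_d) : set (set 'rV[R]_d) :=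
  [set F | F !=set0 /\
     exists (a : 'rV[R]_d) (b : R),
       (forall x, P x -> (x *m a^T) 0 0 <= b) /\
       F = [set x | P x /\ (x *m a^T) 0 0 = b]].

(* The largest number of linearly independent vectors (rows of [V]) joining a
   point of [F] to other points of [F]. *)
Definition affine_dim (F : set 'rV[R]_d) (k : nat) : Prop :=
  let realized j := exists (x : 'rV[R]_d) (V : 'M[R]_(j, d)),
    [/\ F x, forall i, F (x + row i V) & row_free V] in
  realized k /\ forall j, realized j -> (j <= k)%N.

End Polytopes.

(* The strata of the moduli space only depend on the topological type, so they
   are read off from a single surface [S] of that type. *)
Definition moduli_polytopal (R : realType) (g h n : nat) (m : h.-tuple nat)
    (S : marked_surface R g n m) : Prop :=
  exists (d : nat) (P : set 'rV[R]_d)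
         (Phi : set (set (set (set S))) -> set 'rV[R]_d),
    [/\ convex_polytope P,
        set_bij (strata S) (nonempty_faces P) Phi,
        forall X Y, strata S X -> strata S Y ->
          (stratum_le X Y <-> Phi X `<=` Phi Y) &
        forall A : set (set (set S)), curve_system A ->
          exists2 k : nat, affine_dim (Phi (stratum_of A)) k &
            k%:Z = moduli_dim g n m - (system_weight A)%:Z].

(* Main.v *)
Require Import Defs.
From HB Require Import structures.
From mathcomp Require Import all_boot all_order all_algebra complex.
From mathcomp Require Import all_classical all_reals all_analysis.
From mathcomp Require Import ring lra zify.

(** The point is that a 2-loop obstructs polytopality. A 2-loop alone is a curve
    system of weight two, so its stratum has codimension two, and the only
    systems contained in it are itself and the empty one: no stratum lies
    strictly between it and the whole space. In a polytope every face of
    codimension two lies in a facet ([intermediate_face]), so a surface with a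
    2-loop has no polytopal moduli space ([two_loop_not_polytopal]). It remains
    to find a 2-loop on every surface that is not excluded; the types with no
    boundary, genus zero and at most two punctures need no loop, because their
    formal dimension is negative ([polytopal_dim]).

    Loops are drawn on the closed surface obtained by collapsing each boundary
    circle to a point ([capped]). That it is a surface near the collapsed points
    rests on a collar of the boundary ([collar]). On it punctures and boundary
    circles both become points, here called features, and homeomorphisms act
    transitively off any finite set that they fix ([homogeneous_seq]).

    When there are enough features, the loop is a small circle around a boundary
    circle with marked points, or a circle around two of at least four features
    ([enclose_point], [enclose_pair]). It cannot be deformed close to a point or
    to an unmarked boundary circle, because a continuum avoiding that target
    would connect features on its two sides ([sided_two_loop]).

    In positive genus the loop is a curve of a cut system, moved off the
    punctures. It does not separate the surface, whereas a circle in a disc of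
    the capped surface separates by the Jordan curve theorem
    ([jordan_embedded]); this is proved by gluing the two determinations of the
    angle under which the two arcs of the circle are seen. *)

Set Implicit Arguments.
Unset Strict Implicit.
Unset Printing Implicit Defensive.

Import Order.TTheory GRing.Theory Num.Theory numFieldNormedType.Exports.
Local Open Scope classical_set_scope.
Local Open Scope ring_scope.

(** * Connectedness *)

Section GeneralTopology.
Variables T U : topologicalType.

Lemma closed_within_preimage (K : set T) (f : T -> U) (C : set U) :
  closed K -> {within K, continuous f} -> closed C -> closed (K `&` f @^-1` C).
Proof.
move=> cK cf cC; rewrite closed_setSI//.
exact: (@preimage_closed _ _ (f : subspace K -> U)).
Qed.

Lemma open_within_preimage (V : set T) (f : T -> U) (W : set U) :
  open V -> {within V, continuous f} -> open W -> open (V `&` f @^-1` W).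
Proof.
move=> oV cf oW; rewrite open_setSI//.
by move/continuousP : cf => /(_ _ oW).
Qed.

Lemma closed_image_compact (K C : set T) (f : T -> U) :
  hausdorff_space U -> compact K -> closed K -> {within K, continuous f} ->
  closed C -> closed (f @` (K `&` C)).
Proof.
move=> hU kK cK cf cC; apply: compact_closed => //.
apply: continuous_compact; first by apply: continuous_subspaceW cf => x [].
by apply: compact_closedI.
Qed.

(** The form in which connectedness is used below: it avoids relatively open
    and relatively closed sets. *)
Lemma connectedE2 (A : set T) : connected A <->
  forall O1 O2, open O1 -> open O2 -> A `&` O1 `&` O2 = set0 ->
    A `<=` O1 `|` O2 -> A `<=` O1 \/ A `<=` O2.
Proof.
split=> [cA O1 O2 o1 o2 dj AO|H B B0 [C oC BC] [D cD BD]].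
- have [[x [Ax O1x]]|N] := pselect (A `&` O1 !=set0); last first.
    by right=> x Ax; case: (AO _ Ax) => // O1x; exfalso; apply: N; exists x.
  left; suff -> : A = A `&` O1 by apply: subIsetr.
  symmetry; apply: cA; first by exists x.
  - by exists O1.
  - exists (~` O2); first exact: open_closedC.
    apply/seteqP; split=> y [Ay].
    + by move=> O1y; split=> // O2y; have : set0 y by rewrite -dj.
    + by move=> NO2; split=> //; case: (AO _ Ay).
- have [||||AC|AD] := H C (~` D).
  + by [].
  + exact: closed_openC.
  + apply/seteqP; split=> // y [ACy ND]; apply: ND.
    by move: ACy; rewrite -BC BD => -[].
  + move=> y Ay; have [Dy|] := pselect (D y); last by right.
    have By : B y by rewrite BD.
    by left; move: By; rewrite BC => -[_ Cy].
  + by rewrite BC; apply/seteqP; split=> [y []//|y Ay]; split=> //; apply: AC.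
  + case: B0 => y; rewrite BD => -[Ay Dy]; by have := AD _ Ay.
Qed.

(** Applied to two relations with open classes: being exchanged by a
    homeomorphism, and lying on a common continuum. *)
Lemma connected_rel (W : set T) (r : T -> T -> Prop) :
  open W -> connected W ->
  (forall x, W x -> r x x) ->
  (forall x y, r x y -> r y x) ->
  (forall x y z, r x y -> r y z -> r x z) ->
  (forall x, W x -> exists N, [/\ open N, N x & forall y, N y -> W y -> r x y]) ->
  forall x y, W x -> W y -> r x y.
Proof.
move=> oW cW rxx rs rt rl x y Wx Wy.
pose O (P : set T) := \bigcup_(N in [set N | open N /\ N `&` W `<=` P]) N.
have oO P : open (O P) by apply: bigcup_open => N [].
have OP P z : W z -> O P z -> P z by move=> Wz [N [_ NP] Nz]; apply: NP.
move/connectedE2 : cW => /(_ (O [set z | r x z]) (O [set z | ~ r x z])).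
case=> //.
- apply/seteqP; split=> // z [[Wz O1] O2].
  exact: (OP _ _ Wz O2 (OP _ _ Wz O1)).
- move=> z Wz; have [N [oN Nz Nr]] := rl _ Wz.
  have [xz|xz] := pselect (r x z).
  + left; exists N => //; split=> // t [Nt Wt]; apply: rt xz _; exact: Nr.
  + right; exists N => //; split=> // t [Nt Wt] xt; apply: xz.
    by apply: rt xt _; apply: rs; exact: Nr.
- by move=> /(_ _ Wy); exact: OP.
- by move=> /(_ _ Wx)/(OP _ _ Wx); case; exact: rxx.
Qed.

(** Two open sets that cover [A] minus [Z] grow to open sets that cover [A],
    since a small neighbourhood minus [Z] lies on one side. They stay disjoint
    because [Z] has empty interior. *)
Lemma connected_setD (A Z : set T) :
  open A -> connected A ->
  (forall N, open N -> N `<=` A -> N !=set0 -> N `\` Z !=set0) ->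
  (forall z, A z -> exists N, [/\ open N, N z, N `<=` A & connected (N `\` Z)]) ->
  connected (A `\` Z).
Proof.
move=> oA cA dZ lZ; apply/connectedE2 => O1 O2 o1 o2 dj AO.
pose O (P : set T) := \bigcup_(N in [set N | [/\ open N, N `<=` A & N `\` Z `<=` P]]) N.
have oO P : open (O P) by apply: bigcup_open => N [].
have OP P z : open P -> (A `\` Z) z -> O P z -> P z.
  by move=> oP [Az Zz] [N [_ _ NP] Nz]; apply: NP.
move/connectedE2 : cA => /(_ (O O1) (O O2)); case=> //.
- apply/seteqP; split=> // z [[Az [N1 [oN1 N1A N1O] N1z]] [N2 [oN2 N2A N2O] N2z]].
  have [|||y [[N1y N2y] Zy]] := dZ (N1 `&` N2).
  + exact: openI.
  + by move=> t [] /N1A.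
  + by exists z.
  + suff : set0 y by [].
    rewrite -dj; split; last by apply: N2O.
    by split; [split => //; exact: N1A|apply: N1O].
- move=> z Az; have [N [oN Nz NA cN]] := lZ _ Az.
  move/connectedE2 : cN => /(_ O1 O2 o1 o2) [||H|H].
  + apply/seteqP; split=> // t [[[Nt Zt] O1t] O2t].
    suff : set0 t by [].
    rewrite -dj; split=> //.
    by split=> //; split => //; exact: NA.
  + by move=> t [/NA At Zt]; apply: AO.
  + by left; exists N.
  + by right; exists N.
- by move=> H; left=> z Az; apply: OP => //; apply: H; case: Az.
- by move=> H; right=> z Az; apply: OP => //; apply: H; case: Az.
Qed.

(** Lying on a common continuum is an equivalence relation with open classes. *)
Lemma connected_chain (W : set T) :
  open W -> connected W ->
  (forall x, W x -> exists N, [/\ open N, N x & forall y, N y -> W y ->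
     exists K, [/\ closed K, connected K, K `<=` W, K x & K y]]) ->
  forall s : seq T, (forall x, x \in s -> W x) ->
  exists K, [/\ closed K, connected K, K `<=` W & forall x, x \in s -> K x].
Proof.
move=> oW cW lW.
have H : forall x y, W x -> W y ->
     exists K, [/\ closed K, connected K, K `<=` W, K x & K y].
  apply: (@connected_rel W (fun x y => exists K,
     [/\ closed K, connected K, K `<=` W, K x & K y])) => //.
  - move=> x Wx; have [N [oN Nx /(_ x Nx Wx)]] := lW _ Wx; exact.
  - by move=> x y [K [*]]; exists K.
  - move=> x y z [K [cK kK KW Kx Ky]] [L [cL kL LW Ly Lz]].
    exists (K `|` L); split; [exact: closedU| |by rewrite subUset|by left|by right].
    by apply: connectedU => //; exists y.
elim=> [|a s IH] sW.
  by exists set0; split=> //; [exact: closed0|exact: connected0].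
case: IH => [x xs|K [cK kK KW Ks]]; first by apply: sW; rewrite inE xs orbT.
case: s sW Ks => [|b s] sW Ks.
  have Wa : W a by apply: sW; rewrite mem_head.
  have [L [cL kL LW La _]] := H _ _ Wa Wa.
  by exists L; split => // x; rewrite inE => /eqP ->.
have Wa : W a by apply: sW; rewrite mem_head.
have Wb : W b by apply: sW; rewrite !inE eqxx orbT.
have [L [cL kL LW La Lb]] := H _ _ Wa Wb.
exists (K `|` L); split; [exact: closedU| |by rewrite subUset|].
  by apply: connectedU => //; exists b; split=> //; apply: Ks; rewrite mem_head.
by move=> x; rewrite inE => /orP[/eqP->|xs]; [right|left; exact: Ks].
Qed.

End GeneralTopology.

(** * Squares and homeomorphisms of surfaces *)

Section WithinComp.
Variables T U V : topologicalType.

Lemma within_comp (K : set T) (L : set U) (f : T -> U) (g : U -> V) :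
  {within K, continuous f} -> {within L, continuous g} ->
  (forall x, K x -> L (f x)) -> {within K, continuous (g \o f)}.
Proof.
move=> cf cg KL; apply/continuousP => W oW.
have /open_subspaceP[W' oW' W'L] : open (g @^-1` W : set (subspace L)).
  by move/continuousP : cg => /(_ _ oW).
have /open_subspaceP[W'' oW'' W''K] : open (f @^-1` W' : set (subspace K)).
  by move/continuousP : cf => /(_ _ oW').
apply/open_subspaceP; exists W'' => //; rewrite W''K.
apply/seteqP; split=> x [/= fx Kx]; split=> //.
- have : (W' `&` L) (f x) by split => //; exact: KL.
  by rewrite W'L => -[].
- have : (g @^-1` W `&` L) (f x) by split => //; exact: KL.
  by rewrite -W'L => -[].
Qed.

Lemma within_pair (K : set T) (f : T -> U) (g : T -> V) :
  {within K, continuous f} -> {within K, continuous g} ->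
  {within K, continuous (fun x => (f x, g x))}.
Proof. by move=> cf cg x; apply: cvg_pair; [exact: cf|exact: cg]. Qed.

End WithinComp.

Section Cts.
Variables (T : topologicalType) (R : realType).
Implicit Types f g : T -> R.

Lemma ctsD f g : continuous f -> continuous g -> continuous (fun x => f x + g x).
Proof. by move=> cf cg x; apply: cvgD; [exact: cf|exact: cg]. Qed.

Lemma ctsB f g : continuous f -> continuous g -> continuous (fun x => f x - g x).
Proof. by move=> cf cg x; apply: cvgB; [exact: cf|exact: cg]. Qed.

Lemma ctsM f g : continuous f -> continuous g -> continuous (fun x => f x * g x).
Proof. by move=> cf cg x; apply: cvgM; [exact: cf|exact: cg]. Qed.

Lemma ctsN f : continuous f -> continuous (fun x => - f x).
Proof. by move=> cf x; apply: cvgN; exact: cf. Qed.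

Lemma ctsnorm f : continuous f -> continuous (fun x => `|f x|).
Proof. by move=> cf x; apply: cvg_norm; exact: cf. Qed.

Lemma ctsc (U : topologicalType) (k : U) : continuous (fun _ : T => k).
Proof. by move=> x; exact: cvg_cst. Qed.

Lemma ctspair (U V : topologicalType) (f : T -> U) (g : T -> V) :
  continuous f -> continuous g -> continuous (fun x => (f x, g x)).
Proof. by move=> cf cg x; apply: cvg_pair; [exact: cf|exact: cg]. Qed.

Lemma ctscomp (U V : topologicalType) (f : T -> U) (g : U -> V) :
  continuous f -> continuous g -> continuous (fun x => g (f x)).
Proof. by move=> cf cg x; apply: continuous_comp; [exact: cf|exact: cg]. Qed.

Lemma ctsfst (U V : topologicalType) (f : T -> U * V) :
  continuous f -> continuous (fun x => (f x).1).
Proof. by move=> cf x; apply: cvg_comp (cf x) _; exact: cvg_fst. Qed.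

Lemma ctssnd (U V : topologicalType) (f : T -> U * V) :
  continuous f -> continuous (fun x => (f x).2).
Proof. by move=> cf x; apply: cvg_comp (cf x) _; exact: cvg_snd. Qed.

Lemma ctsid : continuous (fun x : T => x).
Proof. by move=> x. Qed.

Lemma ctspnorm (f : T -> R * R) : continuous f -> continuous (fun x => `|f x|).
Proof. by move=> cf x; apply: cvg_norm; exact: cf. Qed.

End Cts.

Ltac cts_step := match goal with
  | _ => assumption
  | |- forall y, continuous_at y ?h => lazymatch h with
    | fst => by move=> ?; exact: cvg_fst
    | snd => by move=> ?; exact: cvg_snd
    | Num.norm => by move=> ?; exact: norm_continuous
    | (fun x => x) => exact: ctsid
    | (fun _ => ?k) => exact: ctsc
    | (fun x => (_, _)) => apply: ctspair
    | (fun x => fst _) => apply: ctsfst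
    | (fun x => snd _) => apply: ctssnd
    | (fun x => GRing.add _ (GRing.opp _)) => apply: ctsB
    | (fun x => GRing.add _ _) => apply: ctsD
    | (fun x => GRing.mul _ _) => apply: ctsM
    | (fun x => GRing.opp _) => apply: ctsN
    | (fun x => Num.norm _) => first [apply: ctsnorm | apply: ctspnorm]
    end
  end.

Ltac cts := repeat cts_step.

Section Plane.
Variable R : realType.
Local Notation P := (R * R)%type.
Implicit Types p q : P.

Lemma pnormE p : `|p| = Num.max `|p.1| `|p.2|. Proof. by []. Qed.

Lemma pnorm_le p (r : R) : (`|p| <= r) = (`|p.1| <= r) && (`|p.2| <= r).
Proof. by rewrite pnormE ge_max. Qed.

Lemma pnorm_lt p (r : R) : (`|p| < r) = (`|p.1| < r) && (`|p.2| < r).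
Proof. by rewrite pnormE gt_max. Qed.

(** The norm of [R * R] is the maximum norm, so its balls are squares. *)
Definition square : set P := [set p | `|p| <= 1].
Definition open_square : set P := [set p | `|p| < 1].

Lemma open_square_sub : open_square `<=` square. Proof. by move=> p; rewrite /open_square/square/=; exact: ltW. Qed.

Lemma compact_square : compact square.
Proof.
have -> : square = `[-1, 1]%classic `*` `[-1, 1]%classic.
  apply/seteqP; split=> p; rewrite /square /= pnorm_le !in_itv/= !ler_norml.
    by move=> /andP[].
  by case=> -> ->.
by apply: compact_setX; exact: segment_compact.
Qed.

Lemma hausdorff_plane : hausdorff_space P.
Proof. exact: norm_hausdorff. Qed.

Lemma closed_square : closed square.
Proof. by apply: compact_closed; [exact: hausdorff_plane|exact: compact_square]. Qed.

Lemma open_open_square : open open_square.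
Proof.
have -> : open_square = (fun p : P => `|p|) @^-1` [set x | x < 1] by [].
by apply: open_comp; [move=> p _; apply: ctspnorm; cts|exact: open_lt].
Qed.

Lemma star_connected (A : set P) p :
  A p -> (forall q t, A q -> 0 <= t <= 1 -> A (p + t *: (q - p))) -> connected A.
Proof.
move=> Ap st.
pose seg q := (fun t : R => p + t *: (q - p)) @` `[0, 1]%classic.
have -> : A = \bigcup_(q in A) seg q.
  apply/seteqP; split=> [q Aq|q [r Ar [t]]].
    exists q => //; exists 1; first by rewrite /= in_itv/= ler01 lexx.
    by rewrite scale1r addrC subrK.
  by rewrite /= in_itv/= => t01 <-; exact: st.
apply: bigcup_connected.
  exists p => q Aq; exists 0; first by rewrite /= in_itv/= ler01 lexx.
  by rewrite scale0r addr0.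
move=> q Aq; apply: connected_continuous_connected.
  exact: segment_connected.
apply: continuous_subspaceT.
have H : continuous (fun t : R => (p.1 + t * (q.1 - p.1), p.2 + t * (q.2 - p.2)))
  by cts.
exact: H.
Qed.

Lemma connected_open_square : connected open_square.
Proof.
apply: (@star_connected _ 0); first by rewrite /open_square/= normr0.
move=> q t qo /andP[t0 t1]; rewrite subr0 add0r /open_square /= normrZ ger0_norm//.
apply: le_lt_trans qo; exact: ler_piMl.
Qed.


Lemma conv_lt (x y t b : R) :
  x < b -> y < b -> 0 <= t <= 1 -> x + t * (y - x) < b.
Proof.
move=> xb yb /andP[]; rewrite le_eqVlt => /orP[/eqP<-|t0] t1.
  by rewrite mul0r addr0.
by have : 0 < t * (b - y); [apply: mulr_gt0 => //; lra|nra].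
Qed.

Lemma conv_gt (x y t b : R) :
  b < x -> b < y -> 0 <= t <= 1 -> b < x + t * (y - x).
Proof.
move=> xb yb t01; have := @conv_lt (- x) (- y) t (- b).
rewrite !ltrN2 => /(_ xb yb t01); rewrite -ltrN2 => /=; lra.
Qed.

Lemma conv_ge (x y t b : R) :
  b <= x -> b <= y -> 0 <= t <= 1 -> b <= x + t * (y - x).
Proof. by move=> ? ? /andP[? ?]; nra. Qed.

Lemma conv_le (x y t b : R) :
  x <= b -> y <= b -> 0 <= t <= 1 -> x + t * (y - x) <= b.
Proof. by move=> ? ? /andP[? ?]; nra. Qed.

Ltac split_all := do ?split; try (apply/andP; split; apply/andP; split).

Ltac convex_piece c :=
  apply: (@star_connected _ c);
  [ by rewrite /= pnorm_lt /= !ltr_norml; split_all; lra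
  | move=> q t; rewrite /= !pnorm_lt /= !ltr_norml;
    move=> [/andP[/andP[? ?] /andP[? ?]] ?] ?; split_all;
    first [apply: conv_lt|apply: conv_gt]; by [|lra] ].

(** Four overlapping half squares cover the punctured square. *)
Lemma connected_punctured_square : connected (open_square `\` [set 0]).
Proof.
pose A1 : set P := [set p | `|p| < 1 /\ 0 < p.1].
pose A2 : set P := [set p | `|p| < 1 /\ 0 < p.2].
pose A3 : set P := [set p | `|p| < 1 /\ p.1 < 0].
pose A4 : set P := [set p | `|p| < 1 /\ p.2 < 0].
have c1 : connected A1 by rewrite /A1; convex_piece (2^-1 : R, 0 : R).
have c2 : connected A2 by rewrite /A2; convex_piece (0 : R, 2^-1 : R).
have c3 : connected A3 by rewrite /A3; convex_piece (- 2^-1 : R, 0 : R).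
have c4 : connected A4 by rewrite /A4; convex_piece (0 : R, - 2^-1 : R).
have -> : open_square `\` [set 0] = ((A1 `|` A2) `|` A3) `|` A4.
  apply/seteqP; split=> p; rewrite /open_square /=.
    move=> [p1 p0]; have [a|a|a] := ltgtP p.1 0; first by left; right.
      by left; left; left.
    have [b|b|b] := ltgtP p.2 0; first by right.
      by left; left; right.
    by exfalso; apply: p0; case: p a b {p1} => x y /= -> ->.
  by case=> [[[]|]|] [p1 H]; split=> // p0; move: H; rewrite p0 /= ltxx.
have w (a b : R) : a \in [:: 2^-1; - 2^-1] -> b \in [:: 2^-1; - 2^-1] -> `|(a, b)| < 1.
  rewrite !inE pnorm_lt /= !ltr_norml => /orP[]/eqP-> /orP[]/eqP->;
  apply/andP; split; apply/andP; split; lra.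
have h1 : 2^-1 \in [:: 2^-1; - 2^-1 : R] by rewrite !inE eqxx.
have h2 : - 2^-1 \in [:: 2^-1; - 2^-1 : R] by rewrite !inE eqxx orbT.
apply: connectedU => //.
  exists (2^-1, - 2^-1); split; last by split; [exact: w|rewrite /=; lra].
  by left; left; split; [exact: w|rewrite /=; lra].
apply: connectedU => //.
  exists (- 2^-1, 2^-1); split; last by split; [exact: w|rewrite /=; lra].
  by right; split; [exact: w|rewrite /=; lra].
apply: connectedU => //.
exists (2^-1, 2^-1); split; by split; [exact: w|rewrite /=; lra].
Qed.

(** The homeomorphism of the square that fixes the edges, sends the centre to
    [a] and is affine on each radius. *)
Definition push (a p : P) : P := p + (1 - `|p|) *: a.

Lemma push_cts a : continuous (push a).
Proof.
have H : continuous (fun p : P => (p.1 + (1 - `|p|) * a.1, p.2 + (1 - `|p|) * a.2)).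
  by cts.
exact: H.
Qed.

Lemma push0 a : push a 0 = a.
Proof. by rewrite /push normr0 subr0 scale1r add0r. Qed.

Lemma push_edge a p : `|p| = 1 -> push a p = p.
Proof. by move=> p1; rewrite /push p1 subrr scale0r addr0. Qed.

(** The map differs from the identity by a strict contraction, hence it is
    injective. The norm of a preimage of [y] is a solution [r] of
    [`|y - (1 - r) *: a| = r], which exists by the intermediate value theorem. *)
Lemma push_bij a : `|a| < 1 -> set_bij square square (push a).
Proof.
move=> a1; split.
- move=> p; rewrite /square /= => p1; rewrite /push.
  have p0 : 0 <= 1 - `|p| by lra.
  apply: le_trans (ler_normD _ _) _; rewrite normrZ ger0_norm//.
  by have : 0 <= `|p| by []; have : 0 <= `|a| by []; nra.
- move=> p q _ _ E; apply/eqP; rewrite -subr_eq0 -normr_le0.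
  have {}E : p - q = (`|p| - `|q|) *: a.
    have E1 : p.1 + (1 - `|p|) * a.1 = q.1 + (1 - `|q|) * a.1 by exact: (congr1 fst E).
    have E2 : p.2 + (1 - `|p|) * a.2 = q.2 + (1 - `|q|) * a.2 by exact: (congr1 snd E).
    apply: (@eq_trans _ _ ((`|p| - `|q|) * a.1, (`|p| - `|q|) * a.2)) => //.
    by rewrite -[LHS]/(p.1 - q.1, p.2 - q.2); congr pair; lra.
  have : `|p - q| <= `|p - q| * `|a|.
    by rewrite {1}E normrZ ler_wpM2r// ler_dist_dist.
  have : 0 <= `|p - q| by []. nra.
- move=> y; rewrite /square /= => y1.
  pose g (r : R) := `|y - (1 - r) *: a| - r.
  have cg : continuous g.
    have H : continuous (fun r : R => `|(y.1 - (1 - r) * a.1, y.2 - (1 - r) * a.2)| - r).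
      by apply: ctsB; [apply: ctspnorm; cts|cts].
    exact: H.
  have [||r] := @IVT R g 0 1 0 ler01; first exact: continuous_subspaceT.
    rewrite /g !subr0 subrr scale0r subr0 ge_min le_max; apply/andP; split.
      by apply/orP; right; lra.
    by apply/orP; left.
  rewrite in_itv/= => /andP[r0 r1] /eqP; rewrite /g subr_eq0 => /eqP gr.
  exists (y - (1 - r) *: a); first by rewrite /= gr.
  by rewrite /push gr subrK.
Qed.

End Plane.
Arguments square R : clear implicits.
Arguments open_square R : clear implicits.

Section SquareEmbeddings.
Variables (R : realType) (X : topologicalType).
Hypothesis hX : hausdorff_space X.
Local Notation P := (R * R)%type.
Local Notation square := (square R).
Local Notation open_square := (open_square R).
Implicit Types (psi : P -> X).

(** The inverse of a chart, on a closed square whose compactness replaces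
    continuity of the chart itself. *)
Definition square_embedding psi : Prop :=
  [/\ {within square, continuous psi}, set_inj square psi & open (psi @` open_square)].

Lemma square_embedding_closed psi (C : set P) : square_embedding psi -> closed C ->
  closed (psi @` (square `&` C)).
Proof.
case=> c _ _; apply: closed_image_compact => //; [exact: compact_square|exact: closed_square].
Qed.

Lemma square_embedding_open psi (V : set P) : square_embedding psi -> open V -> V `<=` open_square ->
  open (psi @` V).
Proof.
move=> psiE oV Vo; have [c i o] := psiE.
have -> : psi @` V = psi @` open_square `&` ~` (psi @` (square `&` ~` V)).
  apply/seteqP; split=> [_ [p Vp <-]|_ [[p po <-] N]].
    split; first by exists p => //; exact: Vo.
    move=> [q [qs qV] /i E]; apply: qV; rewrite E ?inE//.
    by apply: open_square_sub; exact: Vo.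
  exists p => //; apply: contrapT => Vp; apply: N; exists p => //.
  by split=> //; exact: open_square_sub.
by apply: openI => //; apply/closed_openC/square_embedding_closed => //; exact: open_closedC.
Qed.

Lemma square_embedding_at psi p0 (U : set X) : square_embedding psi -> open_square p0 -> open U -> U (psi p0) ->
  exists e : R, [/\ 0 < e,
    forall p, square p -> open_square (p0 + e *: p) /\ U (psi (p0 + e *: p)) &
    square_embedding (fun p => psi (p0 + e *: p))].
Proof.
move=> psiE p0o oU Up0; have [c i o] := psiE.
have oW : open (open_square `&` psi @^-1` U).
  apply: open_within_preimage => //; first exact: open_open_square.
  by apply: continuous_subspaceW c; exact: open_square_sub.
have : nbhs p0 (open_square `&` psi @^-1` U) by apply: open_nbhs_nbhs; split.
move=> /nbhs_ballP[d /= d0 dW].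
have H p : square p -> (open_square `&` psi @^-1` U) (p0 + (d / 2) *: p).
  move=> ps; apply: dW; rewrite -ball_normE /= opprD addNKr normrN normrZ.
  rewrite ger0_norm; last by lra.
  have {}ps : `|p| <= 1 by exact: ps.
  have : 0 <= `|p| by []. nra.
exists (d / 2); split=> //; first by lra.
have cA : continuous (fun p : P => p0 + (d / 2) *: p).
  have : continuous (fun p : P => (p0.1 + (d / 2) * p.1, p0.2 + (d / 2) * p.2)) by cts.
  exact.
split.
- apply: (@within_comp _ _ _ square square (fun p => p0 + (d / 2) *: p) psi) => //.
    exact: continuous_subspaceT.
  by move=> p /H[] /open_square_sub.
- move=> p q; rewrite !inE => ps qs /i; rewrite !inE => E.
  have {}E : (d / 2) *: p = (d / 2) *: q.
    by apply: (@addrI _ p0); apply: E; apply/open_square_sub; [case: (H _ ps)|case: (H _ qs)].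
  have d2 : d / 2 != 0 by apply/eqP; lra.
  have := congr1 (fun x => (d / 2)^-1 *: x) E.
  by rewrite !scalerA mulVf// !scale1r.
- rewrite -(image_comp (fun p => p0 + (d / 2) *: p) psi).
  apply: square_embedding_open => //; last by move=> _ [p po <-]; case: (H p (open_square_sub po)).
  have -> : (fun p => p0 + (d / 2) *: p) @` open_square =
      (fun p => (d / 2)^-1 *: (p - p0)) @^-1` open_square.
    have d2 : d / 2 != 0 by apply/eqP; lra.
    apply/seteqP; split=> [_ [p po <-]|p po]; rewrite /preimage /=.
      by rewrite addrC addKr scalerA mulVf// scale1r.
    exists ((d / 2)^-1 *: (p - p0)) => //.
    by rewrite scalerA divff// scale1r addrC subrK.
  apply: open_comp; last exact: open_open_square.
  have cB : continuous (fun p : P => ((d / 2)^-1 * (p.1 - p0.1), (d / 2)^-1 * (p.2 - p0.2))) by cts.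
  by move=> p _; exact: cB.
Qed.

(** Self-maps of the square that fix its edges are carried to the surface and
    extended by the identity. *)
Definition transplant psi (tau : P -> P) (x : X) : X :=
  if pselect (exists2 p, square p & psi p = x) is left h
  then psi (tau (s2val (cid2 h))) else x.

Lemma transplant_in psi tau p : set_inj square psi -> square p ->
  transplant psi tau (psi p) = psi (tau p).
Proof.
move=> i ps; rewrite /transplant; case: pselect => [h|[]]; last by exists p.
by case: (cid2 h) => /= q qs /i ->; rewrite ?inE.
Qed.

Lemma transplant_out psi tau x : set_inj square psi ->
  (forall p, `|p| = 1 -> tau p = p) -> ~ (psi @` open_square) x -> transplant psi tau x = x.
Proof.
move=> i te nx; rewrite /transplant; case: pselect => //= h.
case: (cid2 h) => /= p ps E; rewrite -E te //; apply/eqP.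
rewrite eq_le ps /= leNgt; apply/negP => p1; apply: nx; exists p => //.
Qed.

(** The preimage of a closed set is the image of a compact set together with a
    closed part outside the open square. *)
Lemma transplant_cts psi tau : square_embedding psi -> {within square, continuous tau} ->
  (forall p, square p -> square (tau p)) -> (forall p, `|p| = 1 -> tau p = p) ->
  continuous (transplant psi tau).
Proof.
move=> psiE ct ts te; have [c i o] := psiE.
apply/continuous_closedP => C cC.
have -> : transplant psi tau @^-1` C =
   psi @` (square `&` (square `&` (psi \o tau) @^-1` C)) `|` (C `&` ~` (psi @` open_square)).
  apply/seteqP; split=> [x|x].
    rewrite /preimage /=; have [[p ps <-]|nx] := pselect ((psi @` square) x).
      by rewrite transplant_in// => Cp; left; exists p.
    rewrite transplant_out//; last by move=> [p /open_square_sub ps E]; apply: nx; exists p.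
    by move=> Cx; right; split=> // -[p /open_square_sub ps E]; apply: nx; exists p.
  case=> [[p [ps [_ /= Cp]] <-]|[Cx nx]]; rewrite /preimage /=.
    by rewrite transplant_in.
  by rewrite transplant_out.
apply: closedU; last by apply: closedI => //; exact: open_closedC.
apply: square_embedding_closed => //; apply: closed_within_preimage => //; first exact: closed_square.
exact: within_comp ct c ts.
Qed.

Lemma square_homeo psi tau : square_embedding psi -> continuous tau -> set_bij square square tau ->
  (forall p, `|p| = 1 -> tau p = p) ->
  exists f, [/\ homeo f, forall p, square p -> f (psi p) = psi (tau p) &
    forall x, ~ (psi @` open_square) x -> f x = x].
Proof.
move=> psiE ct [tf ti ts] te; have [c i o] := psiE.
pose tau' p := if pselect (exists2 q, square q & tau q = p) is left h
  then s2val (cid2 h) else p.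
have tauK p : square p -> tau' (tau p) = p.
  move=> ps; rewrite /tau'; case: pselect => [h|[]]; last by exists p.
  by case: (cid2 h) => /= q qs /ti ->; rewrite ?inE.
have tau'K p : square p -> square (tau' p) /\ tau (tau' p) = p.
  move=> ps; rewrite /tau'; case: pselect => [h|[]]; last exact: ts.
  by case: (cid2 h).
have te' p : `|p| = 1 -> tau' p = p.
  by move=> p1; rewrite -{1}(te p p1) tauK// /square /= p1.
have ct' : {within square, continuous tau'}.
  apply/continuous_closedP => C cC; rewrite -(@closed_setSI _ square); last exact: closed_square.
  have -> : square `&` tau' @^-1` C = tau @` (square `&` C).
    apply/seteqP; split=> [p [ps /= Cp]|_ [p [ps Cp] <-]].
      by exists (tau' p); have [] := tau'K p ps.
    by split; [exact: tf|rewrite /preimage/= tauK].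
  apply: (@closed_image_compact P P square C tau (@hausdorff_plane R)) => //.
  - exact: compact_square.
  - exact: closed_square.
  - exact: continuous_subspaceT.
exists (transplant psi tau); split.
- exists (transplant psi tau'); split.
  + by apply: transplant_cts => //; exact: continuous_subspaceT.
  + by apply: transplant_cts => // p /tau'K[].
  + move=> x; have [[p ps <-]|nx] := pselect ((psi @` square) x).
      rewrite transplant_in// transplant_in ?tauK//; exact: tf.
    have nx' : ~ (psi @` open_square) x by move=> [p /open_square_sub ps E]; apply: nx; exists p.
    by rewrite [X in transplant _ _ X]transplant_out// transplant_out.
  + move=> x; have [[p ps <-]|nx] := pselect ((psi @` square) x).
      have [q1 q2] := tau'K p ps.
      by rewrite transplant_in// transplant_in ?q2.
    have nx' : ~ (psi @` open_square) x by move=> [p /open_square_sub ps E]; apply: nx; exists p.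
    by rewrite [X in transplant _ _ X]transplant_out// transplant_out.
- by move=> p ps; rewrite transplant_in.
- by move=> x nx; rewrite transplant_out.
Qed.

End SquareEmbeddings.

Section Homeos.
Variable X : topologicalType.

Lemma homeo_id : homeo (@id X).
Proof. by exists id; split=> //; exact: ctsid. Qed.

Lemma homeo_comp (f g : X -> X) : homeo f -> homeo g -> homeo (g \o f).
Proof.
move=> [f' [cf cf' fK f'K]] [g' [cg cg' gK g'K]]; exists (f' \o g').
split; [|exact: ctscomp cg' cf'| |].
- exact: ctscomp cf cg.
- by move=> x /=; rewrite gK fK.
- by move=> x /=; rewrite f'K g'K.
Qed.

Lemma homeo_inv (f g : X -> X) : continuous f -> continuous g ->
  cancel f g -> cancel g f -> homeo g.
Proof. by move=> *; exists f. Qed.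

Lemma homeo_inj (f : X -> X) : homeo f -> injective f.
Proof. by move=> [g [_ _ fK _]]; exact: can_inj fK. Qed.

Lemma homeo_cts (f : X -> X) : homeo f -> continuous f.
Proof. by case=> g []. Qed.

Lemma homeo_open (f : X -> X) (V : set X) : homeo f -> open V -> open (f @` V).
Proof.
move=> [g [cf cg fK gK]] oV.
have -> : f @` V = g @^-1` V.
  apply/seteqP; split=> [_ [x Vx <-]|x Vx]; first by rewrite /preimage/= fK.
  by exists (g x).
by apply: open_comp => // x _; exact: cg.
Qed.

Lemma homeo_setC (f : X -> X) (V : set X) : homeo f -> f @` (~` V) = ~` (f @` V).
Proof.
move=> [g [cf cg fK gK]]; apply/seteqP; split=> [_ [x Vx <-] [y Vy]|x nx].
  by move/(can_inj fK) => E; apply: Vx; rewrite -E.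
by exists (g x) => // Vx; apply: nx; exists (g x).
Qed.

End Homeos.

Section ClosedSurface.
Variables (R : realType) (X : topologicalType).

(** A connected surface without boundary. *)
Record boundaryless : Prop := Boundaryless {
  bl_hausdorff : hausdorff_space X;
  bl_connected : connected [set: X];
  bl_square : forall x, exists psi : R * R -> X, square_embedding psi /\ psi 0 = x
}.

Hypothesis bX : boundaryless.
Let hX := bl_hausdorff bX.

Lemma small_square x (U : set X) : open U -> U x ->
  exists psi : R * R -> X,
    [/\ square_embedding psi, psi 0 = x & forall p, square R p -> U (psi p)].
Proof.
move=> oU Ux; have [psi [psiE p0]] := bl_square bX x.
have o0 : open_square R 0 by rewrite /open_square /= normr0.
have [|e [e0 eU eE]] := square_embedding_at hX psiE o0 oU; first by rewrite p0.
by exists (fun p => psi (0 + e *: p)); split=> //; [rewrite scaler0 addr0|move=> p /eU[]].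
Qed.

(** Pushing the centre of small squares shows that the orbits of the
    homeomorphisms fixing the complement of [W] are open. *)
Lemma homogeneous (W : set X) : open W -> connected W ->
  forall x y, W x -> W y ->
  exists f, [/\ homeo f, f x = y & forall z, ~ W z -> f z = z].
Proof.
move=> oW cW; apply: (@connected_rel _ W (fun x y =>
  exists f, [/\ homeo f, f x = y & forall z, ~ W z -> f z = z])) => //.
- by move=> x _; exists id; split=> //; exact: homeo_id.
- move=> x y [f [[g [cf cg fK gK]] fx fz]]; exists g; split.
  + exact: homeo_inv cf cg fK gK.
  + by rewrite -fx fK.
  + by move=> z /fz E; rewrite -{1}E fK.
- move=> x y z [f [hf fx fz]] [g [hg gy gz]]; exists (g \o f); split.
  + exact: homeo_comp.
  + by rewrite /= fx gy.
  + by move=> t Wt /=; rewrite fz// gz.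
- move=> x Wx; have [psi [psiE p0 pW]] := small_square oW Wx.
  exists (psi @` open_square R); split; first by case: psiE.
    by exists 0 => //; rewrite /open_square /= normr0.
  move=> _ [a ao <-] _.
  have [f [hf fp fo]] := square_homeo hX psiE (@push_cts _ a) (push_bij ao) (@push_edge _ a).
  exists f; split=> //.
  + by rewrite -p0 fp ?push0// /square /= normr0.
  + by move=> z Wz; apply: fo => -[p /open_square_sub/pW ? E]; apply: Wz; rewrite -E.
Qed.

Lemma closed_point (x : X) : closed [set x].
Proof. exact/accessible_closed_set1/hausdorff_accessible. Qed.

Lemma connected_del (W : set X) (x : X) : open W -> connected W ->
  connected (W `\` [set x]).
Proof.
move=> oW cW; apply: connected_setD => //.
- move=> N oN NW [y Ny]; have [psi [[c i o] p0 pN]] := small_square oN Ny.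
  have [E|yx] := pselect (y = x); last by exists y.
  exists (psi (2^-1, 0)).
  have s : square R (2^-1, 0).
    by rewrite /square/= pnorm_le /= !ler_norml; apply/andP; split; apply/andP; split; lra.
  split; first exact: pN.
  rewrite -E -p0 => /i; rewrite !inE => /(_ s); rewrite /square/= normr0 => /(_ ler01).
  by move=> /(congr1 fst)/= /eqP; rewrite invr_eq0 pnatr_eq0.
- move=> z Wz; have [zx|zx] := pselect (z = x); last first.
    have oWx : open (W `\` [set x]).
      by rewrite setDE; apply: openI => //; exact/closed_openC/closed_point.
    have [|psi [psiE p0 pN]] := small_square oWx (x := z); first by split.
    have [c i o] := psiE.
    exists (psi @` open_square R); split=> //.
    + by exists 0 => //; rewrite /open_square/= normr0.
    + by move=> _ [p /open_square_sub/pN[? _] <-].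
    + have -> : psi @` open_square R `\` [set x] = psi @` open_square R.
        apply/seteqP; split=> [t []//|t tN]; split=> //.
        by case: tN => p /open_square_sub/pN[_ ?] <-.
      apply: connected_continuous_connected; first exact: connected_open_square.
      by apply: continuous_subspaceW c; exact: open_square_sub.
  have [psi [psiE p0 pN]] := small_square oW Wz.
  have [c i o] := psiE.
  exists (psi @` open_square R); split=> //.
  + by exists 0 => //; rewrite /open_square/= normr0.
  + by move=> _ [p /open_square_sub/pN ? <-].
  + have -> : psi @` open_square R `\` [set x] = psi @` (open_square R `\` [set 0]).
      rewrite -zx -p0; apply/seteqP; split=> [_ [[p po <-] np]|_ [p [po pn] <-]].
        by exists p => //; split=> // E; apply: np; rewrite E.
      split; first by exists p.
      move=> /i; rewrite !inE => /(_ (open_square_sub po)); rewrite /square/= normr0.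
      by move=> /(_ ler01).
    apply: connected_continuous_connected; first exact: connected_punctured_square.
    by apply: continuous_subspaceW c => p [/open_square_sub].
Qed.

Lemma open_delseq (s : seq X) : open (~` [set x | x \in s]).
Proof.
apply: closed_openC; elim: s => [|a s IH].
  have -> : [set x | x \in [::]] = (set0 : set X) by apply/seteqP; split=> x.
  exact: closed0.
have -> : [set x | x \in a :: s] = [set a] `|` [set x | x \in s].
  apply/seteqP; split=> x /=; rewrite inE; first by move=> /orP[/eqP|]; [left|right].
  by move=> [->|->]; rewrite ?eqxx ?orbT.
by apply: closedU => //; exact: closed_point.
Qed.

Lemma connected_delseq (s : seq X) : connected (~` [set x | x \in s]).
Proof.
elim: s => [|a s IH].
  have -> : ~` [set x | x \in [::]] = [set: X] by apply/seteqP; split=> x.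
  exact: bl_connected.
have -> : ~` [set x | x \in a :: s] = ~` [set x | x \in s] `\` [set a].
  apply/seteqP; split=> x /=; rewrite inE.
    by move=> /negP; rewrite negb_or => /andP[/eqP ? /negP].
  by move=> [/negP xs /eqP xa]; apply/negP; rewrite negb_or xa.
apply: connected_del => //; exact: open_delseq.
Qed.

(** A finite set does not disconnect a surface, so [homogeneous] applies to its
    complement. *)
Lemma homogeneous_seq (s : seq X) x y : x \notin s -> y \notin s ->
  exists f, [/\ homeo f, f x = y & forall z, z \in s -> f z = z].
Proof.
move=> /negP xs /negP ys.
have [f [hf fx fz]] := homogeneous (@open_delseq s) (@connected_delseq s) xs ys.
by exists f; split=> // z zs; apply: fz; apply.
Qed.

End ClosedSurface.

(** * Circles *)

Section Circles.
Variables (R : realType) (T : topologicalType).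
Implicit Types c : set T.

Lemma frac_part (t : R) : 0 <= t - (Num.floor t)%:~R < 1.
Proof.
have /andP[f0 f1] := floor_itv t; rewrite intrD in f1.
by apply/andP; split; lra.
Qed.

Lemma circle_compact c : circle_in R c -> compact c.
Proof.
move=> [gam [cg gi ->]].
have -> : range gam = gam @` `[0, 1]%classic.
  apply/seteqP; split=> [_ [t _ <-]|_ [t _ <-]]; last by exists t.
  have /andP[u0 u1] := frac_part t.
  exists (t - (Num.floor t)%:~R); first by rewrite /= in_itv /= u0 ltW.
  by apply/gi; exists (- Num.floor t); rewrite intrN; ring.
by apply: continuous_compact (@segment_compact R 0 1); exact: continuous_subspaceT.
Qed.

Lemma circle_connected c : circle_in R c -> connected c.
Proof.
move=> [gam [cg _ ->]]; apply: connected_continuous_connected.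
  by apply/connected_intervalP => ? ?.
exact: continuous_subspaceT.
Qed.

Lemma homeo_circle (f : T -> T) c : homeo f -> circle_in R c ->
  circle_in R (f @` c).
Proof.
move=> hf [gam [cg gi ->]]; exists (f \o gam); split.
- exact: (ctscomp cg (homeo_cts hf)).
- by move=> s t; rewrite -gi; split=> [/(homeo_inj hf)|/= ->].
- by rewrite -(image_comp gam f).
Qed.

End Circles.

(** * Angles along paths *)

Section Angles.
Variable R : realType.
Local Notation P := (R * R)%type.
Implicit Types (u v w z : P) (a b : R).

Definition dot u v : R := u.1 * v.1 + u.2 * v.2.
Definition cross u v : R := u.1 * v.2 - u.2 * v.1.

(** [v] points in the direction of [u] turned by [a]; lengths are ignored. *)
Definition rotated a u v : Prop := exists2 r : R, 0 < r &
  v.1 = r * (cos a * u.1 - sin a * u.2) /\ v.2 = r * (sin a * u.1 + cos a * u.2).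

(** The angle from [u] to [v] when it is acute. *)
Definition acute_angle u v : R := atan (cross u v / dot u v).

Lemma rotated0 u : rotated 0 u u.
Proof. by exists 1 => //; rewrite cos0 sin0 !mul1r !mul0r subr0 add0r. Qed.

Lemma rotatedD a b u v w : rotated a u v -> rotated b v w -> rotated (b + a) u w.
Proof.
move=> [r r0 [v1 v2]] [s s0 [w1 w2]]; exists (s * r); first exact: mulr_gt0.
by rewrite w1 w2 v1 v2 cosD sinD; split; ring.
Qed.

Lemma rotatedN a u v : rotated a u v -> rotated (- a) v u.
Proof.
move=> [r r0 [v1 v2]]; exists (r^-1); first by rewrite invr_gt0.
have r0' : r != 0 by rewrite gt_eqF.
have cs := cos2Dsin2 a.
rewrite v1 v2 cosN sinN; split.
  transitivity (r^-1 * r * (u.1 * (cos a ^+ 2 + sin a ^+ 2))); last by ring.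
  by rewrite cs mulVf// mulr1 mul1r.
transitivity (r^-1 * r * (u.2 * (cos a ^+ 2 + sin a ^+ 2))); last by ring.
by rewrite cs mulVf// mulr1 mul1r.
Qed.

Lemma dot_gt0 u : u != 0 -> 0 < dot u u.
Proof.
move=> u0; rewrite /dot -!expr2 lt_neqAle addr_ge0 ?sqr_ge0// andbT eq_sym.
rewrite paddr_eq0 ?sqr_ge0// !sqrf_eq0; apply: contraNN u0 => /andP[/eqP a /eqP b].
by case: u a b => x y /= -> ->.
Qed.

Lemma rotated_acute u v : 0 < dot u v -> rotated (acute_angle u v) u v.
Proof.
move=> d0; rewrite /acute_angle; set x := cross u v / dot u v.
have u0 : u != 0.
  by apply/eqP => u0; move: d0; rewrite u0 /dot /= !mul0r addr0 ltxx.
have D0 := dot_gt0 u0.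
have c0 : 0 < cos (atan x).
  by apply: cos_gt0_pihalf; rewrite atan_gtNpi2 atan_ltpi2.
have sE : sin (atan x) = x * cos (atan x).
  have := @atanK R x; rewrite /tan => E; rewrite -[X in X * _]E mulfVK//.
  by rewrite gt_eqF.
exists (dot u v / (dot u u * cos (atan x))).
  by rewrite divr_gt0// mulr_gt0.
rewrite sE /x.
have h1 : cos (atan x) != 0 by rewrite gt_eqF.
have h2 : dot u u != 0 by rewrite gt_eqF.
have h3 : dot u v != 0 by rewrite gt_eqF.
rewrite -/x; set c := cos (atan x) in h1 *.
have key (k : R) : dot u v / (dot u u * c) * (c * k) = dot u v * k / dot u u.
  by field; apply/andP.
have E1 : c * u.1 - x * c * u.2 = c * (u.1 - x * u.2) by ring.
have E2 : x * c * u.1 + c * u.2 = c * (x * u.1 + u.2) by ring.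
have xE : dot u v * x = cross u v by rewrite /x mulrC divfK.
rewrite E1 E2 !key; split; apply: (mulIf h2); rewrite divfK//.
  rewrite mulrBr [dot u v * (_ * _)]mulrA xE /dot /cross; ring.
rewrite [dot u v * (_ + _)]mulrDr [dot u v * (_ * _)]mulrA xE /dot /cross; ring.
Qed.

Lemma cos1_2pi a : cos a = 1 -> exists k : int, a = (pi *+ 2) * k%:~R.
Proof.
have p2 : 0 < (pi *+ 2 : R) by rewrite mulrn_wgt0// pi_gt0.
move=> c1; pose k := Num.floor (a / (pi *+ 2)); exists k.
pose y := a - (pi *+ 2) * k%:~R.
have cosk : cos y = 1.
  have cp (n : nat) b : cos (b + (pi *+ 2) * n%:R) = cos b.
    by rewrite mulr_natr (periodicn (@cosD2pi R)).
  rewrite /y; case: (intP k) => [|n|n].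
  - by rewrite mulr0 subr0.
  - by rewrite -[LHS](cp n.+1) subrK.
  - by rewrite mulrNz mulrN opprK cp.
have /andP[y0 y1] : 0 <= y < pi *+ 2.
  have /andP[f0 f1] := floor_itv (a / (pi *+ 2)).
  rewrite -/k in f0 f1; rewrite /y subr_ge0 ltrBlDl.
  have -> : (pi *+ 2) * k%:~R + pi *+ 2 = (pi *+ 2) * (k + 1)%:~R :> R.
    by rewrite intrD mulrDr mulr1.
  by rewrite -ler_pdivlMl// -ltr_pdivrMl// [_^-1 * _]mulrC f0 f1.
suff : y = 0 by move=> /eqP; rewrite subr_eq0 => /eqP.
apply: contrapT => /eqP yn.
have : 0 < sin (y / 2).
  have yp : 0 < y by rewrite lt_def yn y0.
  apply: sin_gt0_pi; move: y1; rewrite mulr2n => y1.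
  by apply/andP; split; lra.
have : cos y = 1 - 2 * sin (y / 2) ^+ 2.
  have -> : y = (y / 2) *+ 2 by rewrite mulr2n; lra.
  rewrite cos_mulr2n.
  have -> : (y / 2) *+ 2 / 2 = y / 2 by rewrite mulr2n; lra.
  by have := cos2Dsin2 (y / 2); rewrite !mulr2n; lra.
rewrite cosk => E s0; nra.
Qed.

Lemma cos_sin_2pi (k : int) :
  cos ((pi *+ 2) * k%:~R) = 1 :> R /\ sin ((pi *+ 2) * k%:~R) = 0 :> R.
Proof.
have cp (n : nat) : cos ((pi *+ 2) * n%:R) = 1 :> R.
  by rewrite mulr_natr -[_ *+ n]add0r (periodicn (@cosD2pi R)) cos0.
have c1 : cos ((pi *+ 2) * k%:~R) = 1 :> R.
  case: (intP k) => [|n|n]; first by rewrite mulr0 cos0.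
    exact: cp.
  by rewrite mulrNz mulrN cosN; exact: cp.
by split=> //; apply: cos1sin0; rewrite c1 normr1.
Qed.

Lemma rotated_2pi (k : int) u : rotated ((pi *+ 2) * k%:~R) u u.
Proof.
have [c1 s0] := cos_sin_2pi k.
by exists 1 => //; rewrite c1 s0 !mul1r !mul0r subr0 add0r.
Qed.

Lemma rotated_uniq a b u v : u != 0 -> rotated a u v -> rotated b u v ->
  exists k : int, a - b = (pi *+ 2) * k%:~R.
Proof.
move=> u0 A B; apply: cos1_2pi.
have [r r0 [e1 e2]] := rotatedD B (rotatedN A).
have D0 := dot_gt0 u0.
have := cos2Dsin2 (- a + b); set c := cos _ in e1 e2 *; set s := sin _ in e1 e2 *.
have cE : r * c * dot u u = dot u u.
  transitivity (u.1 * (r * (c * u.1 - s * u.2)) + u.2 * (r * (s * u.1 + c * u.2))).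
    by rewrite /dot; ring.
  by rewrite -e1 -e2.
have sE : r * s * dot u u = 0.
  transitivity (cross u (r * (c * u.1 - s * u.2), r * (s * u.1 + c * u.2))).
    by rewrite /cross /dot /=; ring.
  by rewrite -e1 -e2 /cross; ring.
have D1 : dot u u != 0 by rewrite gt_eqF.
have rc : r * c = 1 by apply: (mulIf D1); rewrite mul1r.
have rs : r * s = 0 by apply: (mulIf D1); rewrite mul0r.
have -> : cos (a - b) = c by rewrite -cosN opprB /c; congr cos; ring.
have s0 : s = 0.
  by move/eqP: rs; rewrite mulf_eq0 (gt_eqF r0) => /eqP.
rewrite s0 => H; have c2 : c ^+ 2 = 1 by rewrite -H; ring.
have c0 : 0 < c.
  by have : 0 < r * c; [rewrite rc|rewrite pmulr_rgt0].
by nra.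
Qed.

Lemma acute_angle_cts (T : topologicalType) (f g : T -> P) x :
  {for x, continuous f} -> {for x, continuous g} -> 0 < dot (f x) (g x) ->
  {for x, continuous (fun y => acute_angle (f y) (g y))}.
Proof.
move=> cf cg d0.
have f1 : (fun y => (f y).1) @ x --> (f x).1 by apply: cvg_comp cf _; exact: cvg_fst.
have f2 : (fun y => (f y).2) @ x --> (f x).2 by apply: cvg_comp cf _; exact: cvg_snd.
have g1 : (fun y => (g y).1) @ x --> (g x).1 by apply: cvg_comp cg _; exact: cvg_fst.
have g2 : (fun y => (g y).2) @ x --> (g x).2 by apply: cvg_comp cg _; exact: cvg_snd.
apply: (@continuous_comp _ _ _ (fun y => cross (f y) (g y) / dot (f y) (g y)) (@atan R)).
  apply: cvgM.
    by apply: cvgB; apply: cvgM.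
  apply: cvgV; first by rewrite gt_eqF.
  by apply: cvgD; apply: cvgM.
exact: continuous_atan.
Qed.

(** By connectedness a jump would pass through a half-integral multiple of the
    period. *)
Lemma lattice_const (T : topologicalType) (A : set T) (f : T -> R) :
  connected A -> {within A, continuous f} ->
  (forall x, A x -> exists k : int, f x = (pi *+ 2) * k%:~R) ->
  forall x y, A x -> A y -> f x = f y.
Proof.
move=> cA cf fk; have p2 : 0 < (pi *+ 2 : R) by rewrite mulrn_wgt0// pi_gt0.
have : connected (f @` A) by exact: connected_continuous_connected.
move/connected_intervalP => iA.
suff H x y : A x -> A y -> ~ f x < f y.
  move=> x y Ax Ay; apply/eqP; rewrite eq_le !leNgt.
  by apply/andP; split; apply/negP; exact: H.
move=> Ax Ay xy; have [k kE] := fk _ Ax; have [l lE] := fk _ Ay.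
have kl : (k < l)%R by move: xy; rewrite kE lE ltr_pM2l// ltr_int.
have : (f @` A) ((pi *+ 2) * (k%:~R + 2^-1)).
  apply: (iA (f x) (f y)); [by exists x|by exists y|].
  rewrite kE lE !ler_pM2l//; apply/andP; split; first by lra.
  have : (k + 1)%:~R <= l%:~R :> R by rewrite ler_int lezD1.
  by rewrite intrD; lra.
move=> [z Az]; have [j ->] := fk _ Az.
move/(mulfI (lt0r_neq0 p2)) => E.
have : k%:~R < j%:~R :> R by rewrite E; lra.
rewrite ltr_int -lezD1 -(ler_int R) intrD E; lra.
Qed.

End Angles.

Section PathAngles.
Variables (R : realType) (w : R -> R * R).
Hypothesis cw : continuous w.
Local Notation P := (R * R)%type.
Implicit Types (z : P) (N : nat).
Let I : set R := `[0, 1]%classic.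

Definition node N (t : R) (i : nat) : R := t * (i%:R / N%:R).

(** The angle swept by [w - z] up to time [t], as a sum of acute angles over
    [N] steps of equal length. Rescaling the whole subdivision with [t] makes
    continuity in [t] immediate. *)
Definition sweep N (t : R) z : R :=
  \sum_(i < N) acute_angle (w (node N t i) - z) (w (node N t i.+1) - z).

(** The steps are short compared with the distance from [z] to the path, so
    that consecutive directions form acute angles. *)
Definition fine_mesh N z := [/\ (0 < N)%N & exists m : R, [/\ 0 < m,
  forall s, I s -> m <= `|w s - z| &
  forall s t, I s -> I t -> `|s - t| <= N%:R^-1 -> `|w s - w t| < m / 2]].

Lemma near_dot (u v : P) (m : R) : 0 < m -> m <= `|u| -> `|u - v| < m / 2 ->
  0 < dot u v.
Proof.
move=> m0; rewrite pnormE le_max pnorm_lt /dot /= !ltr_norml.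
case: u v => u1 u2 [v1 v2] /= H /andP[/andP[a b] /andP[c d]].
have [h1|h1] := lerP 0 u1; have [h2|h2] := lerP 0 u2;
  rewrite ?(ger0_norm h1) ?(ger0_norm h2) ?(ltr0_norm h1) ?(ltr0_norm h2) in H;
  case/orP: H => H; try nra.
Qed.

Lemma node_I N t i : (0 < N)%N -> (i <= N)%N -> I t -> I (node N t i).
Proof.
rewrite /I /= !in_itv /= /node => N0 iN /andP[t0 t1].
have h : 0 <= (i%:R / N%:R : R) <= 1.
  by rewrite divr_ge0//= ler_pdivrMr ?ltr0n// mul1r ler_nat.
by case/andP: h => *; apply/andP; split; nra.
Qed.

Lemma node_near N t i : (0 < N)%N -> I t ->
  `|node N t i - node N t i.+1| <= N%:R^-1.
Proof.
rewrite /I /= !in_itv /= /node => N0 /andP[t0 t1].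
have -> : t * (i%:R / N%:R) - t * (i.+1%:R / N%:R) = - (t * N%:R^-1).
  by rewrite -natr1; ring.
rewrite normrN ger0_norm; last by rewrite mulr_ge0 ?invr_ge0.
by rewrite ler_piMl ?invr_ge0.
Qed.

Lemma fine_mesh_dot N z t i : fine_mesh N z -> I t -> (i < N)%N ->
  0 < dot (w (node N t i) - z) (w (node N t i.+1) - z).
Proof.
move=> [N0 [m [m0 mz mN]]] It iN.
have I1 : I (node N t i) by apply: node_I => //; exact: ltnW.
have I2 : I (node N t i.+1) by apply: node_I.
apply: (near_dot m0); first exact: mz.
by rewrite opprB addrA subrK; apply: mN => //; exact: node_near.
Qed.

Lemma sweep0 N z : fine_mesh N z -> sweep N 0 z = 0.
Proof.
move=> [N0 [m [m0 mz mN]]]; rewrite /sweep big1// => i _.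
rewrite /acute_angle /node !mul0r (_ : cross _ _ = 0) ?mul0r ?atan0//.
by rewrite /cross; ring.
Qed.

Lemma sweep_rotated N t z : fine_mesh N z -> I t -> rotated (sweep N t z) (w 0 - z) (w t - z).
Proof.
move=> fN It; have [N0 _] := fN.
suff H k : (k <= N)%N -> rotated
    (\sum_(i < k) acute_angle (w (node N t i) - z) (w (node N t i.+1) - z))
    (w 0 - z) (w (node N t k) - z).
  have := H N (leqnn N); rewrite /node divff ?mulr1// pnatr_eq0; lia.
elim: k => [|k IH] kN; first by rewrite big_ord0 /node mul0r mulr0; exact: rotated0.
rewrite big_ord_recr /= addrC; apply: rotatedD (IH (ltnW kN)) _.
by apply: rotated_acute; exact: fine_mesh_dot.
Qed.

Lemma sum_cts (T : topologicalType) n (f : 'I_n -> T -> R) x :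
  (forall i, {for x, continuous (f i)}) ->
  {for x, continuous (fun y => \sum_(i < n) f i y)}.
Proof.
elim: n f => [|n IH] f cf.
  have -> : (fun y => \sum_(i < 0) f i y) = (fun=> 0).
    by apply/funext => y; rewrite big_ord0.
  exact: cvg_cst.
have -> : (fun y => \sum_(i < n.+1) f i y) =
   (fun y => \sum_(i < n) f (widen_ord (leqnSn n) i) y + f ord_max y).
  by apply/funext => y; rewrite big_ord_recr.
by apply: cvgD; [apply: IH => i; exact: cf|exact: cf].
Qed.

Lemma sweep_cts_time N z t : fine_mesh N z -> I t -> {for t, continuous (fun s => sweep N s z)}.
Proof.
move=> fN It; apply: sum_cts => i; apply: acute_angle_cts; last exact: fine_mesh_dot.
- have : continuous (fun s : R => w (node N s i) - z).
    move=> s; apply: cvgB; last exact: cvg_cst.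
    by apply: (@ctscomp _ _ _ (fun s => node N s i) w) => //; rewrite /node; cts.
  exact.
- have : continuous (fun s : R => w (node N s i.+1) - z).
    move=> s; apply: cvgB; last exact: cvg_cst.
    by apply: (@ctscomp _ _ _ (fun s => node N s i.+1) w) => //; rewrite /node; cts.
  exact.
Qed.

Lemma sweep_cts_point N z t : fine_mesh N z -> I t -> {for z, continuous (sweep N t)}.
Proof.
move=> fN It; apply: sum_cts => i; apply: acute_angle_cts; last exact: fine_mesh_dot.
- by apply: cvgB; [exact: cvg_cst|exact: cvg_id].
- by apply: cvgB; [exact: cvg_cst|exact: cvg_id].
Qed.

Lemma fine_mesh_neq0 N z : fine_mesh N z -> w 0 - z != 0.
Proof.
move=> [_ [m [m0 mz _]]]; rewrite -normr_gt0; apply: lt_le_trans m0 _.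
by apply: mz; rewrite /I /= in_itv /= lexx ler01.
Qed.

(** As functions of time both sides measure the same rotation, so they differ
    by a multiple of the period, which is constant and starts at zero. *)
Lemma sweep_indep N N' z : fine_mesh N z -> fine_mesh N' z -> sweep N 1 z = sweep N' 1 z.
Proof.
move=> f f'; apply/eqP; rewrite -subr_eq0; apply/eqP.
have I0 : I 0 by rewrite /I /= in_itv /= lexx ler01.
have I1 : I 1 by rewrite /I /= in_itv /= lexx ler01.
rewrite -[RHS](_ : sweep N 0 z - sweep N' 0 z = 0); last by rewrite !sweep0// subrr.
apply: (@lattice_const R _ I (fun t => sweep N t z - sweep N' t z)) => //.
- exact: segment_connected.
- apply: continuous_in_subspaceT => t; rewrite inE => It.
  by apply: cvgB; exact: sweep_cts_time.
- move=> t It; apply: rotated_uniq (fine_mesh_neq0 f) _ _; exact: sweep_rotated.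
Qed.

Lemma uniform_path (e : R) : 0 < e -> exists2 N, (0 < N)%N &
  forall s t, I s -> I t -> `|s - t| <= N%:R^-1 -> `|w s - w t| < e.
Proof.
move=> e0; have /compact_near_coveringP := @segment_compact R 0 1.
move=> /(_ nat \oo (fun N s => forall t, `|s - t| <= N%:R^-1 -> `|w s - w t| < e) _).
case.
- move=> x _.
  have : nbhs x (w @^-1` ball (w x) (e / 2)).
    by apply: cw; apply: nbhsx_ballx; lra.
  move=> /nbhs_ballP[d /= d0 dw].
  exists (ball x (d / 2), [set N | N%:R^-1 < d / 2]).
    split; first by apply: nbhsx_ballx; lra.
    have d2 : 0 < d / 2 by lra.
    near=> N; rewrite /=.
    have N0 : (0 < N)%N by near: N; exact: nbhs_infty_gt.
    rewrite invf_plt ?posrE ?ltr0n//; near: N; exact: nbhs_infty_gtr.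
  move=> [s N] /= [xs Nd] t st.
  have h1 : ball x d s by apply: le_ball xs; lra.
  have h2 : ball x d t.
    move: xs; rewrite -!ball_normE /= => xs.
    by have := ler_distD s x t; lra.
  move: (dw _ h1) (dw _ h2); rewrite -!ball_normE /= => g1 g2.
  have := ler_distD (w x) (w s) (w t); rewrite [`|w s - w x|]distrC; lra.
move=> N0 _ H; exists (maxn N0 1); first by rewrite leq_maxr.
move=> s t Is _; apply: H => //=; first by rewrite leq_maxl.
Unshelve. all: by end_near.
Qed.

Lemma fine_mesh_near z : ~ (w @` I) z ->
  exists N d, 0 < d /\ forall z', `|z - z'| < d -> fine_mesh N z'.
Proof.
move=> nz; have [|c cI cmin] := @EVT_min R (fun s => `|w s - z|) 0 1 ler01.
  apply: continuous_subspaceT => s; apply: cvg_norm; apply: cvgB; last exact: cvg_cst.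
  exact: cw.
pose m := `|w c - z|.
have m0 : 0 < m.
  by rewrite normr_gt0 subr_eq0; apply/eqP => E; apply: nz; exists c.
have [|N N0 NH] := @uniform_path (m / 4); first by lra.
exists N, (m / 2); split; first by lra.
move=> z' zz; split=> //; exists (m / 2); split; first by lra.
- move=> s Is; have := cmin s Is; rewrite -/m => ms.
  by have := ler_distD z' (w s) z; rewrite [`|z' - z|]distrC; lra.
- by move=> s t Is It st; have := NH _ _ Is It st; lra.
Qed.

(** One subdivision serves all points near [z], which gives
    continuity; the value does not depend on the subdivision. *)
Lemma angle_off_path : exists Th : P -> R,
  (forall z, ~ (w @` I) z -> {for z, continuous Th}) /\
  forall z, ~ (w @` I) z -> rotated (Th z) (w 0 - z) (w 1 - z).
Proof.
pose Th z := if pselect (exists N, fine_mesh N z) is left h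
  then sweep (projT1 (cid h)) 1 z else 0.
have ThE N z : fine_mesh N z -> Th z = sweep N 1 z.
  move=> f; rewrite /Th; case: pselect => [h|[]]; last by exists N.
  by apply: sweep_indep => //; exact: (projT2 (cid h)).
have I1 : I 1 by rewrite /I /= in_itv /= lexx ler01.
exists Th; split=> z nz; have [N [d [d0 dN]]] := fine_mesh_near nz.
- have fz : fine_mesh N z by apply: dN; rewrite subrr normr0.
  have E : \forall z' \near z, sweep N 1 z' = Th z'.
    near=> z'; symmetry; apply: ThE; apply: dN; near: z'.
    have := @nbhsx_ballx _ P z d d0; rewrite -ball_normE; exact.
  rewrite /prop_for /continuous_at (ThE _ _ fz).
  by apply: cvg_trans (sweep_cts_point fz I1); apply: near_eq_cvg.
- have fz : fine_mesh N z by apply: dN; rewrite subrr normr0.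
  by rewrite (ThE _ _ fz); exact: sweep_rotated.
Unshelve. all: by end_near.
Qed.

End PathAngles.

(** * The Jordan curve theorem *)

Section Jordan.
Variable R : realType.
Local Notation P := (R * R)%type.

(** Cut the circle into two arcs from [p] to [q]. Off each arc, the angle
    between the directions to [p] and to [q] has a continuous determination. If
    the complement of the circle were connected, the two determinations would
    differ there by a constant multiple of the period, and together they would
    define one off [p] and [q]; but none exists on a small circle around [p]. *)
Lemma jordan_plane (c : set P) : circle_in R c -> ~ connected (~` c).
Proof.
move=> [gam [cg ginj ->]] con.
pose I : set R := `[0, 1]%classic.
have II (s : R) : I s <-> 0 <= s <= 1 by rewrite /I /= in_itv.
pose wA (s : R) := gam (s / 2); pose wB (s : R) := gam (1 - s / 2).
have cA : continuous wA by apply: (@ctscomp _ _ _ (fun s : R => s / 2) gam) => //; cts.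
have cB : continuous wB by apply: (@ctscomp _ _ _ (fun s : R => 1 - s / 2) gam) => //; cts.
pose p := gam 0; pose q := gam 2^-1.
have A0 : wA 0 = p by rewrite /wA mul0r.
have A1 : wA 1 = q by rewrite /wA mul1r.
have B0 : wB 0 = p by apply/ginj; exists 1; rewrite mul0r !subr0.
have B1 : wB 1 = q by rewrite /wB; congr gam; lra.
have pq : p <> q.
  move/ginj => [k]; rewrite sub0r => E.
  have k0 : k%:~R < 0 :> R by rewrite -E; lra.
  have k1 : (-1)%:~R < k%:~R :> R by rewrite -E mulrN1z; lra.
  by move: k0 k1; rewrite ltrz0 ltr_int; lia.
have [TA [cTA aTA]] := angle_off_path cA.
have [TB [cTB aTB]] := angle_off_path cB.
pose KA := wA @` I; pose KB := wB @` I.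
have KK z : KA z -> KB z -> z = p \/ z = q.
  move=> [s /II/andP[s0 s1] <-] [t /II/andP[t0 t1]] /ginj[k kE].
  have h0 : 0 <= k%:~R :> R by rewrite -kE; lra.
  have h1 : k%:~R <= 1%:~R :> R by rewrite -kE mulr1z; lra.
  have : k = 0 \/ k = 1 by move: h0 h1; rewrite ler0z ler_int; lia.
  case=> E; move: kE; rewrite E ?mulr1z => kE.
    right; rewrite /wA; have -> : s = 1 by rewrite mulr0z in kE; lra.
    by rewrite mul1r.
  by left; rewrite /wA; have -> : s = 0; [lra|rewrite mul0r].
have KAr z : KA z -> range gam z by move=> [s _ <-]; exists (s / 2).
have KBr z : KB z -> range gam z by move=> [s _ <-]; exists (1 - s / 2).
have rK z : range gam z -> KA z \/ KB z.
  move=> [t _ <-]; have s01 := frac_part t.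
  pose s := t - (Num.floor t)%:~R.
  have E : gam t = gam s by apply/ginj; exists (Num.floor t); rewrite /s; ring.
  have /andP[s0 s1] : 0 <= s < 1 by exact: s01.
  rewrite E; have [h|h] := lerP s 2^-1.
    by left; exists (s * 2); [apply/II/andP; split; lra|rewrite /wA; congr gam; lra].
  by right; exists ((1 - s) * 2); [apply/II/andP; split; lra|rewrite /wB; congr gam; lra].
have p0 z : ~ range gam z -> p - z != 0.
  by move=> nz; rewrite subr_eq0; apply/eqP => E; apply: nz; rewrite -E; exists 0.
have DE : exists d, (forall u, rotated d u u) /\
    forall z, ~ range gam z -> TA z = TB z + d.
  have [[z0 nz0]|N] := pselect (exists z, ~ range gam z); last first.
    exists 0; split=> [u|z nz]; first exact: rotated0.
    by exfalso; apply: N; exists z.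
  have lat z : ~ range gam z -> exists k : int, TA z - TB z = (pi *+ 2) * k%:~R.
    move=> nz; apply: (@rotated_uniq _ _ _ (p - z) (q - z)); first exact: p0.
      by rewrite -A0 -A1; apply: aTA => /KAr.
    by rewrite -B0 -B1; apply: aTB => /KBr.
  exists (TA z0 - TB z0); split=> [u|z nz].
    by have [k ->] := lat _ nz0; exact: rotated_2pi.
  suff : TA z - TB z = TA z0 - TB z0 by lra.
  apply: (@lattice_const R _ (~` range gam) (fun z => TA z - TB z)) => //.
  - apply: continuous_in_subspaceT => x; rewrite inE => nx.
    by apply: cvgB; [apply: cTA => /KAr|apply: cTB => /KBr].
have [d [d1 dE]] := DE.
(* The two determinations glue to one defined off the two common endpoints. *)
pose Th z := if pselect (KA z) is left _ then TB z + d else TA z.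
have ThA z : ~ KA z -> Th z = TA z by rewrite /Th; case: pselect.
have ThB z : ~ KB z -> Th z = TB z + d.
  move=> nB; rewrite /Th; case: pselect => // nA.
  by apply: dE => /rK[].
have oK (w : R -> P) : continuous w -> open (~` (w @` I)).
  move=> cw; apply: closed_openC; apply: compact_closed; first exact: hausdorff_plane.
  by apply: continuous_compact (@segment_compact R 0 1); exact: continuous_subspaceT.
have cTh z : z <> p -> z <> q -> {for z, continuous Th}.
  move=> zp zq; have [nA|/contrapT hA] := pselect (~ KA z).
    rewrite /prop_for /continuous_at ThA//; apply: cvg_trans (cTA _ nA).
    apply: near_eq_cvg; have : nbhs z (~` KA) by apply: open_nbhs_nbhs; split=> //; exact: oK.
    by apply: filterS => y ny; rewrite ThA.
  have nB : ~ KB z by move=> hB; have [] := KK _ hA hB.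
  rewrite /prop_for /continuous_at ThB//.
  apply: cvg_trans (_ : TB y + d @[y --> z] --> TB z + d); last first.
    by apply: cvgD; [exact: cTB|exact: cvg_cst].
  apply: near_eq_cvg; have : nbhs z (~` KB) by apply: open_nbhs_nbhs; split=> //; exact: oK.
  by apply: filterS => y ny; rewrite ThB.
have aTh z : z <> p -> z <> q -> rotated (Th z) (p - z) (q - z).
  move=> zp zq; have [nA|/contrapT hA] := pselect (~ KA z).
    by rewrite ThA// -A0 -A1; exact: aTA.
  have nB : ~ KB z by move=> hB; have [] := KK _ hA hB.
  by rewrite ThB// -B0 -B1; apply: rotatedD; [exact: d1|exact: aTB].
(* On a small circle around [p] the direction to [p] turns once, while the
   direction to [q] does not. *)
pose v := q - p; have v0 : v != 0 by rewrite subr_eq0; apply/eqP => E; apply: pq.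
have nv : 0 < `|v| by rewrite normr_gt0.
have [e e0 eE] : exists2 e, 0 < e & e = `|v| / 4 by exists (`|v| / 4) => //; lra.
pose ci (t : R) : P := (e * cos t, e * sin t).
have nci t : `|ci t| <= e.
  rewrite pnorm_le /= [`|e * cos t|]normrM [`|e * sin t|]normrM (gtr0_norm e0).
  apply/andP; split; apply: ler_piMr; rewrite ?(ltW e0)//.
    exact: cos_max.
  exact: sin_max.
have ci0 t : ci t != 0.
  apply/eqP => -[/eqP + /eqP]; rewrite !mulf_eq0 (gt_eqF e0) /= => /eqP c0 /eqP s0.
  by have := cos2Dsin2 t; rewrite c0 s0 expr0n addr0 => /esym/eqP; rewrite oner_eq0.
pose ze t := p - ci t.
have zp t : ze t <> p.
  move=> E; have := ci0 t; rewrite -[ci t]opprK oppr_eq0 => /eqP; apply.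
  by apply: (@addrI _ p); rewrite addr0.
have vz t : v + ci t = q - ze t by rewrite /v /ze opprB addrA addrAC.
have dv t : 0 < dot v (q - ze t).
  apply: (@near_dot R v _ `|v|) => //.
  by rewrite -vz opprD addNKr normrN; have := nci t; rewrite eE; lra.
have zq t : ze t <> q.
  by move=> E; have := dv t; rewrite E subrr /dot /= !mulr0 addr0 ltxx.
pose D t := - acute_angle v (q - ze t) + (Th (ze t) + t).
have aD t : rotated (D t) (1, 0) v.
  apply: rotatedD (rotatedN (rotated_acute (dv t))); apply: rotatedD (aTh _ (zp t) (zq t)).
  exists e => //; rewrite /ze opprB addrC subrK /ci /=; split; ring.
have cci : continuous ci.
  by apply: ctspair; apply: ctsM; first [exact: ctsc|exact: continuous_cos|exact: continuous_sin].
have cze : continuous ze by move=> t; apply: cvgB; [exact: cvg_cst|exact: cci].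
have cD : continuous D.
  move=> t.
  have ca : {for t, continuous (fun t => acute_angle v (q - ze t))}.
    apply: (@acute_angle_cts R _ (fun=> v) (fun t => q - ze t)); last exact: dv.
      exact: cvg_cst.
    by apply: cvgB; [exact: cvg_cst|exact: cze].
  apply: cvgD; first by apply: cvgN; exact: ca.
  apply: cvgD; last exact: cvg_id.
  by apply: (@continuous_comp _ _ _ ze Th); [exact: cze|exact: cTh].
have u0 : ((1, 0) : P) != 0 by apply/eqP => -[/eqP]; rewrite oner_eq0.
have : D (pi *+ 2) - D 0 = D 0 - D 0.
  apply: (@lattice_const R _ [set: R] (fun t => D t - D 0)) => //.
  - by apply/connected_intervalP => ? ?.
  - apply: continuous_subspaceT => t; apply: cvgB; [exact: cD|exact: cvg_cst].
  - by move=> t _; apply: rotated_uniq u0 (aD t) (aD 0).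
have ze2 : ze (pi *+ 2) = ze 0.
  by rewrite /ze /ci cos2pi sin2pi cos0 sin0.
rewrite /D ze2 => E; have := pi_gt0 R; move: E; rewrite mulr2n; lra.
Qed.

Lemma connected_outside : connected (~` open_square R).
Proof.
pose A1 : set P := [set p | 1 <= p.1].
pose A2 : set P := [set p | 1 <= p.2].
pose A3 : set P := [set p | p.1 <= -1].
pose A4 : set P := [set p | p.2 <= -1].
have c1 : connected A1.
  by apply: (@star_connected _ _ (1, 0)) => [|x t]; rewrite /A1/= // => ? ?; exact: conv_ge.
have c2 : connected A2.
  by apply: (@star_connected _ _ (0, 1)) => [|x t]; rewrite /A2/= // => ? ?; exact: conv_ge.
have c3 : connected A3.
  by apply: (@star_connected _ _ (-1, 0)) => [|x t]; rewrite /A3/= // => ? ?; exact: conv_le.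
have c4 : connected A4.
  by apply: (@star_connected _ _ (0, -1)) => [|x t]; rewrite /A4/= // => ? ?; exact: conv_le.
have -> : ~` open_square R = ((A1 `|` A2) `|` A3) `|` A4.
  apply/seteqP; split=> z; rewrite /open_square /=.
    move=> /negP; rewrite -leNgt pnormE le_max !ler_normr.
    move=> /orP[/orP[]|/orP[]] h; [left; left; left|left; right|left; left; right|right];
    rewrite /A1 /A2 /A3 /A4 /=; lra.
  move=> H; apply/negP; rewrite -leNgt pnormE le_max !ler_normr.
  by case: H => [[[]|]|] h; rewrite /A1 /A2 /A3 /A4 /= in h;
    [apply/orP; left; apply/orP; left|apply/orP; right; apply/orP; left
    |apply/orP; left; apply/orP; right|apply/orP; right; apply/orP; right]; lra.
apply: connectedU => //.
  by exists (1, -1); split; [left; left|]; rewrite /A1 /A4 /=; lra.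
apply: connectedU => //.
  by exists (-1, 1); split; [right|]; rewrite /A2 /A3 /=; lra.
by apply: connectedU => //; exists (1, 1); split; rewrite /A1 /A2 /=; lra.
Qed.

(** The outside of the square is connected, hence lies on one side of the
    circle; the other side stays in the square. *)
Lemma jordan_square (c : set P) : circle_in R c -> c `<=` open_square R ->
  exists O, [/\ open O, O !=set0, O `<=` open_square R `\` c & closed (c `|` O)].
Proof.
move=> hc cO; have := jordan_plane hc; rewrite connectedE2.
have cc : closed c.
  by apply: compact_closed; [exact: hausdorff_plane|exact: circle_compact hc].
move=> /existsNP [ O1 /existsNP [ O2 /not_implyP [ o1 /not_implyP [ o2 ]]]].
move=> /not_implyP [dj /not_implyP [cov /not_orP]].
have Ec : ~` open_square R `<=` ~` c by move=> x xo /cO.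
have := connected_outside; move/connectedE2 => /(_ O1 O2 o1 o2) H.
wlog EO : O1 O2 o1 o2 dj cov {H} / ~` open_square R `<=` O2.
  move=> W [n1 n2]; case: H => [||E|E].
  - apply/seteqP; split=> // x [[/Ec x1 x2] x3].
    by suff : set0 x by []; rewrite -dj.
  - by move=> x /Ec/cov.
  - apply: (W O2 O1) => //; first by rewrite -setIA (setIC O2) setIA.
    by rewrite setUC.
  - exact: (W O1 O2).
move=> [n1 n2]; exists (O1 `&` ~` c); split.
- by apply: openI => //; exact: closed_openC.
- move: n2 => /existsNP[x /not_implyP[xc xO2]]; exists x; split=> //.
  by case: (cov _ xc).
- move=> x [x1 xc]; split=> //; apply: contrapT => xo.
  by suff : set0 x by []; rewrite -dj; split; [split|exact: EO].
- have -> : c `|` (O1 `&` ~` c) = ~` (O2 `&` ~` c).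
    apply/seteqP; split=> x.
      case=> [xc [_ []//]|[x1 xc] [x2 _]].
      by suff : set0 x by []; rewrite -dj.
    move=> nx; have [xc|xc] := pselect (c x); [by left|right; split=> //].
    by case: (cov _ xc) => // x2; exfalso; apply: nx.
  by apply: open_closedC; apply: openI => //; exact: closed_openC.
Qed.

(** The part cut off inside the square is open in the whole space, and its
    closure adds only points of the circle. *)
Lemma jordan_embedded (X : topologicalType) (psi : P -> X) (c : set X) :
  hausdorff_space X -> square_embedding psi -> circle_in R c -> c `<=` psi @` open_square R ->
  exists O1 O2, [/\ open O1, open O2, O1 !=set0, O2 !=set0 &
    O1 `&` O2 = set0 /\ ~` c = O1 `|` O2].
Proof.
move=> hX psiE [gam [cg gi cE]] cO; have [cp ip op] := psiE.
have lift t : {p | open_square R p /\ psi p = gam t}.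
  by apply: cid; have [|p] := cO (gam t); [rewrite cE; exists t|exists p].
pose g t := sval (lift t).
have gO t : open_square R (g t) by case: (svalP (lift t)).
have gE t : psi (g t) = gam t by case: (svalP (lift t)).
have hc : circle_in R (range g).
  exists g; split=> //.
  - apply/continuous_closedP => C cC.
    have -> : g @^-1` C = gam @^-1` (psi @` (square R `&` C)).
      apply/seteqP; split=> t; rewrite /preimage /=.
        by move=> gC; exists (g t) => //; split=> //; exact: open_square_sub.
      move=> [p [ps pC]]; rewrite -gE => /ip.
      by rewrite !inE => /(_ ps (open_square_sub (gO t))) <-.
    by apply: preimage_closed; [move=> t _; exact: cg|exact: square_embedding_closed].
  - move=> s t; rewrite -gi -!gE; split=> [->//|/ip]; rewrite !inE.
    by apply; exact: open_square_sub.
have [|O [oO O0 Ogo cOc]] := jordan_square hc; first by move=> _ [t _ <-].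
have gc : psi @` range g = c.
  rewrite cE image_comp; apply/seteqP; split=> [_ [t _ <-]|_ [t _ <-]];
    by exists t => //=; rewrite gE.
have Oo : O `<=` open_square R by move=> x /Ogo[].
exists (psi @` O), (~` (psi @` (square R `&` (range g `|` O)))); split.
- exact: square_embedding_open.
- by apply: closed_openC; exact: square_embedding_closed.
- by case: O0 => x Ox; exists (psi x); exists x.
- have e1 : `|((1, 0) : P)| = 1.
    by rewrite pnormE /= normr1 normr0; apply/max_idPl.
  exists (psi (1, 0)) => -[p [ps pO]] /ip.
  rewrite !inE /square /= e1 => /(_ ps (lexx _)) E.
  have : open_square R p by case: pO => [[t _ <-]|/Oo].
  by rewrite E /open_square /= e1 ltxx.
- split.
    apply/seteqP; split=> // _ [[p Op <-]]; apply; exists p => //.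
    by split; [apply: open_square_sub; exact: Oo|right].
  apply/seteqP; split=> x.
    move=> nc; have [[p [ps [pg|pO]] E]|n] :=
      pselect ((psi @` (square R `&` (range g `|` O))) x); last by right.
      by exfalso; apply: nc; rewrite -gc -E; exists p.
    by left; rewrite -E; exists p.
  rewrite -gc => -[[p pO <-]|n] [q qg E].
    have [po pg] := Ogo _ pO.
    have qs : square R q by case: qg => t _ <-; apply: open_square_sub; exact: gO.
    move/ip : E; rewrite !inE => /(_ qs (open_square_sub po)) E.
    by apply: pg; rewrite -E.
  apply: n; exists q => //; split; last by left.
  by case: qg => t _ <-; apply: open_square_sub; exact: gO.
Qed.

End Jordan.

(** * Charts on squares and half squares *)

Section ComplexPlane.
Variable R : realType.
Local Notation P := (R * R)%type.

Definition mk_cplx (p : P) : Cplx R := (p.1 +i* p.2)%C.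

Lemma normc_ge_Im (z : Cplx R) : ((`|complex.Im z|)%:C)%C <= `|z|.
Proof. by rewrite normc_def lecR -sqrtr_sqr ler_wsqrtr// lerDr sqr_ge0. Qed.

Lemma re_cts : continuous (@complex.Re R : Cplx R -> R).
Proof.
move=> z; have FF : Filter (nbhs z) by exact: nbhs_filter.
apply/cvgrPdist_lt => e e0; apply/nbhs_ballP.
exists ((e%:C)%C : Cplx R) => /=; first by rewrite ltcR.
move=> w zw; have {}zw : `|z - w| < ((e%:C)%C : Cplx R) by exact: zw.
have := le_lt_trans (normc_ge_Re (z - w)) zw.
by rewrite ltcR raddfB.
Qed.

Lemma im_cts : continuous (@complex.Im R : Cplx R -> R).
Proof.
move=> z; have FF : Filter (nbhs z) by exact: nbhs_filter.
apply/cvgrPdist_lt => e e0; apply/nbhs_ballP.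
exists ((e%:C)%C : Cplx R) => /=; first by rewrite ltcR.
move=> w zw; have {}zw : `|z - w| < ((e%:C)%C : Cplx R) by exact: zw.
have := le_lt_trans (normc_ge_Im (z - w)) zw.
by rewrite ltcR raddfB.
Qed.

Lemma mk_cplx_cts : continuous mk_cplx.
Proof.
move=> p; have FF : Filter (nbhs p) by exact: nbhs_filter.
apply/cvgrPdist_lt => -[r i]; rewrite ltcE /= => /andP[/eqP -> r0].
have r2 : 0 < r / 2 by lra.
apply: (filterS _ (@nbhsx_ballx _ P p _ r2)) => q.
rewrite -ball_normE /= pnorm_lt /= !ltr_norml => /andP[/andP[a b] /andP[c d]].
rewrite normc_def ltcR /=.
have -> : r = Num.sqrt (r ^+ 2) by rewrite sqrtr_sqr gtr0_norm.
by rewrite ltr_sqrt; nra.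
Qed.

Definition reim (z : Cplx R) : P := (complex.Re z, complex.Im z).

Lemma reimK z : mk_cplx (reim z) = z. Proof. by case: z. Qed.

End ComplexPlane.

Section HalfSquares.
Variables (R : realType).
Local Notation P := (R * R)%type.

Definition half_square : set P := [set p | `|p| <= 1 /\ 0 <= p.2].
Definition open_half_square : set P := [set p | `|p| < 1 /\ 0 <= p.2].

Lemma open_half_square_sub : open_half_square `<=` half_square.
Proof. by move=> p [/ltW ? ?]; split. Qed.

Lemma closed_half_square : closed half_square.
Proof.
have -> : half_square = square R `&` (fun p : P => p.2) @^-1` [set x | 0 <= x] by [].
apply: closedI; first exact: closed_square.
by apply: preimage_closed; [move=> p _; apply: ctssnd; cts|exact: closed_ge].
Qed.

Lemma compact_half_square : compact half_square.
Proof. by apply: subclosed_compact closed_half_square (@compact_square R) _ => p []. Qed.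

Variable T : topologicalType.
Hypothesis hT : hausdorff_space T.
Variable D : set T.

(** The inverse of a chart at a boundary point, on a closed half square. *)
Definition half_square_embedding (psi : P -> T) : Prop :=
  [/\ {within half_square, continuous psi}, set_inj half_square psi, open (psi @` open_half_square) &
      forall p, half_square p -> (D (psi p) <-> p.2 = 0)].

Lemma half_square_embedding_open psi (V : set P) : half_square_embedding psi -> open V ->
  V `&` half_square `<=` open_half_square -> open (psi @` (V `&` open_half_square)).
Proof.
move=> [c i o dp] oV Vo.
have -> : psi @` (V `&` open_half_square) = psi @` open_half_square `&` ~` (psi @` (half_square `&` ~` V)).
  apply/seteqP; split=> [_ [p [Vp po] <-]|_ [[p po <-] N]].
    split; first by exists p.
    move=> [q [qs qV] /i E]; apply: qV; rewrite E ?inE//.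
    exact: open_half_square_sub.
  exists p => //; split=> //; apply: contrapT => Vp; apply: N; exists p => //.
  by split=> //; exact: open_half_square_sub.
apply: openI => //; apply: closed_openC; apply: closed_image_compact => //.
- exact: compact_half_square.
- exact: closed_half_square.
- exact: open_closedC.
Qed.

Variables (a : chart R T) (x : T).
Hypotheses (ca : is_chart D a) (ax : a.1 x).
Let z0 := a.2 x.
Let k (e : R) (p : P) := mk_cplx (complex.Re z0 + e * p.1, complex.Im z0 + e * p.2).

Let k_cts e : continuous (k e).
Proof. by apply: ctscomp (@mk_cplx_cts R); cts. Qed.

Let k_inj e p q : 0 < e -> k e p = k e q -> p = q.
Proof.
move=> e0 [/addrI/(mulfI (lt0r_neq0 e0)) E1 /addrI/(mulfI (lt0r_neq0 e0)) E2].
by case: p q E1 E2 => ? ? [? ?] /= -> ->.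
Qed.

(** The inverse of a chart rescaled by [e] around the image of [x]. It is
    continuous because charts are open onto their image in the half plane. *)
Lemma chart_pull e (K : set P) : 0 < e ->
  (forall p, K p -> (a.2 @` a.1) (k e p)) ->
  exists psi : P -> T,
    [/\ {within K, continuous psi}, set_inj K psi &
        forall p, K p -> a.1 (psi p) /\ a.2 (psi p) = k e p].
Proof.
move=> e0 Kk; have [oA cA iA VA dA] := ca.
have g p : {y | K p -> a.1 y /\ a.2 y = k e p}.
  apply: cid; have [Kp|nK] := pselect (K p); last by exists x.
  by have [y ay <-] := Kk _ Kp; exists y.
pose psi p := sval (g p).
have gE p : K p -> a.1 (psi p) /\ a.2 (psi p) = k e p by exact: (svalP (g p)).
exists psi; split=> //.
- apply/continuousP => V oV; apply/open_subspaceP.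
  have [|W oW WE] := VA (V `&` a.1) (openI oV oA); first by move=> ? [].
  exists (k e @^-1` W); first by apply: open_comp => // p _; exact: k_cts.
  apply/seteqP; split=> p [Wp Kp]; split=> //; have [g1 g2] := gE _ Kp.
  + have : (a.2 @` (V `&` a.1)) (k e p).
      rewrite WE; split=> //; have [y ay yE] := Kk _ Kp.
      have [|W' oW' WE'] := VA a.1 oA; first by [].
      have : (a.2 @` a.1) (k e p) by exists y.
      by rewrite WE' => -[].
    move=> [y [Vy ay]]; rewrite -g2 => /iA; rewrite !inE => /(_ ay g1) E.
    by suff : V (psi p) by []; rewrite -E.
  + have : (a.2 @` (V `&` a.1)) (k e p) by exists (psi p).
    by rewrite WE => -[].
- move=> p q; rewrite !inE => Kp Kq E.
  have [_ g1] := gE _ Kp; have [_ g2] := gE _ Kq.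
  by apply: (@k_inj e) => //; rewrite -g1 -g2 E.
Qed.

Let k_open e : 0 < e -> open (k e @` open_square R).
Proof.
move=> e0.
have -> : k e @` open_square R = (fun z : Cplx R => (e^-1 * (complex.Re z - complex.Re z0),
    e^-1 * (complex.Im z - complex.Im z0))) @^-1` open_square R.
  have e1 : e != 0 by rewrite gt_eqF.
  apply/seteqP; split=> [_ [p po <-]|z zo]; rewrite /preimage /=.
    rewrite [_ - complex.Re z0]addrC addKr [_ - complex.Im z0]addrC addKr.
    by rewrite !mulKf//; case: p po.
  exists (e^-1 * (complex.Re z - complex.Re z0), e^-1 * (complex.Im z - complex.Im z0)) => //.
  rewrite /k /= !mulVKf// [_ + (complex.Re z - _)]addrC subrK.
  by rewrite [_ + (complex.Im z - _)]addrC subrK; case: z {zo}.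
apply: open_comp; last exact: open_open_square.
move=> z _; move: z; apply: ctspair; apply: ctsM; try exact: ctsc; apply: ctsB;
  by [exact: ctsc|exact: re_cts|exact: im_cts].
Qed.

Let near_k (W : set (Cplx R)) : open W -> W z0 ->
  exists2 e0 : R, 0 < e0 & forall e, 0 < e -> e < e0 -> forall p, square R p -> W (k e p).
Proof.
move=> oW Wz.
have : nbhs (0 : P) [set q | W (k 1 q)].
  have : open [set q | W (k 1 q)] by apply: open_comp => // p _; exact: k_cts.
  move=> oV; apply: open_nbhs_nbhs; split=> //=.
  by rewrite /k /= !mulr0 !addr0; case: z0 Wz.
move=> /nbhs_ballP[d /= d0 dW]; exists d => // e e0 ed p ps.
have -> : k e p = k 1 (e *: p) by rewrite /k /= !mul1r.
apply: dW; rewrite -ball_normE /= sub0r normrN normrZ gtr0_norm//.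
move: ps; rewrite /square /= => ps; have : 0 <= `|p| by []. nra.
Qed.

Lemma chart_interior : ~ D x -> exists psi : P -> T,
  [/\ square_embedding psi, psi 0 = x & forall p, square R p -> ~ D (psi p)].
Proof.
move=> Dx; have [oA cA iA VA dA] := ca.
have [|W oW WE] := VA a.1 oA; first by [].
have : (a.2 @` a.1) z0 by exists x.
rewrite WE => -[Wz hz].
have iz : 0 < complex.Im z0.
  by rewrite lt_def hz andbT; apply/eqP => E; apply: Dx; apply/dA.
have oI : open ((@complex.Im R : Cplx R -> R) @^-1` [set r | 0 < r]).
  by apply: open_comp; [move=> z _; exact: im_cts|exact: open_gt].
have [|d d0 dW] := near_k (openI oW oI); first by split.
have dd : 0 < d / 2 by lra.
have d2 : d / 2 < d by lra.
have [|psi [cp ip gp]] := @chart_pull (d / 2) (square R) dd.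
  by move=> p ps; rewrite WE; have [W1 /ltW W2] := dW _ dd d2 p ps.
have s0 : square R 0 by rewrite /square /= normr0.
exists psi; split.
- split=> //.
  have -> : psi @` open_square R = a.1 `&` a.2 @^-1` (k (d / 2) @` open_square R).
    apply/seteqP; split=> [_ [p po <-]|y [ay [p po E]]].
      by have [g1 g2] := gp _ (open_square_sub po); split=> //; exists p.
    exists p => //; have [g1 g2] := gp _ (open_square_sub po).
    by apply: iA; rewrite ?inE// g2.
  by apply: open_within_preimage => //; exact: k_open.
- have [g1 g2] := gp _ s0; apply: iA; rewrite ?inE// g2 /k /= !mulr0 !addr0.
  exact: (reimK (a.2 x)).
- move=> p ps; have [g1 g2] := gp _ ps; rewrite dA// g2 => E.
  have [W1 W2] := dW _ dd d2 p ps.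
  have W3 : 0 < complex.Im (k (d / 2) p) by exact: W2.
  by move: W3; rewrite E ltxx.
Qed.

Lemma chart_boundary : D x -> exists psi : P -> T, half_square_embedding psi /\ psi 0 = x.
Proof.
move=> Dx; have [oA cA iA VA dA] := ca.
have [|W oW WE] := VA a.1 oA; first by [].
have : (a.2 @` a.1) z0 by exists x.
rewrite WE => -[Wz hz].
have iz : complex.Im z0 = 0 by apply/dA.
have [d d0 dW] := near_k oW Wz.
have dd : 0 < d / 2 by lra.
have d2 : d / 2 < d by lra.
have [|psi [cp ip gp]] := @chart_pull (d / 2) half_square dd.
  move=> p [ps p2]; rewrite WE; split; first by apply: dW.
  by rewrite /half_plane /= iz add0r mulr_ge0// ltW.
have s0 : half_square 0 by split; rewrite /= ?normr0.
exists psi; split; last first.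
  have [g1 g2] := gp _ s0; apply: iA; rewrite ?inE// g2 /k /= !mulr0 !addr0.
  exact: (reimK (a.2 x)).
split=> //.
- have -> : psi @` open_half_square = a.1 `&` a.2 @^-1` (k (d / 2) @` open_square R).
    apply/seteqP; split=> [_ [p po <-]|y [ay [p po E]]].
      by have [g1 g2] := gp _ (open_half_square_sub po); split=> //; exists p => //; case: po.
    have hp : open_half_square p.
      split=> //; have : (a.2 @` a.1) (a.2 y) by exists y.
      rewrite WE => -[_]; rewrite /half_plane /= -E /k /= iz add0r.
      by rewrite pmulr_rge0.
    exists p => //; have [g1 g2] := gp _ (open_half_square_sub hp).
    by apply: iA; rewrite ?inE// g2.
  by apply: open_within_preimage => //; exact: k_open.
- move=> p ps; have [g1 g2] := gp _ ps; rewrite dA// g2 /k /= iz add0r.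
  split=> [/eqP|->]; last by rewrite mulr0.
  by rewrite mulf_eq0 (gt_eqF dd) /= => /eqP.
Qed.

End HalfSquares.
Arguments half_square R : clear implicits.
Arguments open_half_square R : clear implicits.

(** * Collars *)

(** If [Q D] failed, the sets [B] with [Q (D `\` B)] would form a proper filter
    with a cluster point in [D]. *)
Lemma compact_local (T : topologicalType) (D : set T) (Q : set T -> Prop) :
  compact D -> Q set0 -> (forall A B, Q A -> Q B -> Q (A `|` B)) ->
  (forall A B, A `<=` B -> Q B -> Q A) ->
  (forall x, D x -> exists V, [/\ open V, V x & Q V]) -> Q D.
Proof.
move=> cD Q0 QU QS QV; apply: contrapT => nQ.
pose F : set_system T := [set B | Q (D `\` B)].
have FF : ProperFilter F.
  split; first by rewrite /F /= setD0.
  split; rewrite /F /=; first by rewrite setDT.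
    move=> A B QA QB; suff : Q (D `\` (A `&` B)) by [].
    have -> : D `\` (A `&` B) = (D `\` A) `|` (D `\` B).
      by rewrite !setDE setCI setIUr.
    exact: QU.
  by move=> A B AB; apply: QS => x [Dx nB]; split=> // /AB.
have FD : F D by rewrite /F /= setDv.
have [x [Dx cx]] := cD F FF FD; have [V [oV Vx QV']] := QV _ Dx.
have FV : F (~` V) by apply: QS QV' => y [_ /contrapT].
by have [y []] := cx _ _ FV (open_nbhs_nbhs (conj oV Vx)).
Qed.

Lemma openX (T U : topologicalType) (A : set T) (B : set U) :
  open A -> open B -> open (A `*` B).
Proof.
move=> oA oB; have -> : A `*` B = fst @^-1` A `&` snd @^-1` B by [].
by apply: openI; apply: open_comp => // p _; [exact: cvg_fst|exact: cvg_snd].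
Qed.

Section IntoSubspace.
Variables (T U : topologicalType) (Y : set U).

Lemma within_into (K : set T) (f : T -> U) : {within K, continuous f} ->
  (forall x, K x -> Y (f x)) -> {within K, continuous (f : T -> subspace Y)}.
Proof.
move=> cf KY; apply/continuousP => O /open_subspaceP[V oV VY].
have : open (f @^-1` V : set (subspace K)) by move/continuousP : cf; apply.
move=> /open_subspaceP[W oW WK]; apply/open_subspaceP; exists W => //.
rewrite WK; apply/seteqP; split=> x [fx Kx]; split=> //.
  have : (V `&` Y) (f x) by split=> //; exact: KY.
  by rewrite VY => -[].
have : (O `&` Y) (f x) by split=> //; exact: KY.
by rewrite -VY => -[].
Qed.

End IntoSubspace.

Section Collar.
Variables (R : realType) (T : topologicalType).
Hypothesis hT : hausdorff_space T.
Variable D : set T.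
Local Notation P := (R * R)%type.

(** [T] with the external collar [D * [-1, 0]] glued along [D * {0}]. *)
Definition collared : set (T * R) :=
  [set p | p.2 = 0 \/ (D p.1 /\ -1 <= p.2 <= 0)].
Local Notation Y := (subspace collared).

Lemma hausdorff_collared : hausdorff_space Y.
Proof.
apply: subspace_hausdorff; rewrite open_hausdorff => -[x s] [y t] /eqP xy.
have [E|/eqP xy'] := pselect (x = y).
  have /eqP st : s <> t by move=> st; apply: xy; rewrite E st.
  have := @Rhausdorff R; rewrite open_hausdorff => /(_ _ _ st) [[A B] /= [As Bt] [oA oB AB]].
  exists (setT `*` A, setT `*` B); split; rewrite /= ?inE.
  - by split=> //; move: As; rewrite inE.
  - by split=> //; move: Bt; rewrite inE.
  - by apply: openX => //; exact: openT.
  - by apply: openX => //; exact: openT.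
  - rewrite (_ : _ `&` _ = set0) ?eqxx//; apply/seteqP; split=> // -[u v] [[_ /= Av] [_ /= Bv]].
    by move/eqP: AB => AB; have : (A `&` B) v by []; rewrite AB.
have := hT; rewrite open_hausdorff => /(_ _ _ xy') [[A B] /= [As Bt] [oA oB AB]].
exists (A `*` setT, B `*` setT); split; rewrite /= ?inE.
- by split=> //; move: As; rewrite inE.
- by split=> //; move: Bt; rewrite inE.
- by apply: openX => //; exact: openT.
- by apply: openX => //; exact: openT.
- rewrite (_ : _ `&` _ = set0) ?eqxx//; apply/seteqP; split=> // -[u v] [[/= Au _] [/= Bu _]].
  by move/eqP: AB => AB; have : (A `&` B) u by []; rewrite AB.
Qed.

(** Positive and negative parts are written with the absolute value, so that
    their continuity is that of the absolute value. *)
Definition pos_part (x : R) := (x + `|x|) / 2.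
Definition neg_part (x : R) := (x - `|x|) / 2.

Lemma pos_part_ge x : 0 <= x -> pos_part x = x.
Proof. by rewrite /pos_part => h; rewrite ger0_norm//; lra. Qed.
Lemma pos_part_le x : x <= 0 -> pos_part x = 0.
Proof. by rewrite /pos_part => h; rewrite ler0_norm//; lra. Qed.
Lemma neg_part_ge x : 0 <= x -> neg_part x = 0.
Proof. by rewrite /neg_part => h; rewrite ger0_norm//; lra. Qed.
Lemma neg_part_le x : x <= 0 -> neg_part x = x.
Proof. by rewrite /neg_part => h; rewrite ler0_norm//; lra. Qed.
Lemma pos_part_add_neg_part x : pos_part x + neg_part x = x.
Proof. by rewrite /pos_part /neg_part; lra. Qed.

(** A chart across the boundary: the given chart inside [T], and a product
    with the fibres in the external collar. *)
Definition straddle (psi : P -> T) (p : P) : T * R := (psi (p.1, pos_part p.2), neg_part p.2).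

Lemma pos_part_half_square p : square R p -> half_square R (p.1, pos_part p.2).
Proof.
rewrite /square /half_square /= !pnorm_le /= => /andP[a b].
have [h|h] := lerP 0 p.2; first by rewrite pos_part_ge// a b.
by rewrite pos_part_le ?(ltW h)// a normr0 ler01.
Qed.

Lemma pos_part_open_half_square p : open_square R p -> open_half_square R (p.1, pos_part p.2).
Proof.
rewrite /open_square /open_half_square /= !pnorm_lt /= => /andP[a b].
have [h|h] := lerP 0 p.2; first by rewrite pos_part_ge// a b.
by rewrite pos_part_le ?(ltW h)// a normr0 ltr01.
Qed.

Lemma straddle_le psi p : p.2 <= 0 -> straddle psi p = (psi (p.1, 0), p.2).
Proof. by move=> h; rewrite /straddle pos_part_le// neg_part_le. Qed.

Lemma straddle_ge psi p : 0 <= p.2 -> straddle psi p = (psi p, 0).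
Proof. by move=> h; rewrite /straddle pos_part_ge// neg_part_ge//; case: p h. Qed.

Lemma straddleY psi p : half_square_embedding D psi -> square R p -> collared (straddle psi p).
Proof.
move=> [c i o d] ps; have [h|/ltW h] := lerP 0 p.2.
  by rewrite straddle_ge//; left.
rewrite straddle_le//; right; split=> /=.
  apply/d => //; rewrite -(pos_part_le h); exact: pos_part_half_square.
by move: ps; rewrite /square /= pnorm_le ler_norml => /andP[_]; rewrite ler_norml => /andP[-> _].
Qed.

Lemma straddle_embedding psi : half_square_embedding D psi -> square_embedding (straddle psi : P -> Y).
Proof.
move=> psiE; have [c i o d] := psiE.
have cpos : continuous (fun p : P => (p.1, pos_part p.2)) by rewrite /pos_part; cts.
have cneg : continuous (fun p : P => neg_part p.2) by rewrite /neg_part; cts.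
split.
- apply: within_into; last by move=> p ps; exact: straddleY.
  apply: within_pair; last exact: continuous_subspaceT.
  apply: (@within_comp _ _ _ _ (half_square R) (fun p : P => (p.1, pos_part p.2)) psi) => //.
    exact: continuous_subspaceT.
  exact: pos_part_half_square.
- move=> p q; rewrite !inE => ps qs [/i]; rewrite !inE => E Eneg.
  have [E1 Epos] := E (pos_part_half_square ps) (pos_part_half_square qs).
  case: p q E1 Epos Eneg {E ps qs} => [p1 p2] [q1 q2] /= -> Epos Eneg.
  by rewrite -(pos_part_add_neg_part p2) -(pos_part_add_neg_part q2) Epos Eneg.
- apply/open_subspaceP; exists ((psi @` open_half_square R) `*` [set t | -1 < t]).
    by apply: openX => //; exact: open_gt.
  apply/seteqP; split=> [[x t] [[/= [p [p1 p2] px] t1]]|_ [[p po <-] Yp]].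
  + move=> Yxt; split=> //; case: Yxt => /= [t0|[Dx /andP[_ t0]]].
      by exists p => //; rewrite straddle_ge// px t0.
    have hp : half_square R p by apply: open_half_square_sub.
    have pE : p.2 = 0 by apply/d => //; rewrite px.
    exists (p.1, t) => /=.
      move: p1; rewrite /open_square /= !pnorm_lt /= => /andP[-> _].
      by rewrite ltr_norml t1 /=; lra.
    have pp : (p.1, 0) = p by rewrite -pE; case: (p).
    by rewrite straddle_le//= pp px.
  + split=> //; split=> /=.
      by exists (p.1, pos_part p.2) => //; exact: pos_part_open_half_square.
    move: po; rewrite /open_square /= pnorm_lt => /andP[_]; rewrite ltr_norml => /andP[h _].
    have [h0|/ltW h0] := lerP 0 p.2; first by rewrite neg_part_ge//; lra.
    by rewrite neg_part_le.
Qed.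

(** Homeomorphisms preserving each fibre [{x} * [-1, 0]] and moving its points
    away from [T]. Monotonicity along the fibre makes the property stable under
    composition. *)
Definition outward (f : Y -> Y) : Prop :=
  [/\ homeo f,
      forall p, collared (f p) <-> collared p,
      forall x, D x -> f (x, -1) = (x, -1) &
      forall x t, D x -> -1 <= t <= 0 ->
        [/\ (f (x, t)).1 = x, -1 <= (f (x, t)).2 <= t &
            forall s, -1 <= s < t -> (f (x, s)).2 < (f (x, t)).2]].

Lemma outward_id : outward id.
Proof.
split=> //; first exact: homeo_id.
by move=> x t Dx /andP[t1 t0]; split=> //=; [rewrite t1 lexx|move=> s /andP[]].
Qed.

Lemma outward_fibre f x t : outward f -> D x -> -1 <= t <= 0 ->
  f (x, t) = (x, (f (x, t)).2).
Proof.
by move=> [_ _ _ /(_ x t) H] Dx t10; have [+ _ _] := H Dx t10; case: (f (x, t)) => a b /= ->.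
Qed.

Lemma outward_range f x t : outward f -> D x -> -1 <= t <= 0 ->
  -1 <= (f (x, t)).2 <= 0.
Proof.
move=> [_ _ _ /(_ x t) H] Dx t10; have [_ /andP[a b] _] := H Dx t10.
by rewrite a /=; case/andP: t10 => _; exact: le_trans.
Qed.

Lemma outward_comp f g : outward f -> outward g -> outward (g \o f).
Proof.
move=> fo go; have [hf fY f1 fH] := fo; have [hg gY g1 gH] := go; split.
- exact: homeo_comp.
- by move=> p; rewrite /= gY fY.
- by move=> x Dx /=; rewrite f1// g1.
- move=> x t Dx t10; have [a /andP[b c] d] := fH x t Dx t10.
  have r := outward_range fo Dx t10.
  have [a' /andP[b' c'] d'] := gH x (f (x, t)).2 Dx r.
  have E := outward_fibre fo Dx t10.
  rewrite /= E; split=> //; first by rewrite b' (le_trans c').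
  move=> s /andP[s1 st].
  have s10 : -1 <= s <= 0 by case/andP: t10 => _ t0; rewrite s1 (le_trans (ltW st)).
  rewrite (outward_fibre fo Dx s10); apply: d'; rewrite d ?s1 ?st// andbT.
  by have /andP[] := outward_range fo Dx s10.
Qed.

(** The centre of a straddling square is pushed along the fibre. *)
Lemma outward_push psi : half_square_embedding D psi -> exists f, outward f /\
  forall x, D x -> (psi @` open_half_square R) x -> (f (x, 0)).2 < 0.
Proof.
move=> psiE; have [c i o d] := psiE; have se := straddle_embedding psiE.
pose a : P := (0, - 2^-1).
have a1 : `|a| < 1.
  by rewrite pnorm_lt /= !ltr_norml; apply/andP; split; apply/andP; split; lra.
have [f [hf fp fo]] := square_homeo hausdorff_collared se (@push_cts _ a) (push_bij a1) (@push_edge _ a).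
have pE (p : P) : push a p = (p.1, p.2 - (1 - `|p|) / 2).
  rewrite /push /a -[LHS]/(p.1 + (1 - `|p|) * 0, p.2 + (1 - `|p|) * (- 2^-1)).
  by congr pair; lra.
have [tf _ _] := push_bij a1.
have hl x : D x -> (psi @` half_square R) x ->
    exists2 u : R, `|u| <= 1 & forall t, -1 <= t <= 0 ->
      f (x, t) = (x, t - (1 - `|(u, t)|) / 2).
  move=> Dx [p ps px]; have p2 : p.2 = 0 by apply/d => //; rewrite px.
  have pp : (p.1, 0) = p by rewrite -p2; case: (p).
  have p1 : `|p.1| <= 1 by case: ps; rewrite pnorm_le => /andP[].
  exists p.1 => // t /andP[t1 t0].
  have s : square R (p.1, t) by rewrite /square /= pnorm_le p1 /= ler_norml t1 /=; lra.
  have -> : (x, t) = straddle psi (p.1, t) by rewrite straddle_le//= pp px.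
  have n1 : `|(p.1, t)| <= 1 by exact: s.
  rewrite fp// pE straddle_le /=; last by lra.
  by rewrite pp px.
have out x t : ~ (psi @` half_square R) x -> f (x, t) = (x, t).
  move=> nx; apply: fo => -[p po]; rewrite /straddle => -[E _]; apply: nx.
  by exists (p.1, pos_part p.2) => //; exact/pos_part_half_square/open_square_sub.
exists f; split; last first.
  move=> x Dx [p po px]; have [|u u1 H] := hl x Dx.
    by exists p => //; exact: open_half_square_sub.
  have p2 : p.2 = 0 by apply/d; [exact: open_half_square_sub|rewrite px].
  have pp : (p.1, 0) = p by rewrite -p2; case: (p).
  have s : square R (p.1, 0) by rewrite pp; case: po => /ltW.
  have := fp _ s; rewrite straddle_le//= pp px => ->.
  rewrite pE straddle_le /=; case: po => n1 _; lra.
split=> //.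
- move=> p; have [[q qs E]|np] := pselect ((straddle psi @` square R) p).
    by rewrite -E fp//; split=> _; apply: straddleY => //; exact: tf.
  by rewrite fo// => -[q /open_square_sub qs E]; apply: np; exists q.
- move=> x Dx; have [/(hl x Dx)[u u1 H]|nx] := pselect ((psi @` half_square R) x); last exact: out.
  rewrite H ?lexx ?lerN10//; congr pair.
  have -> : `|(u, -1)| = 1 by rewrite pnormE /= normrN normr1; apply/max_idPr.
  by lra.
- move=> x t Dx t10; have [/(hl x Dx)[u u1 H]|nx] := pselect ((psi @` half_square R) x); last first.
    rewrite out//; split=> //=; first by case/andP: t10 => -> _; rewrite lexx.
    by move=> s /andP[_ st]; rewrite out.
  rewrite H//=; have /andP[t1 t0] := t10.
  have n1 : `|(u, t)| <= 1 by rewrite pnorm_le u1 /= ler_norml t1 /=; lra.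
  have n2 : - t <= `|(u, t)| by rewrite pnormE le_max /= (ler0_norm t0) lexx orbT.
  split=> //; first by apply/andP; split; lra.
  move=> s /andP[s1 st]; rewrite H ?s1 /=; last by lra.
  suff : `|(u, s)| - `|(u, t)| <= t - s by lra.
  have : `|((u, s) : P) - (u, t)| <= t - s.
    rewrite pnorm_le /= subrr normr0 distrC gtr0_norm; last by lra.
    by rewrite lexx andbT; lra.
  have := lerB_dist ((u, s) : P) (u, t); lra.
Qed.


Hypothesis kD : compact D.
Hypothesis bD : forall x, D x -> exists psi : P -> T, half_square_embedding D psi /\ psi 0 = x.

(** By compactness finitely many pushes move all boundary points. *)
Lemma outward_exists : exists f, outward f /\ forall x, D x -> (f (x, 0)).2 < 0.
Proof.
pose Q (A : set T) := exists f, outward f /\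
  forall x, D x -> A x -> (f (x, 0)).2 < 0.
suff [f [fo fD]] : Q D by exists f; split=> // x Dx; exact: fD.
have z10 : -1 <= (0 : R) <= 0 by rewrite lexx lerN10.
apply: compact_local => //.
- by exists id; split=> //; exact: outward_id.
- move=> A B [f [fo fA]] [g [go gB]]; exists (g \o f).
  split; first exact: outward_comp.
  move=> x Dx AB; have [_ _ _ /(_ x (f (x, 0)).2 Dx (outward_range fo Dx z10))] := go.
  rewrite /= -(outward_fibre fo Dx z10) => -[_ /andP[_ le] _].
  have [Ax|nA] := pselect (A x); first by apply: le_lt_trans le _; exact: fA.
  have Bx : B x by case: AB.
  have := outward_range fo Dx z10 => /andP[_]; rewrite le_eqVlt => /orP[/eqP E|lt].
    by rewrite (outward_fibre fo Dx z10) E; exact: gB.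
  exact: le_lt_trans le lt.
- move=> A B AB [f [fo fB]]; exists f; split=> // x Dx /AB; exact: fB.
- move=> x Dx; have [psi [psiE p0]] := bD Dx; exists (psi @` open_half_square R); split.
  + by case: psiE.
  + by exists 0 => //; split; rewrite /= ?normr0.
  + by have [f [fo fD]] := outward_push psiE; exists f.
Qed.

(** An outward homeomorphism moves the boundary into the external collar. The
    part of the fibres between the old and the new boundary belongs to the image
    of [T], and its preimage is a collar inside [T]. *)
Lemma collar : exists E : T -> R -> T,
  [/\ {within D `*` `[0, 1], continuous (fun p : T * R => E p.1 p.2)},
      forall x, D x -> E x 0 = x,
      forall x y s t, D x -> D y -> 0 <= s <= 1 -> 0 <= t <= 1 ->
        E x s = E y t -> x = y /\ s = t &
      open [set y | exists x s, [/\ D x, 0 <= s < 1 & y = E x s]]].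
Proof.
have [f [fo f0]] := outward_exists; have [[g [cf cg fK gK]] fY f1 fH] := fo.
have z10 : -1 <= (0 : R) <= 0 by rewrite lexx lerN10.
pose ph x := (f (x, 0)).2.
have phr x : D x -> -1 <= ph x < 0.
  by move=> Dx; rewrite f0// andbT; have /andP[] := outward_range fo Dx z10.
have c0 : continuous ((fun x => (x, 0)) : T -> Y).
  apply/continuous_subspace_setT; apply: within_into; last by move=> x _; left.
  by apply: continuous_subspaceT; apply: ctspair; [exact: ctsid|exact: ctsc].
have ci : continuous (incl_subspace : Y -> T * R) by exact: incl_subspace_continuous.
have cf0 : continuous (fun x => (incl_subspace (f (x, 0))) : T * R).
  by apply: (ctscomp (f := fun x => f (x, 0)) (g := incl_subspace)) => //; exact: (ctscomp c0 cf).
have cph : continuous ph by apply: ctssnd cf0.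
pose e (p : T * R) : T * R := (p.1, (1 - p.2) * ph p.1).
have ce : continuous e.
  apply: ctspair; first by cts.
  by apply: ctsM; [cts|exact: (ctscomp (f := fst) (g := ph)) (ctsfst (@ctsid _)) cph].
have er p : D p.1 -> 0 <= p.2 <= 1 -> ph p.1 <= (e p).2 <= 0.
  move=> Dx /andP[s0 s1]; have /andP[h1 h2] := phr _ Dx.
  by apply/andP; split; rewrite /=; nra.
have eY p : (D `*` `[0, 1]) p -> collared (e p).
  case: p => x s [/= Dx]; rewrite in_itv /= => s01; right; split=> //.
  have /andP[h1 h2] := er (x, s) Dx s01; have /andP[h3 h4] := phr _ Dx.
  by rewrite (le_trans h3 h1) h2.
pose E x s := (incl_subspace (g (e (x, s)))).1.
have EE x s : D x -> 0 <= s <= 1 -> f (E x s, 0) = e (x, s).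
  move=> Dx s01; have eYx : collared (e (x, s)) by apply: eY; split=> //=; rewrite in_itv.
  have gY : collared (g (e (x, s))) by rewrite -fY gK.
  suff -> : (E x s, 0) = g (e (x, s)) by rewrite gK.
  rewrite /E /incl_subspace; case Eg : (g (e (x, s))) gY => [y u] [/= -> //|[/= Dy /andP[u1 u0]]].
  congr pair; apply/eqP; rewrite eq_le u0 andbT leNgt; apply/negP => ult.
  have fyu : f (y, u) = e (x, s) by rewrite -Eg gK.
  have u10 : -1 <= u <= 0 by rewrite u1.
  have [e1 _ _] := fH y u Dy u10; move: e1; rewrite fyu /= => xy.
  have [_ _ /(_ u)] := fH y 0 Dy z10.
  rewrite u1 ult fyu /= => /(_ isT); rewrite -xy.
  have /andP[+ _] := er (x, s) Dx s01; rewrite /= /ph; lra.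
exists E; split.
- have cge : {within D `*` `[0, 1], continuous (fun p => g (e p))}.
    apply: (@within_comp _ _ _ _ setT (e : T * R -> Y) g) => //.
      by apply: within_into => //; exact: continuous_subspaceT.
    exact: continuous_subspaceT.
  apply: (@within_comp _ _ _ _ setT (fun p => g (e p)) (fun q => (incl_subspace q).1)) => //.
    by apply: continuous_subspaceT; apply: ctsfst.
- move=> x Dx; rewrite /E.
  have -> : e (x, 0) = f (x, 0).
    by rewrite /e /= subr0 mul1r (outward_fibre fo Dx z10).
  by rewrite fK.
- move=> x y s t Dx Dy s01 t01 EX; have := EE _ _ Dx s01.
  rewrite EX EE//; case=> <- H; split=> //.
  have /andP[_ p0] := phr _ Dy; have p1 : ph y != 0 by rewrite lt_eqF.
  move/(mulIf p1): H; lra.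
- have -> : [set y | exists x s, [/\ D x, 0 <= s < 1 & y = E x s]] =
      (fun y => (incl_subspace (f (y, 0))).2) @^-1` [set t | t < 0].
    apply/seteqP; split=> [y [x [s [Dx /andP[s0 s1] ->]]]|y].
      rewrite /preimage /= EE// ?s0 ?ltW//=.
      by have /andP[_ p0] := phr _ Dx; nra.
    rewrite /preimage /= /incl_subspace => y0.
    have yY : collared (f (y, 0)) by rewrite fY; left.
    case Ef : (f (y, 0)) y0 yY => [x t] /= t0 [/= tE|[/= Dx /andP[t1 _]]].
      by move: t0; rewrite tE ltxx.
    have /andP[p1 p0] := phr _ Dx.
    have pt : ph x <= t.
      rewrite leNgt; apply/negP => tph.
      have cfib : {within `[-1, 0], continuous (fun u => (incl_subspace (f (x, u))).2)}.
        apply: (@within_comp _ _ _ _ setT ((fun u => (x, u)) : R -> Y) (fun q => (incl_subspace (f q)).2)) => //.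
          apply: within_into; last first.
            by move=> u /=; rewrite in_itv /= => u10; right.
          by apply: continuous_subspaceT; apply: ctspair; [move=> ?; exact: cvg_cst|exact: ctsid].
        apply: continuous_subspaceT; apply: ctssnd.
        exact: (ctscomp (f := f) (g := incl_subspace)).
      have [|u] := @IVT R _ (-1) 0 t (lerN10 R) cfib.
        rewrite /incl_subspace f1//= -/(ph x) ge_min le_max t1 /=.
        by rewrite (ltW tph) orbT.
      rewrite in_itv /= => u10 fu.
      have fxu : f (x, u) = (x, t).
        by rewrite (outward_fibre fo Dx u10); congr pair; exact: fu.
      have : (x, u) = (y, 0) by rewrite -[LHS]fK -[RHS]fK fxu Ef.
      by case=> xy _; move: tph; rewrite /ph xy Ef ltxx.
    have pn0 : ph x != 0 by rewrite lt_eqF.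
    exists x, (1 - t / ph x); split=> //.
      apply/andP; split; first by rewrite subr_ge0 ler_ndivrMr// mul1r.
      by rewrite ltrBlDr ltrDl nmulr_lgt0// invr_lt0.
    rewrite /E (_ : e _ = f (y, 0)) ?fK// Ef /e /=.
    by congr pair; rewrite opprB addrC subrK divfK.
apply: open_comp; last exact: open_lt.
by move=> y _; exact: (ctssnd cf0).
Qed.

End Collar.

(** * Collapsing the boundary circles *)

Section SurfaceFacts.
Local Open Scope quotient_scope.
Variables (R : realType) (g h : nat) (S : bordered_surface R g h).

Lemma surface_compact : compact [set: S]. Proof. by case: S. Qed.
Lemma surface_hausdorff : hausdorff_space S. Proof. by case: S. Qed.
Lemma surface_connected : connected [set: S]. Proof. by case: S. Qed.
Lemma circ_circle i : circle_in R (circ S i). Proof. by case: S i. Qed.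
Lemma circ_disjoint i j : i != j -> circ S i `&` circ S j = set0.
Proof. by case: S i j. Qed.
Lemma surface_chart x : exists a : chart R S, is_chart (bdry S) a /\ a.1 x.
Proof.
by case: S x => T A c ? ? ? ? ? ? ca At ? ? x; have [a aA ax] := At x; exists a; split=> //; exact: (ca _ aA).
Qed.
Lemma surface_genus : has_genus R (bdry S) g. Proof. by case: S. Qed.

Lemma circ_uniq i j x : circ S i x -> circ S j x -> i = j.
Proof.
move=> ix jx; apply: contrapT => /eqP /circ_disjoint E.
by have : set0 x by rewrite -E.
Qed.

Lemma circ_compact i : compact (circ S i).
Proof. exact/circle_compact/circ_circle. Qed.

Lemma circ_nonempty i : exists x, circ S i x.
Proof. by have [gam [_ _ ->]] := circ_circle i; exists (gam 0); exists 0. Qed.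

Lemma bigcup_circ_compact (Q : set 'I_h) : compact (\bigcup_(i in Q) circ S i).
Proof.
have -> : \bigcup_(i in Q) circ S i = \big[setU/set0]_(i <- enum 'I_h | `[< Q i >]) circ S i.
  rewrite -bigcup_seq_cond; apply/seteqP; split=> x [i Qi ix]; exists i => //=.
    by rewrite mem_enum; apply/asboolP.
  by move: Qi; rewrite /= mem_enum /= => Qi; apply/asboolP; case: Qi.
by apply: bigsetU_compact => i _; exact: circ_compact.
Qed.

Lemma bdry_compact : compact (bdry S).
Proof. exact: bigcup_circ_compact. Qed.

Lemma surface_closed (A : set S) : compact A -> closed A.
Proof. by apply: compact_closed; exact: surface_hausdorff. Qed.

Definition collapse_rel (x y : S) : bool :=
  `[< x = y \/ exists i, circ S i x /\ circ S i y >].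

Lemma collapse_equiv : equiv_class_of collapse_rel.
Proof.
split=> [x|x y|y x z].
- by apply/asboolP; left.
- by apply/asboolP/asboolP => -[->|[i [a b]]]; [left|right; exists i|left|right; exists i].
- move=> /asboolP[->|[i [a b]]] /asboolP[E|[j [c d]]]; apply/asboolP.
  + by left.
  + by right; exists j.
  + by rewrite -E; right; exists i.
  + by right; exists i; rewrite (circ_uniq b c) in a *.
Qed.

Canonical collapse_equivRel := EquivRelPack collapse_equiv.

(** A closed surface on which punctures and boundary circles are both points. *)
Definition capped : topologicalType := quotient_topology {eq_quot collapse_equivRel}.

Definition capping (x : S) : capped := \pi_({eq_quot collapse_equivRel}) x.
Definition uncap (y : capped) : S := repr (y : {eq_quot collapse_equivRel}).

Lemma uncapK y : capping (uncap y) = y.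
Proof. exact: reprK. Qed.

Lemma cappingP x y : capping x = capping y <->
  x = y \/ exists i, circ S i x /\ circ S i y.
Proof. by split=> [/eqmodP/asboolP|H]; last by apply/eqmodP/asboolP. Qed.

Lemma capping_cts : continuous capping.
Proof. exact: pi_continuous. Qed.

Lemma capping_open (U : set capped) : open (capping @^-1` U) -> open U.
Proof. by []. Qed.
End SurfaceFacts.

Section Polar.
Variable R : realType.
Local Notation P := (R * R)%type.
Local Notation Q := (`[0, 1]%classic `*` `[0, 1]%classic : set (R * R)).

(** Polar coordinates, with the angle measured in turns. The radius goes up to
    2 so that the disc contains the square, whose corners are at distance
    [Num.sqrt 2]. *)
Definition polar (p : P) : P :=
  (2 * p.2 * cos ((pi *+ 2) * p.1), 2 * p.2 * sin ((pi *+ 2) * p.1)).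

Lemma polar_cts : continuous polar.
Proof.
have ca : continuous (fun p : P => (pi *+ 2) * p.1) by cts.
apply: ctspair; apply: ctsM; cts.
  exact: (ctscomp ca (@continuous_cos R)).
exact: (ctscomp ca (@continuous_sin R)).
Qed.

Lemma polar_sqr p : (polar p).1 ^+ 2 + (polar p).2 ^+ 2 = 4 * p.2 ^+ 2.
Proof.
rewrite /polar /=; set c := cos _; set s := sin _.
have cs : c ^+ 2 + s ^+ 2 = 1 by exact: cos2Dsin2.
transitivity (4 * p.2 ^+ 2 * (c ^+ 2 + s ^+ 2)); [by ring|by rewrite cs mulr1].
Qed.

Lemma polar_inj p q : 0 <= p.2 -> 0 <= q.2 -> polar p = polar q ->
  p.2 = q.2 /\ (p.2 = 0 \/ exists k : int, p.1 - q.1 = k%:~R).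
Proof.
move=> p0 q0 E.
have e2 : p.2 = q.2.
  have := polar_sqr p; rewrite E polar_sqr => /(mulfI (_ : (4 : R) != 0)) H.
  have {}H : q.2 ^+ 2 = p.2 ^+ 2 by apply: H; rewrite pnatr_eq0.
  by apply/eqP; rewrite -(@eqrXn2 _ 2)// H.
split=> //; have [->|/eqP pn] := pselect (p.2 = 0); [by left|right].
move: E; rewrite /polar -e2 => -[].
have n0 : 2 * p.2 != 0 by rewrite mulf_neq0// pnatr_eq0.
move=> /(mulfI n0) ec /(mulfI n0) es.
have c1 : cos ((pi *+ 2) * p.1 - (pi *+ 2) * q.1) = 1.
  by rewrite cosB ec es -!expr2 cos2Dsin2.
have [k kE] := cos1_2pi c1; exists k.
have p2 : (pi *+ 2 : R) != 0 by rewrite gt_eqF// mulrn_wgt0// pi_gt0.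
by apply: (mulfI p2); rewrite -kE mulrBr.
Qed.

Lemma polar_surj z : z.1 ^+ 2 + z.2 ^+ 2 <= 4 -> exists2 p, Q p & polar p = z.
Proof.
move=> z4; set n := z.1 ^+ 2 + z.2 ^+ 2 in z4.
have n0 : 0 <= n by rewrite addr_ge0 ?sqr_ge0.
pose s := Num.sqrt n / 2.
have r2 : Num.sqrt n ^+ 2 = n by exact: sqr_sqrtr.
have r0 : 0 <= Num.sqrt n by exact: sqrtr_ge0.
have s1 : s <= 1.
  have : Num.sqrt n <= 2 by rewrite -(@ler_pXn2r _ 2) ?nnegrE// r2; lra.
  by rewrite /s; lra.
have s0 : 0 <= s by rewrite /s; lra.
have p2 : (pi *+ 2 : R) != 0 by rewrite gt_eqF// mulrn_wgt0// pi_gt0.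
have p0 := pi_gt0 R.
have [rz|rz] := eqVneq (Num.sqrt n) 0.
  have nz : n = 0 by rewrite -r2 rz expr0n.
  have [z1 z2] : z.1 = 0 /\ z.2 = 0.
    have : z.1 ^+ 2 = 0 /\ z.2 ^+ 2 = 0.
      by move: nz; rewrite /n; have := sqr_ge0 z.1; have := sqr_ge0 z.2; split; lra.
    by move=> [/eqP + /eqP]; rewrite !sqrf_eq0 => /eqP-> /eqP->.
  exists (0, 0); first by split; rewrite /= in_itv /= lexx ler01.
  by rewrite /polar /= mulr0 !mul0r; case: z z1 z2 {n z4 n0 s r2 r0 s1 s0 rz nz} => a b /= -> ->.
have rp : 0 < Num.sqrt n by rewrite lt_def rz.
pose u := z.1 / Num.sqrt n; pose v := z.2 / Num.sqrt n.
have uv : u ^+ 2 + v ^+ 2 = 1.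
  rewrite /u /v !expr_div_n -mulrDl -/n r2 divff//.
  by apply/eqP => nz; move: rp; rewrite nz sqrtr0 ltxx.
have u11 : -1 <= u <= 1 by apply/andP; split; nra.
have c1 := acosK u11; have sE := sin_acos u11.
have a0 := acos_ge0 u11; have a1 := acos_lepi u11.
have vv : 1 - u ^+ 2 = v ^+ 2 by lra.
have zu : z = (Num.sqrt n * u, Num.sqrt n * v).
  by rewrite /u /v ![Num.sqrt n * _]mulrC !divfK//; case: (z).
have two : 2 * s = Num.sqrt n by rewrite /s; lra.
move: sE; rewrite vv sqrtr_sqr.
have pi2 : acos u <= pi *+ 2 by rewrite mulr2n; lra.
have pp : 0 < (pi *+ 2 : R) by rewrite mulrn_wgt0.
have /andP[q0 q1] : 0 <= acos u / (pi *+ 2) <= 1.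
  apply/andP; split; first by apply: divr_ge0 => //; exact: ltW.
  by rewrite ler_pdivrMr ?mul1r.
have [v0|v0] := lerP 0 v => sE.
  exists (acos u / (pi *+ 2), s).
    split; rewrite /= in_itv /= ?s0 ?s1//.
    by rewrite q0 q1.
  by rewrite /polar /= [pi *+ 2 * _]mulrC divfK// two c1 sE (ger0_norm v0) -zu.
exists (1 - acos u / (pi *+ 2), s).
  split; rewrite /= in_itv /= ?s0 ?s1//.
  by apply/andP; split; lra.
rewrite /polar /= mulrBr mulr1 [pi *+ 2 * _]mulrC divfK// two.
rewrite cosB sinB cos2pi sin2pi c1 sE (ltr0_norm v0) !mul1r !mul0r addr0 sub0r opprK.
by rewrite -zu.
Qed.

Lemma polar_osq p : `|polar p| < 1 -> p.2 < 1.
Proof.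
have := polar_sqr p; rewrite pnorm_lt !ltr_norml => e /andP[/andP[a b] /andP[c d]].
by rewrite ltNge; apply/negP => p1; nra.
Qed.

End Polar.

Section Capped.
Variables (R : realType) (g h : nat) (S : bordered_surface R g h).
Local Notation X := (capped S).
Local Notation pi := (@capping R g h S).

Lemma capping_sat (A : set S) : pi @^-1` (pi @` A) =
  A `|` \bigcup_(i in [set i | A `&` circ S i !=set0]) circ S i.
Proof.
apply/seteqP; split=> x.
  move=> [y Ay /cappingP[<-|[i [a b]]]]; first by left.
  by right; exists i => //; exists y.
case=> [Ax|[i [y [Ay iy]] ix]]; first by exists x.
by exists y => //; apply/cappingP; right; exists i.
Qed.

(** Saturating a closed set adds finitely many circles. *)
Lemma capping_closed (A : set S) : closed A -> closed (pi @` A).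
Proof.
move=> cA; rewrite -openC; apply: capping_open.
have -> : pi @^-1` (~` (pi @` A)) =
    ~` (A `|` \bigcup_(i in [set i | A `&` circ S i !=set0]) circ S i).
  by rewrite -capping_sat.
apply: closed_openC.
by apply: closedU => //; apply: surface_closed; exact: bigcup_circ_compact.
Qed.

Lemma capping_sat_open (V : set S) : open V ->
  (forall x i, V x -> circ S i x -> circ S i `<=` V) -> open (pi @` V).
Proof.
move=> oV Vc; apply: capping_open; have -> // : pi @^-1` (pi @` V) = V.
rewrite capping_sat.
apply/seteqP; split=> x; last by left.
by case=> // -[i [y [Vy iy]] ix]; apply: (Vc y i).
Qed.

Lemma capping_interior_open (V : set S) : open V -> V `&` bdry S = set0 -> open (pi @` V).
Proof.
move=> oV VD; apply: capping_sat_open => // x i Vx ix; exfalso.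
by suff : set0 x by []; rewrite -VD; split=> //; exists i.
Qed.

Lemma capping_inj x y : ~ bdry S x -> pi x = pi y -> x = y.
Proof. by move=> nx /cappingP[//|[i [ix _]]]; exfalso; apply: nx; exists i. Qed.

Lemma capped_hausdorff : hausdorff_space X.
Proof.
rewrite open_hausdorff => y z /eqP yz.
have nS : normal_space S.
  by apply: compact_normal; [exact: surface_hausdorff|exact: surface_compact].
have cpt1 (w : X) : closed (pi @^-1` [set w]).
  apply: preimage_closed; first by move=> ? _; exact: capping_cts.
  have -> : [set w] = pi @` [set uncap w] by rewrite image_set1 uncapK.
  apply: capping_closed; exact/accessible_closed_set1/hausdorff_accessible/surface_hausdorff.
have [|B sB BC] := nS _ (cpt1 y) (~` (pi @^-1` [set z])).
  apply/set_nbhsP; exists (~` (pi @^-1` [set z])); split=> //.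
    by apply: closed_openC; exact: cpt1.
  by move=> x xy xz; apply: yz; rewrite -[y]xy -[z]xz.
have /set_nbhsP[V [oV yV VB]] := sB.
exists (~` (pi @` (~` V)), ~` (pi @` (closure B))).
  split; rewrite inE /= => -[x]; first by move=> nx xy; apply: nx; exact: yV.
  by move=> cx xz; exact: (BC _ cx).
split => /=.
- by apply: closed_openC; apply: capping_closed; exact: open_closedC.
- by apply: closed_openC; apply: capping_closed; exact: closed_closure.
- rewrite (_ : _ `&` _ = set0) ?eqxx//; apply/seteqP; split=> // w [/= n1 n2].
  apply: n2; exists (uncap w); last exact: uncapK.
  apply: subset_closure; apply: VB; apply: contrapT => nV; apply: n1.
  by exists (uncap w) => //; exact: uncapK.
Qed.

End Capped.

Section CappedSurface.
Variables (R : realType) (g h : nat) (S : bordered_surface R g h).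
Local Notation P := (R * R)%type.
Local Notation X := (capped S).
Local Notation pi := (@capping R g h S).
Local Notation Q := (`[0, 1]%classic `*` `[0, 1]%classic : set (R * R)).

Lemma boundary_square x : bdry S x -> exists psi : P -> S, half_square_embedding (bdry S) psi /\ psi 0 = x.
Proof.
by move=> Dx; have [a [ca ax]] := surface_chart x; exact: (chart_boundary ca ax).
Qed.

Lemma interior_square x : ~ bdry S x -> exists psi : P -> S,
  [/\ square_embedding psi, psi 0 = x & forall p, square R p -> ~ bdry S (psi p)].
Proof.
by move=> Dx; have [a [ca ax]] := surface_chart x; exact: (chart_interior ca ax).
Qed.

Lemma capping_square (psi : P -> S) : square_embedding psi ->
  (forall p, square R p -> ~ bdry S (psi p)) -> square_embedding (pi \o psi).
Proof.
move=> [c i o] nD; split.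
- apply: (@within_comp _ _ _ _ setT psi pi) => //.
  by apply: continuous_subspaceT; exact: capping_cts.
- move=> p q; rewrite !inE => ps qs /= /capping_inj E.
  by apply: i; rewrite ?inE//; apply: E; exact: nD.
- rewrite -(image_comp psi pi); apply: capping_interior_open => //.
  apply/seteqP; split=> // _ [[p po <-] Dp]; apply: (nD p) => //; exact: open_square_sub.
Qed.

(** A collar of a boundary circle becomes a disc, in polar coordinates, when
    the circle is collapsed. *)
Lemma cone_square i x : circ S i x -> exists psi : P -> X, square_embedding psi /\ psi 0 = pi x.
Proof.
move=> ix; have [gam [cg gi gE]] := circ_circle S i.
have [E [cE E0 Ei Eo]] := collar (@surface_hausdorff R g h S) (@bdry_compact R g h S) boundary_square.
have gD t : bdry S (gam t) by exists i => //; rewrite gE; exists t.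
pose Psi (p : P) := pi (E (gam p.1) p.2).
have PsiC : {within Q, continuous Psi}.
  pose L : set (S * R) := bdry S `*` `[0, 1]%classic.
  have : {within Q, continuous ((fun q : S * R => pi (E q.1 q.2)) \o
      (fun p : P => (gam p.1, p.2) : S * R))}; last by [].
  apply: (@within_comp _ _ _ _ L).
  - apply: continuous_subspaceT; apply: ctspair; last by cts.
    by apply: (ctscomp (f := fst) (g := gam)) => //; exact: (ctsfst (@ctsid _)).
  - apply: (@within_comp _ _ _ _ setT (fun q : S * R => E q.1 q.2) pi) => //.
    by apply: continuous_subspaceT; exact: capping_cts.
  - by move=> p [p1 p2]; split=> //=; exact: gD.
have ED y s : bdry S y -> 0 <= s <= 1 -> bdry S (E y s) -> s = 0.
  move=> Dy s01 DE; have := E0 _ DE => /(Ei _ _ _ _ DE Dy).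
  by rewrite lexx ler01 => /(_ isT s01)[_ <-].
have PsiI p q : Q p -> Q q -> Psi p = Psi q <-> polar p = polar q.
  move=> [_]; rewrite /= in_itv /= => p01 [_]; rewrite /= in_itv /= => q01.
  split.
    move=> /cappingP[/(Ei _ _ _ _ (gD _) (gD _) p01 q01)[/gi[k kE] e2]|].
      rewrite /polar e2; have -> : p.1 = q.1 + k%:~R by rewrite -kE; lra.
      have [c1 s0] := cos_sin_2pi R k.
      by rewrite mulrDr cosD sinD c1 s0 !mulr1 !mulr0 subr0 addr0.
    move=> [j [jp jq]].
    have e1 : p.2 = 0 by apply: (ED (gam p.1)) => //; exists j.
    have e2 : q.2 = 0 by apply: (ED (gam q.1)) => //; exists j.
    by rewrite /polar e1 e2 !mulr0 !mul0r.
  have /andP[p0 _] := p01; have /andP[q0 _] := q01.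
  move=> /(polar_inj p0 q0)[e2 [e1|[k kE]]].
    apply/cappingP; right; exists i; rewrite -e2 e1 !E0//.
    by rewrite gE; split; [exists p.1|exists q.1].
  have -> : Psi p = pi (E (gam q.1) p.2).
    by rewrite /Psi; congr (pi (E _ _)); apply/gi; exists k.
  by rewrite e2.
pose disc : set P := [set z | z.1 ^+ 2 + z.2 ^+ 2 <= 4].
have lift z : {p | disc z -> Q p /\ polar p = z}.
  apply: cid; have [dz|nz] := pselect (disc z); last by exists 0.
  by have [p Qp pz] := polar_surj dz; exists p.
pose psi z := Psi (sval (lift z)).
have psiE p : Q p -> psi (polar p) = Psi p.
  move=> Qp; have dp : disc (polar p).
    rewrite /disc /= polar_sqr; case: Qp => _; rewrite /= in_itv /= => /andP[? ?]; nra.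
  rewrite /psi; case: (lift (polar p)) => q /= /(_ dp)[Qq Eq].
  exact/PsiI.
have sqd z : square R z -> disc z.
  rewrite /square /disc /= pnorm_le !ler_norml => /andP[/andP[a b] /andP[c d]]; nra.
have dP z : disc z -> exists2 p, Q p & polar p = z.
  by move=> dz; exact: polar_surj.
have kQ : compact Q by apply: compact_setX; exact: segment_compact.
have cQ : closed Q by apply: compact_closed; [exact: hausdorff_plane|].
exists psi; split; last first.
  have -> : (0 : P) = polar 0 by rewrite /polar /= mulr0 !mul0r.
  have Q0 : Q 0 by split; rewrite /= in_itv /= lexx ler01.
  rewrite psiE// /Psi E0//; apply/cappingP; right; exists i; split=> //.
  by rewrite gE; exists 0.
split.
- apply/continuous_closedP => C cC; rewrite -(@closed_setSI _ (square R)); last exact: closed_square.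
  have -> : square R `&` psi @^-1` C = square R `&` @polar R @` (Q `&` (Q `&` Psi @^-1` C)).
    apply/seteqP; split=> z [zs].
      move=> Cz; split=> //; have [p Qp pz] := dP _ (sqd _ zs).
      by exists p => //; split=> //; split=> //; rewrite /preimage /= -psiE// pz.
    by move=> [p [Qp [_ Cp]] pz]; split=> //; rewrite /preimage /= -pz psiE.
  apply: closedI; first exact: closed_square.
  apply: (@closed_image_compact P P Q _ (@polar R) (@hausdorff_plane R)) => //.
    by apply: continuous_subspaceT; exact: polar_cts.
  exact: closed_within_preimage.
- move=> z w; rewrite !inE => /sqd/dP[p Qp <-] /sqd/dP[q Qq <-].
  by rewrite !psiE// => /PsiI; apply.
- pose N : set S := [set y | exists t s, 0 <= s < 1 /\ y = E (gam t) s].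
  have NE : N = [set y | exists x s, [/\ bdry S x, 0 <= s < 1 & y = E x s]] `&`
     ~` ((fun p : S * R => E p.1 p.2) @` ((\bigcup_(j in [set j | j != i]) circ S j) `*` `[0, 1])).
    apply/seteqP; split=> y.
      move=> [t [s [s1 ->]]]; split; first by exists (gam t), s.
      move=> [[z u] [/= [j ji jz]]]; rewrite in_itv /= => u01.
      have Dz : bdry S z by exists j.
      have s01 : 0 <= s <= 1 by case/andP: s1 => -> /ltW.
      move=> /(Ei _ _ _ _ Dz (gD t) u01 s01)[zt _].
      by move/eqP: ji; apply; apply: (@circ_uniq _ _ _ S _ _ z) => //; rewrite zt gE; exists t.
    move=> [[z [s [[j _ jz] s1 ->]]] n]; have [ji|ji] := eqVneq j i.
      by move: jz; rewrite ji gE => -[t _ <-]; exists t, s.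
    exfalso; apply: n; exists (z, s) => //; split; first by exists j.
    by rewrite /= in_itv /=; case/andP: s1 => -> /ltW.
  have oN : open N.
    rewrite NE; apply: openI => //; apply: closed_openC; apply: surface_closed.
    apply: continuous_compact.
      apply: continuous_subspaceW cE => p [[j _ jp] p2]; split=> //; by exists j.
    by apply: compact_setX; [exact: bigcup_circ_compact|exact: segment_compact].
  have oPN : open (pi @` N).
    apply: capping_sat_open => // y j [t [s [s1 yE]]] jy z jz.
    have s01 : 0 <= s <= 1 by case/andP: s1 => -> /ltW.
    have s0 : s = 0 by apply: (ED (gam t)) => //; exists j => //; rewrite -yE.
    have yt : y = gam t by rewrite yE s0 E0.
    have ji : j = i by apply: (@circ_uniq _ _ _ S _ _ y) => //; rewrite yt gE; exists t.
    move: jz; rewrite ji gE => -[u _ <-]; exists u, 0; rewrite lexx ltr01 E0//.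
  have -> : psi @` open_square R = pi @` N `&` ~` (Psi @` (Q `&` ~` (@polar R @^-1` open_square R))).
    apply/seteqP; split.
      move=> _ [z zo <-]; have [p Qp pz] := dP _ (sqd _ (open_square_sub zo)).
      rewrite -pz psiE//; split; last first.
        move=> [q [Qq nq]] /PsiI E1; apply: nq; rewrite /preimage /= E1// pz//.
      exists (E (gam p.1) p.2) => //; exists p.1, p.2; split=> //.
      rewrite (polar_osq (p := p)) ?pz// andbT.
      by case: Qp => _; rewrite /= in_itv /= => /andP[].
    move=> _ [[_ [t [s [s1 ->]]] <-] n].
    have /andP[s0 s1'] := s1.
    pose u := t - (Num.floor t)%:~R.
    have gu : gam t = gam u by apply/gi; exists (Num.floor t); rewrite /u opprB addrC subrK.
    have Qu : Q (u, s).
      have /andP[u0 /ltW u1] := frac_part t.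
      by split; rewrite /= in_itv /= ?s0 ?(ltW s1') ?u0.
    exists (polar (u, s)); last by rewrite psiE// /Psi /= gu.
    by apply: contrapT => no; apply: n; exists (u, s) => //; rewrite /Psi /= gu.
  apply: openI => //; apply: closed_openC; apply: closed_image_compact => //.
  + exact: capped_hausdorff.
  + apply: open_closedC; apply: open_comp; last exact: open_open_square.
    by move=> ? _; exact: polar_cts.
Qed.

Lemma capped_boundaryless : boundaryless R X.
Proof.
split.
- exact: capped_hausdorff.
- have -> : [set: X] = pi @` setT.
    by apply/seteqP; split=> // y _; exists (uncap y) => //; exact: uncapK.
  apply: connected_continuous_connected; first exact: surface_connected.
  by apply: continuous_subspaceT; exact: capping_cts.
- move=> y; rewrite -(uncapK y); have [[i _ ix]|nD] := pselect (bdry S (uncap y)).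
    exact: cone_square ix.
  have [psi [psiE p0 pD]] := interior_square nD.
  by exists (pi \o psi); split; [exact: capping_square|rewrite /= p0].
Qed.

End CappedSurface.

(** * Circles on a surface without boundary *)

Section CircleInterior.
Variables (R : realType).
Local Notation P := (R * R)%type.

Lemma ivt_pair (f1 f2 : R -> R) (a : R) :
  {within `[0, 1], continuous f1} -> {within `[0, 1], continuous f2} ->
  f1 0 = a -> f2 0 = a -> a < f1 1 -> a < f2 1 ->
  exists s t, [/\ 0 < s <= 1, 0 < t <= 1 & f1 s = f2 t].
Proof.
move=> c1 c2 a1 a2 l1 l2.
wlog le : f1 f2 c1 c2 a1 a2 l1 l2 / f1 1 <= f2 1.
  move=> W; case: (leP (f1 1) (f2 1)) => [|/ltW] le; first exact: W.
  by have [s [t [s0 t0 E]]] := W _ _ c2 c1 a2 a1 l2 l1 le; exists t, s.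
have [|t] := @IVT R f2 0 1 (f1 1) ler01 c2.
  by rewrite ge_min le_max a2 (ltW l1) le orbT.
rewrite in_itv /= => /andP[t0 t1] E; exists 1, t; rewrite ltr01 lexx t1 E; split=> //.
rewrite andbT lt_def t0 andbT; apply/eqP => tz.
by move: E l1; rewrite tz a2 => <-; rewrite ltxx.
Qed.

(** Three segments issuing from the centre of a square cannot be mapped
    injectively and continuously into a line: two of them would start in the
    same direction and share values. *)
Lemma circle_no_interior (X : topologicalType) (c : set X) (psi : P -> X) :
  hausdorff_space X -> circle_in R c -> {within square R, continuous psi} ->
  set_inj (square R) psi -> ~ psi @` square R `<=` c.
Proof.
move=> hX [gam [cg gi cE]] cp ip sub.
have s1 : square R (1, 0).
  by rewrite /square /= pnorm_le /= normr1 normr0 lexx ler01.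
have [t0 _ t0E] : (range gam) (psi (1, 0)) by rewrite -cE; apply: sub; exists (1, 0).
have lift p : {t | open_square R p -> t0 < t < t0 + 1 /\ gam t = psi p}.
  apply: cid; have [po|no] := pselect (open_square R p); last by exists 0.
  have [t _ tE] : (range gam) (psi p).
    by rewrite -cE; apply: sub; exists p => //; exact: open_square_sub.
  have /andP[f0 f1] := frac_part (t - t0).
  exists (t - (Num.floor (t - t0))%:~R) => _.
  have E : gam (t - (Num.floor (t - t0))%:~R) = psi p.
    by rewrite -tE; apply/gi; exists (- Num.floor (t - t0)); rewrite intrN; lra.
  split=> //; apply/andP; split; last by lra.
  rewrite lt_def; apply/andP; split; last by lra.
  apply/eqP => tt; move: E; rewrite tt t0E => /ip; rewrite !inE => /(_ s1 (open_square_sub po)) E.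
  by move: po; rewrite -E /open_square /= pnorm_lt /= normr1 ltxx.
pose th p := sval (lift p).
have thE p : open_square R p -> t0 < th p < t0 + 1 /\ gam (th p) = psi p.
  by move=> po; exact: (svalP (lift p) po).
have thI p q : open_square R p -> open_square R q -> th p = th q -> p = q.
  move=> po qo E; have [_ e1] := thE _ po; have [_ e2] := thE _ qo.
  by apply: ip; rewrite ?inE; [exact: open_square_sub|exact: open_square_sub|rewrite -e1 -e2 E].
have gclosed a b : closed (gam @` `[a, b]).
  apply: compact_closed => //; apply: continuous_compact; last exact: segment_compact.
  exact: continuous_subspaceT.
have cpo : {within open_square R, continuous psi} by apply: continuous_subspaceW cp; exact: open_square_sub.
have rng t a b : t0 <= a -> b <= t0 + 1 -> t0 < t < t0 + 1 ->
    (gam @` `[a, b]) (gam t) -> a <= t <= b.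
  move=> ha hb /andP[h1 h2] [u /=]; rewrite in_itv /= => /andP[au ub] /gi[k kE].
  have k1 : k%:~R < 1%:~R :> R by rewrite -kE mulr1z; lra.
  have k2 : (-1)%:~R < k%:~R :> R by rewrite -kE mulrN1z; lra.
  have k0 : k = 0 by move: k1 k2; rewrite !ltr_int; lia.
  by move: kE; rewrite k0 mulr0z => ?; apply/andP; split; lra.
have cth : {within open_square R, continuous th}.
  apply: continuous_in_subspaceT => p; rewrite inE => po.
  have [h1 e1] := thE _ po; have /andP[h2 h3] := h1.
  apply/cvgrPdist_lt => e e0.
  pose a := Num.max t0 (th p - e); pose b := Num.min (t0 + 1) (th p + e).
  have [a0 [ap ae]] : t0 <= a /\ (a < th p /\ th p - e <= a).
    by rewrite /a !le_max gt_max !lexx h2 orbT /=; split=> //; split=> //; lra.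
  have [b0 [pb be]] : b <= t0 + 1 /\ (th p < b /\ b <= th p + e).
    by rewrite /b !ge_min lt_min !lexx h3 orbT /=; split=> //; split=> //; lra.
  have oV : open (open_square R `&` psi @^-1` (~` (gam @` `[t0, a]) `&` ~` (gam @` `[b, t0 + 1]))).
    apply: open_within_preimage => //; first exact: open_open_square.
    by apply: openI; apply: closed_openC; exact: gclosed.
  have : nbhs p (open_square R `&` psi @^-1` (~` (gam @` `[t0, a]) `&` ~` (gam @` `[b, t0 + 1]))).
    apply: open_nbhs_nbhs; split=> //; split=> //; split; rewrite /= -e1.
      move=> /(rng _ t0 a (lexx _)) H; have /andP[_] := H (ltac:(lra)) h1; lra.
    move=> /(rng _ b (t0 + 1)) H; have /andP[+ _] := H (ltac:(lra)) (lexx _) h1; lra.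
  apply: filterS => q [qo [/= n1 n2]].
  have [/andP[k2 k3] e2] := thE _ qo.
  have aq : a < th q.
    rewrite ltNge; apply/negP => qa; apply: n1; exists (th q) => //.
    by rewrite /= in_itv /= qa ltW.
  have qb : th q < b.
    rewrite ltNge; apply/negP => bq; apply: n2; exists (th q) => //.
    by rewrite /= in_itv /= bq ltW.
  by rewrite ltr_norml; apply/andP; split; lra.
have o0 : open_square R 0 by rewrite /open_square /= normr0.
pose ray (u : P) (s : R) := th (s * u.1, s * u.2).
have rayo (u : P) (s : R) : `|u| < 1 -> 0 <= s <= 1 -> open_square R (s * u.1, s * u.2).
  move=> u1 /andP[a b]; rewrite /open_square /=.
  rewrite -[(_, _)]/(s *: u) normrZ ger0_norm//.
  by have : 0 <= `|u| by []; nra.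
have rayc (u : P) : `|u| < 1 -> {within `[0, 1], continuous (ray u)}.
  move=> u1; apply: (@within_comp _ _ _ _ (open_square R) (fun s : R => (s * u.1, s * u.2)) th) => //.
    by apply: continuous_subspaceT; cts.
  by move=> s /=; rewrite in_itv /=; exact: rayo.
have ray0 u : ray u 0 = th 0 by rewrite /ray !mul0r.
have rayn (u : P) : `|u| < 1 -> u != 0 -> ray u 1 != th 0.
  move=> u1 u0; apply/eqP => /thI E; move: u0; rewrite -E ?eqxx//.
    by rewrite !mul1r; case: u {u1 E} => a b /=; rewrite eqxx.
  by apply: rayo => //; rewrite lexx ler01.
have two (u v : P) : `|u| < 1 -> `|v| < 1 ->
    (forall s t : R, 0 < s -> 0 < t -> (s * u.1, s * u.2) <> (t * v.1, t * v.2)) ->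
    (th 0 < ray u 1 -> th 0 < ray v 1 -> False) /\
    (ray u 1 < th 0 -> ray v 1 < th 0 -> False).
  move=> u1 v1 uv; split=> l1 l2.
    have [s [t [/andP[s0 s1'] /andP[t0' t1] E]]] := ivt_pair (rayc _ u1) (rayc _ v1) (ray0 u) (ray0 v) l1 l2.
    by apply: (uv s t) => //; apply: thI E; apply: rayo => //; rewrite ?(ltW s0) ?(ltW t0').
  have cN (w : P) : `|w| < 1 -> {within `[0, 1], continuous (fun s => - ray w s)}.
    by move=> w1 x; apply: cvgN; exact: (rayc w w1 x).
  have [||||s [t [/andP[s0 s1'] /andP[t0' t1] E]]] :=
      @ivt_pair (fun s => - ray u s) (fun s => - ray v s) (- th 0) (cN u u1) (cN v v1).
  - by rewrite ray0.
  - by rewrite ray0.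
  - by rewrite ltrN2.
  - by rewrite ltrN2.
  move/oppr_inj: E => E.
  by apply: (uv s t) => //; apply: thI E; apply: rayo => //; rewrite ?(ltW s0) ?(ltW t0').
pose u1 : P := (2^-1, 0); pose u2 : P := (- 2^-1, 0); pose u3 : P := (0, 2^-1).
have n1 : `|u1| < 1 by rewrite pnorm_lt /= !ltr_norml; apply/andP; split; apply/andP; split; lra.
have n2 : `|u2| < 1 by rewrite pnorm_lt /= !ltr_norml; apply/andP; split; apply/andP; split; lra.
have n3 : `|u3| < 1 by rewrite pnorm_lt /= !ltr_norml; apply/andP; split; apply/andP; split; lra.
have z1 : u1 != 0 by apply/eqP => -[/eqP]; rewrite invr_eq0 pnatr_eq0.
have z2 : u2 != 0 by apply/eqP => -[/eqP]; rewrite oppr_eq0 invr_eq0 pnatr_eq0.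
have z3 : u3 != 0 by apply/eqP => -[/eqP]; rewrite invr_eq0 pnatr_eq0.
have [|a12 b12] := two _ _ n1 n2; first by move=> s t s0 t0'; rewrite /u1 /u2 /= => -[]; lra.
have [|a13 b13] := two _ _ n1 n3; first by move=> s t s0 t0'; rewrite /u1 /u3 /= => -[]; lra.
have [|a23 b23] := two _ _ n2 n3; first by move=> s t s0 t0'; rewrite /u2 /u3 /= => -[]; lra.
have := rayn _ n1 z1; have := rayn _ n2 z2; have := rayn _ n3 z3.
rewrite !neq_lt => /orP[l3|l3] /orP[l2|l2] /orP[l1|l1]; by auto.
Qed.

End CircleInterior.

Section Enclosing.
Variables (R : realType) (X : topologicalType).
Hypothesis bX : boundaryless R X.
Local Notation P := (R * R)%type.
Let hX := bl_hausdorff bX.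

Definition separates (c A B : set X) : Prop :=
  [/\ circle_in R c, open A, open B, A `&` B = set0 & ~` c = A `|` B].

(** The circle is round in a small chart. The additional point inside it is the
    one that [enclose_pair] moves. *)
Lemma enclose_point (s : seq X) p : exists c A B,
  [/\ separates c A B, A p, forall q, q \in s -> q <> p -> B q &
      exists q, A q /\ q \notin s].
Proof.
pose s' := [seq q <- s | q != p].
have ps' : (~` [set x | x \in s']) p by rewrite /= mem_filter eqxx.
have [psi [psiE p0 ps]] := small_square bX (open_delseq bX s') ps'.
have [cp ip op] := psiE.
pose r2 (z : P) := z.1 ^+ 2 + z.2 ^+ 2.
have cr2 : continuous r2 by rewrite /r2; apply: ctsD; apply: ctsM; cts.
pose ci (t : R) : P := (2^-1 * cos ((pi *+ 2) * t), 2^-1 * sin ((pi *+ 2) * t)).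
have ca : continuous (fun t : R => (pi *+ 2) * t) by cts.
have cci : continuous ci.
  apply: ctspair; apply: ctsM; first [exact: ctsc|exact: (ctscomp ca (@continuous_cos R))|
    exact: (ctscomp ca (@continuous_sin R))].
have r2ci t : r2 (ci t) = 4^-1.
  rewrite /r2 /ci /=; transitivity (4^-1 * (cos (pi *+ 2 * t) ^+ 2 + sin (pi *+ 2 * t) ^+ 2)); first by field.
  by rewrite cos2Dsin2 mulr1.
have r2o z : r2 z <= 4^-1 -> open_square R z.
  rewrite /r2 /open_square /= pnorm_lt !ltr_norml => h.
  by apply/andP; split; apply/andP; split; nra.
have r2s z : r2 z <= 4^-1 -> square R z by move=> /r2o/open_square_sub.
have cE z : r2 z = 4^-1 -> exists t, ci t = z.
  move=> rz; have [|q Qq qz] := @polar_surj R (4 * z.1, 4 * z.2).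
    by move: rz; rewrite /r2 /=; lra.
  exists q.1; have := polar_sqr q; rewrite qz /= => H.
  have q1 : q.2 = 1.
    have q0 : 0 <= q.2 by case: Qq => _; rewrite /= in_itv /= => /andP[].
    by move: rz; rewrite /r2; nra.
  move: qz; rewrite /polar q1 mulr1 /ci => -[h1 h2].
  by case: z rz h1 h2 H => z1 z2 /= _ h1 h2 _; congr pair; lra.
exists (range (psi \o ci)), (psi @` [set z | r2 z < 4^-1]),
  (~` (psi @` (square R `&` [set z | r2 z <= 4^-1]))); split.
- split.
  + exists (psi \o ci); split=> //.
      apply/continuous_subspace_setT; apply: (@within_comp _ _ _ _ (square R)) => //.
        exact: continuous_subspaceT.
      by move=> t _; apply: r2s; rewrite r2ci.
    move=> t t'; split.
      move=> /ip; rewrite !inE => E; have := E (r2s _ _) (r2s _ _).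
      rewrite !r2ci lexx => /(_ isT isT) [].
      have h0 : (2^-1 : R) != 0 by rewrite invr_eq0 pnatr_eq0.
      move=> /(mulfI h0) ec /(mulfI h0) es.
      have c1 : cos ((pi *+ 2) * t - (pi *+ 2) * t') = 1.
        by rewrite cosB ec es -!expr2 cos2Dsin2.
      have [k kE] := cos1_2pi c1; exists k.
      have p2 : (pi *+ 2 : R) != 0 by rewrite gt_eqF// mulrn_wgt0// pi_gt0.
      by apply: (mulfI p2); rewrite -kE mulrBr.
    move=> [k kE]; congr psi; rewrite /ci; have -> : t = t' + k%:~R by rewrite -kE; lra.
    have [c1 s0] := cos_sin_2pi R k.
    by rewrite mulrDr cosD sinD c1 s0 !mulr1 !mulr0 subr0 addr0.
  + apply: square_embedding_open => //.
      by apply: (@open_comp _ _ r2 [set x | x < 4^-1]); [move=> z _; exact: cr2|exact: open_lt].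
    by move=> z /= /ltW/r2o.
  + apply: closed_openC; apply: square_embedding_closed => //.
    by apply: (@preimage_closed _ _ r2 [set x | x <= 4^-1]); [move=> z _; exact: cr2|exact: closed_le].
  + apply/seteqP; split=> // x [[z /= zr <-]]; apply; exists z => //.
    by split; [apply: r2s; exact: ltW|exact: ltW].
  + apply/seteqP; split=> x.
      move=> nc; have [[z [zs /= zr] zx]|n] := pselect ((psi @` (square R `&` [set z | r2 z <= 4^-1])) x); last by right.
      left; exists z => //=; rewrite lt_neqAle zr andbT; apply/eqP => /cE[t tz].
      by apply: nc; exists t => //=; rewrite tz.
    case=> [[z /= zr <-]|n] [t _ /= tx].
      move/ip: tx; rewrite !inE => /(_ (r2s _ _) (r2s _ _)).
      rewrite r2ci lexx (ltW zr) => /(_ isT isT) E.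
      by move: zr; rewrite -E r2ci ltxx.
    apply: n; exists (ci t) => //.
    by split; [apply: r2s|]; rewrite /= r2ci.
- by exists 0 => //=; rewrite /r2 /= !expr0n addr0 invr_gt0.
- move=> q qs qp [z [zs _] zq]; have := ps _ zs; apply.
  by rewrite /= zq mem_filter qs andbT; apply/eqP.
- have z0 : r2 (4^-1, 0) < 4^-1 by rewrite /r2 /=; lra.
  have zs : square R (4^-1, 0) by apply: r2s; exact: ltW.
  exists (psi (4^-1, 0)); split; first by exists (4^-1, 0).
  apply/negP => H; apply: (ps _ zs); rewrite /= mem_filter H andbT; apply/eqP.
  rewrite -p0 => /ip; rewrite !inE /square /= normr0 => /(_ zs ler01) [] /eqP.
  by rewrite invr_eq0 pnatr_eq0.
Qed.

Lemma homeo_separates (f : X -> X) (c A B : set X) : homeo f -> separates c A B ->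
  separates (f @` c) (f @` A) (f @` B).
Proof.
move=> hf [hc oA oB AB cAB]; split.
- exact: homeo_circle.
- exact: homeo_open.
- exact: homeo_open.
- apply/seteqP; split=> // _ [[x Ax <-] [y By /(homeo_inj hf) yx]].
  by suff : set0 x by []; rewrite -AB; split=> //; rewrite -yx.
- by rewrite -homeo_setC// cAB image_setU.
Qed.

(** A point inside a small circle around [p] is moved to [p2], dragging the
    circle along. *)
Lemma enclose_pair (s : seq X) p p2 : p \in s -> p2 \in s -> p <> p2 ->
  exists c A B, [/\ separates c A B, A p, A p2 &
    forall q, q \in s -> q <> p -> q <> p2 -> B q].
Proof.
move=> ps p2s pp2; have [c [A [B [cAB Ap sB [q [Aq qs]]]]]] := enclose_point s p.
pose s' := [seq x <- s | x != p2].
have [||f [hf fq fs]] := @homogeneous_seq _ _ bX s' q p2.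
- by rewrite mem_filter negb_and qs orbT.
- by rewrite mem_filter eqxx.
exists (f @` c), (f @` A), (f @` B); split.
- exact: homeo_separates.
- by exists p => //; apply: fs; rewrite mem_filter ps andbT; apply/eqP.
- by exists q.
- move=> x xs xp xp2; exists x; first exact: sB.
  by apply: fs; rewrite mem_filter xs andbT; apply/eqP.
Qed.

Definition nonseparating (c : set X) : Prop :=
  ~ exists O1 O2, [/\ open O1, open O2, O1 !=set0, O2 !=set0 &
    O1 `&` O2 = set0 /\ ~` c = O1 `|` O2].

Lemma homeo_nonseparating (f : X -> X) (c : set X) : homeo f -> nonseparating c ->
  nonseparating (f @` c).
Proof.
move=> hf nc [ O1 [ O2 [ o1 o2 [x x1] [y y2] [dj cov]]]]; apply: nc.
have cf := homeo_cts hf.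
have sf z : exists w, f w = z by case: hf => g [_ _ _ gK]; exists (g z).
exists (f @^-1` O1), (f @^-1` O2); split.
- by apply: open_comp => // z _; exact: cf.
- by apply: open_comp => // z _; exact: cf.
- by have [w wx] := sf x; exists w; rewrite /preimage /= wx.
- by have [w wx] := sf y; exists w; rewrite /preimage /= wx.
- split; first by rewrite -preimage_setI dj preimage_set0.
  rewrite -preimage_setU -cov; apply/seteqP; split=> z; rewrite /preimage /=.
    by move=> zc [w wc /(homeo_inj hf) E]; apply: zc; rewrite -E.
  by move=> zc wc; apply: zc; exists z.
Qed.

(** A circle has empty interior, so a point on it has neighbours off it; a
    homeomorphism fixing the other points of the list moves such a neighbour to
    the given point. *)
Lemma avoid_seq (c : set X) (s t : seq X) : circle_in R c -> nonseparating c ->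
  (forall x, x \in s -> ~ c x) ->
  exists c', [/\ circle_in R c', nonseparating c' & forall x, x \in t ++ s -> ~ c' x].
Proof.
move=> hc nc cs; elim: t => [|q t [c' [hc' nc' c's]]]; first by exists c.
have [qs|qs] := boolP (q \in t ++ s).
  exists c'; split=> // x; rewrite /= inE => /orP[/eqP->|]; exact: c's.
have [cq|ncq] := pselect (c' q); last first.
  by exists c'; split=> // x; rewrite /= inE => /orP[/eqP->|] //; exact: c's.
have qs' : (~` [set x | x \in t ++ s]) q by move=> /= H; rewrite H in qs.
have [psi [[cp ip op] p0 ps]] := small_square bX (open_delseq bX (t ++ s)) qs'.
have := circle_no_interior hX hc' cp ip.
move=> /existsNP[_ /not_implyP[[z zs <-] nz]].
have [|f [hf fz fs]] := @homogeneous_seq _ _ bX (t ++ s) (psi z) q _ qs.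
  by apply/negP; exact: ps.
exists (f @` c'); split; [exact: homeo_circle|exact: homeo_nonseparating|].
move=> x; rewrite /= inE => /orP[/eqP->|xs] [w wc].
  by rewrite -fz => /(homeo_inj hf) E; apply: nz; rewrite -E.
rewrite -(fs _ xs) => /(homeo_inj hf) E; apply: (c's _ xs); by rewrite -E.
Qed.

End Enclosing.

(** * Continua on a bordered surface *)

Section Cells.
Variables (R : realType) (g h : nat) (S : bordered_surface R g h).
Local Notation P := (R * R)%type.

Lemma small_half_square x (U : set S) : bdry S x -> open U -> U x ->
  exists psi : P -> S, [/\ half_square_embedding (bdry S) psi, psi 0 = x & forall p, half_square R p -> U (psi p)].
Proof.
move=> Dx oU Ux; have [psi [psiE p0]] := boundary_square Dx.
have [cp ip op dp] := psiE.
have h0 : half_square R 0 by split; rewrite /= ?normr0.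
have : open (psi @^-1` U : set (subspace (half_square R))) by move/continuousP : cp; apply.
move=> /open_subspaceP[W oW WE].
have : nbhs (0 : P) W.
  apply: open_nbhs_nbhs; split=> //.
  have : (psi @^-1` U `&` half_square R) 0 by split=> //; rewrite /preimage /= p0.
  by rewrite -WE => -[].
move=> /nbhs_ballP[d /= d0 dW].
pose e : R := Num.min (d / 2) 2^-1.
have [e0 [ed e2]] : 0 < e /\ (e <= d / 2 /\ e <= 2^-1).
  rewrite /e lt_min !ge_min !lexx orbT /=; split=> //.
  by apply/andP; split; lra.
have eh p : half_square R p -> open_half_square R (e *: p).
  move=> [p1 p2]; split; last by rewrite /= mulr_ge0 ?(ltW e0).
  by rewrite /= normrZ gtr0_norm//; have : 0 <= `|p| by []; nra.
have eW p : half_square R p -> W (e *: p).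
  move=> [p1 p2]; apply: dW; rewrite -ball_normE /= sub0r normrN normrZ gtr0_norm//.
  by have : 0 <= `|p| by []; nra.
exists (fun p => psi (e *: p)); split; last first.
- move=> p ph; have : (W `&` half_square R) (e *: p) by split; [exact: eW|exact/open_half_square_sub/eh].
  by rewrite WE => -[].
- by rewrite scaler0.
have ce : continuous (fun p : P => e *: p).
  by have : continuous (fun p : P => (e * p.1, e * p.2)) by cts.
have e1 : e != 0 by rewrite gt_eqF.
split.
- apply: (@within_comp _ _ _ _ (half_square R) (fun p : P => e *: p) psi) => //.
    exact: continuous_subspaceT.
  by move=> p ph; exact/open_half_square_sub/eh.
- move=> p q; rewrite !inE => ph qh /ip; rewrite !inE => E.
  have {}E := E (open_half_square_sub (eh _ ph)) (open_half_square_sub (eh _ qh)).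
  have := congr1 (fun x => e^-1 *: x) E.
  by rewrite /= !scalerA mulVf// !scale1r.
- have -> : (fun p => psi (e *: p)) @` open_half_square R = psi @` ([set p | `|p| < e] `&` open_half_square R).
    apply/seteqP; split=> [_ [p [p1 p2] <-]|_ [p [pe [p1 p2]] <-]].
      exists (e *: p) => //; split; last by apply: eh; split=> //; exact: ltW.
      by rewrite /= normrZ gtr0_norm// gtr_pMr.
    exists (e^-1 *: p); last by rewrite scalerA divff// scale1r.
    split; last by rewrite /= mulr_ge0// invr_ge0 ltW.
    by rewrite /= normrZ gtr0_norm ?invr_gt0// mulrC ltr_pdivrMr// mul1r.
  apply: (@half_square_embedding_open R S (@surface_hausdorff R g h S) (bdry S)) => //.
    have H : open ((fun p : P => `|p|) @^-1` [set x | x < e]).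
      by apply: open_comp; [move=> p _; apply: ctspnorm; cts|exact: open_lt].
    exact: H.
  by move=> p [/= pe [p1 p2]]; split=> //; apply: lt_le_trans pe _; lra.
- move=> p ph; rewrite dp; last exact/open_half_square_sub/eh.
  have -> : (e *: p).2 = e * p.2 by [].
  by split=> [/eqP|->]; [rewrite mulf_eq0 (negbTE e1) /= => /eqP|rewrite mulr0].
Qed.

Lemma small_interior_square x (U : set S) : ~ bdry S x -> open U -> U x ->
  exists psi : P -> S, [/\ square_embedding psi, psi 0 = x &
    forall p, square R p -> U (psi p) /\ ~ bdry S (psi p)].
Proof.
move=> Dx oU Ux; have [psi [psiE p0 pD]] := interior_square Dx.
have o0 : open_square R 0 by rewrite /open_square /= normr0.
have [|e [e0 eU eE]] := square_embedding_at (@surface_hausdorff _ _ _ S) psiE o0 oU; first by rewrite p0.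
exists (fun p => psi (0 + e *: p)); split=> //; first by rewrite scaler0 addr0.
by move=> p ps; have [a b] := eU _ ps; split=> //; apply: pD; exact: open_square_sub.
Qed.

Lemma connected_open_half_square : connected (open_half_square R).
Proof.
apply: (@star_connected _ _ 0); first by split; rewrite /= ?normr0.
move=> q t [qo q2] /andP[t0 t1]; rewrite subr0 add0r; split=> /=; last exact: mulr_ge0.
by rewrite normrZ ger0_norm//; apply: le_lt_trans qo; exact: ler_piMl.
Qed.

Lemma connected_upper_square : connected [set p : P | `|p| < 1 /\ 0 < p.2].
Proof.
apply: (@star_connected _ _ (0, 2^-1)).
  by rewrite /= pnorm_lt /= !ltr_norml; split; [apply/andP; split; apply/andP; split|]; lra.
move=> q t; rewrite /= !pnorm_lt /= !ltr_norml.
move=> [/andP[/andP[a b] /andP[c d]] e] /andP[t0 t1].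
by split; [apply/andP; split; apply/andP; split|];
  first [apply: conv_lt|apply: conv_gt]; rewrite ?t0 ?t1//; lra.
Qed.

Lemma connected_punctured_half_square : connected (open_half_square R `\` [set 0]).
Proof.
pose A1 : set P := [set p | `|p| < 1 /\ 0 <= p.2 /\ 0 < p.1].
pose A2 : set P := [set p | `|p| < 1 /\ 0 < p.2].
pose A3 : set P := [set p | `|p| < 1 /\ 0 <= p.2 /\ p.1 < 0].
have c1 : connected A1.
  apply: (@star_connected _ _ (2^-1, 0)).
    by rewrite /A1 /= pnorm_lt /= !ltr_norml; split; [apply/andP; split; apply/andP; split|split]; lra.
  move=> q t; rewrite /A1 /= !pnorm_lt /= !ltr_norml.
  move=> [/andP[/andP[a b] /andP[c d]] [e f]] /andP[t0 t1].
  by split; [apply/andP; split; apply/andP; split|split];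
    first [apply: conv_lt|apply: conv_gt|apply: conv_ge]; rewrite ?t0 ?t1//; lra.
have c3 : connected A3.
  apply: (@star_connected _ _ (- 2^-1, 0)).
    by rewrite /A3 /= pnorm_lt /= !ltr_norml; split; [apply/andP; split; apply/andP; split|split]; lra.
  move=> q t; rewrite /A3 /= !pnorm_lt /= !ltr_norml.
  move=> [/andP[/andP[a b] /andP[c d]] [e f]] /andP[t0 t1].
  by split; [apply/andP; split; apply/andP; split|split];
    first [apply: conv_lt|apply: conv_gt|apply: conv_ge]; rewrite ?t0 ?t1//; lra.
have -> : open_half_square R `\` [set 0] = (A1 `|` A2) `|` A3.
  apply/seteqP; split=> p; rewrite /open_half_square /=.
    move=> [[p1 p2] p0]; have [a|a|a] := ltgtP p.1 0; first by right.
      by left; left.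
    have [b|b] := ltP 0 p.2; first by left; right.
    exfalso; apply: p0; case: p a b p2 {p1} => x y /= -> b c.
    by congr pair; apply/eqP; rewrite eq_le b.
  case=> [[[p1 [p2 H]]|[p1 H]]|[p1 [p2 H]]]; split=> //; try (by split=> //; exact: ltW);
    by move=> p0; move: H; rewrite p0 /= ltxx.
apply: connectedU => //.
  exists (- 2^-1, 2^-1); split; [right|]; rewrite /A2 /A3 /= pnorm_lt /= !ltr_norml;
    by do ?split; (try (apply/andP; split; apply/andP; split)); lra.
apply: connectedU => //; last exact: connected_upper_square.
exists (2^-1, 2^-1); split; rewrite /A1 /A2 /= pnorm_lt /= !ltr_norml;
    by do ?split; (try (apply/andP; split; apply/andP; split)); lra.
Qed.

Lemma segment_image (K : set P) (psi : P -> S) (q : P) :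
  {within K, continuous psi} -> (forall t, 0 <= t <= 1 -> K (t *: q)) ->
  exists L, [/\ closed L, connected L, L `<=` psi @` K, L (psi 0) & L (psi q)].
Proof.
move=> cp Kq; pose f (t : R) := psi (t *: q).
have cs : continuous (fun t : R => t *: q).
  have H : continuous (fun t : R => (t * q.1, t * q.2)) by cts.
  exact: H.
have cf : {within `[0, 1], continuous f}.
  apply: (@within_comp _ _ _ _ K (fun t : R => t *: q) psi) => //.
    exact: continuous_subspaceT.
exists (f @` `[0, 1]%classic); split.
- by apply: surface_closed; apply: continuous_compact => //; exact: segment_compact.
- by apply: connected_continuous_connected => //; exact: segment_connected.
- by move=> _ [t t01 <-]; exists (t *: q) => //; apply: Kq; move: t01; rewrite /= in_itv.
- by exists 0; rewrite /f ?scale0r//= in_itv /= lexx ler01.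
- by exists 1; rewrite /f ?scale1r//= in_itv /= lexx ler01.
Qed.

(** Neighbourhoods that stay connected without their centre, or without the
    boundary. *)
Lemma cell x (U : set S) : open U -> U x -> exists N,
  [/\ open N, N x, N `<=` U,
      [/\ connected N, connected (N `\` [set x]), N `\` [set x] !=set0,
          connected (N `\` bdry S) & N `\` bdry S !=set0] &
      forall y, N y -> exists K, [/\ closed K, connected K, K `<=` U, K x & K y]].
Proof.
move=> oU Ux; have [Dx|nDx] := pselect (bdry S x).
  have [psi [[cp ip op dp] p0 pU]] := small_half_square Dx oU Ux.
  have h0 : half_square R 0 by split; rewrite /= ?normr0.
  have cpo : {within open_half_square R, continuous psi} by apply: continuous_subspaceW cp; exact: open_half_square_sub.
  have zh : open_half_square R (0, 2^-1).
    by split; rewrite ?pnorm_lt /= ?ltr_norml; first (apply/andP; split; apply/andP; split); lra.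
  have E1 : psi @` open_half_square R `\` [set x] = psi @` (open_half_square R `\` [set 0]).
    rewrite -p0; apply/seteqP; split=> [_ [[p po <-] np]|_ [p [po pn] <-]].
      by exists p => //; split=> // E; apply: np; rewrite E.
    split; first by exists p.
    by move=> /ip; rewrite !inE => /(_ (open_half_square_sub po) h0).
  have E2 : psi @` open_half_square R `\` bdry S = psi @` [set p : P | `|p| < 1 /\ 0 < p.2].
    apply/seteqP; split=> [_ [[p po <-] np]|_ [p [p1 p2] <-]].
      exists p => //; have [p1 p2] := po; split=> //.
      rewrite lt_neqAle p2 andbT eq_sym; apply/eqP => E; apply: np.
      by apply/dp => //; exact: open_half_square_sub.
    have po : open_half_square R p by split=> //; exact: ltW.
    split; first by exists p.
    by move=> /dp -/(_ (open_half_square_sub po)) E; move: p2; rewrite E ltxx.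
  exists (psi @` open_half_square R); split=> //.
  - by exists 0 => //; split; rewrite /= ?normr0.
  - by move=> _ [p /open_half_square_sub/pU ? <-].
  - split.
    + by apply: connected_continuous_connected => //; exact: connected_open_half_square.
    + rewrite E1; apply: connected_continuous_connected; first exact: connected_punctured_half_square.
      by apply: continuous_subspaceW cpo => p [].
    + rewrite E1; exists (psi (0, 2^-1)); exists (0, 2^-1) => //; split=> //.
      by move=> /(congr1 snd) /= /eqP; rewrite invr_eq0 pnatr_eq0.
    + rewrite E2; apply: connected_continuous_connected; first exact: connected_upper_square.
      by apply: continuous_subspaceW cpo => p [p1 /ltW].
    + rewrite E2; exists (psi (0, 2^-1)); exists (0, 2^-1) => //.
      by case: zh => ? _; split=> //=; lra.
  - move=> _ [q qo <-]; have [|K [cK kK Ks Kx Ky]] := @segment_image (half_square R) psi q cp.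
      move=> t /andP[t0 t1]; have [q1 q2] := open_half_square_sub qo; split; last by rewrite /= mulr_ge0.
      by rewrite /= normrZ ger0_norm//; apply: le_trans q1; exact: ler_piMl.
    by exists K; split=> //; [move=> z /Ks[p /pU ? <-]|rewrite -p0].
have [psi [psiE p0 pU]] := small_interior_square nDx oU Ux.
have [cp ip op] := psiE.
have s0 : square R 0 by rewrite /square /= normr0.
have cpo : {within open_square R, continuous psi} by apply: continuous_subspaceW cp; exact: open_square_sub.
have zh : open_square R (0, 2^-1).
  by rewrite /open_square /= pnorm_lt /= ?ltr_norml; apply/andP; split; apply/andP; split; lra.
have E1 : psi @` open_square R `\` [set x] = psi @` (open_square R `\` [set 0]).
  rewrite -p0; apply/seteqP; split=> [_ [[p po <-] np]|_ [p [po pn] <-]].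
    by exists p => //; split=> // E; apply: np; rewrite E.
  split; first by exists p.
  by move=> /ip; rewrite !inE => /(_ (open_square_sub po) s0).
have E2 : psi @` open_square R `\` bdry S = psi @` open_square R.
  apply/seteqP; split=> [y []//|_ [p po <-]]; split; first by exists p.
  by case: (pU _ (open_square_sub po)).
have cN : connected (psi @` open_square R).
  by apply: connected_continuous_connected => //; exact: connected_open_square.
exists (psi @` open_square R); split=> //.
- by exists 0 => //; rewrite /open_square /= normr0.
- by move=> _ [p /open_square_sub/pU[? _] <-].
- split=> //.
  + rewrite E1; apply: connected_continuous_connected; first exact: connected_punctured_square.
    by apply: continuous_subspaceW cpo => p [].
  + rewrite E1; exists (psi (0, 2^-1)); exists (0, 2^-1) => //; split=> //.
    by move=> /(congr1 snd) /= /eqP; rewrite invr_eq0 pnatr_eq0.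
  + by rewrite E2.
  + by rewrite E2; exists (psi (0, 2^-1)); exists (0, 2^-1).
- move=> _ [q qo <-]; have [|K [cK kK Ks Kx Ky]] := @segment_image (square R) psi q cp.
    move=> t /andP[t0 t1]; have q1 := open_square_sub qo; rewrite /square /=.
    by rewrite normrZ ger0_norm//; apply: le_trans q1; exact: ler_piMl.
  by exists K; split=> //; [move=> z /Ks[p /pU[? _] <-]|rewrite -p0].
Qed.

Lemma surface_point_closed (x : S) : closed [set x].
Proof.
by apply: accessible_closed_set1; apply: hausdorff_accessible; exact: surface_hausdorff.
Qed.

Lemma circ_closed i : closed (circ S i).
Proof. by apply: surface_closed; exact: circ_compact. Qed.

Lemma connected_del_point x : connected (~` [set x] : set S).
Proof.
have -> : ~` [set x] = [set: S] `\` [set x] by rewrite setTD.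
apply: connected_setD; [exact: openT|exact: surface_connected| |].
- move=> N oN _ [y Ny]; have [yx|yx] := pselect (y = x); last by exists y.
  have [M [oM My MN [_ _ [z [Mz zx]] _ _] _]] := cell oN Ny.
  by exists z; split; [exact: MN|rewrite -yx].
- move=> z _; have [->|zx] := pselect (z = x).
    have [M [oM Mz _ [_ cM _ _ _] _]] := cell (@openT S) (I : [set: S] x).
    by exists M.
  have oC : open (~` [set x] : set S) by apply: closed_openC; exact: surface_point_closed.
  have [M [oM Mz MN [cM _ _ _ _] _]] := cell oC zx.
  exists M; split=> //; have -> // : M `\` [set x] = M.
  by apply/seteqP; split=> [t []//|t Mt]; split=> //; exact: MN.
Qed.

Lemma connected_del_circ j : connected (~` circ S j).
Proof.
have -> : ~` circ S j = [set: S] `\` circ S j by rewrite setTD.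
apply: connected_setD; [exact: openT|exact: surface_connected| |].
- move=> N oN _ [y Ny].
  have [M [oM My MN [_ _ _ _ [z [Mz zx]]] _]] := cell oN Ny.
  by exists z; split; [exact: MN|move=> jz; apply: zx; exists j].
- move=> z _; have [jz|zx] := pselect (circ S j z); last first.
    have oC : open (~` circ S j) by apply: closed_openC; exact: circ_closed.
    have [M [oM Mz MN [cM _ _ _ _] _]] := cell oC zx.
    exists M; split=> //; have -> // : M `\` circ S j = M.
    by apply/seteqP; split=> [t []//|t Mt]; split=> //; exact: MN.
  have oC : open (~` \bigcup_(i in [set i | i != j]) circ S i).
    by apply: closed_openC; apply: surface_closed; exact: bigcup_circ_compact.
  have Cz : (~` \bigcup_(i in [set i | i != j]) circ S i) z.
    by move=> [i /= /eqP ij iz]; apply: ij; exact: circ_uniq iz jz.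
  have [M [oM Mz MN [_ _ _ cM _] _]] := cell oC Cz.
  exists M; split=> //; have -> // : M `\` circ S j = M `\` bdry S.
  apply/seteqP; split=> t [Mt nt]; split=> //.
    move=> [i _ it]; have [ij|ij] := eqVneq i j; first by apply: nt; rewrite -ij.
    by apply: (MN _ Mt); exists i.
  by move=> jt; apply: nt; exists j.
Qed.

Lemma continuum_through (Z : set S) (s : seq S) : closed Z -> connected (~` Z) ->
  (forall x, x \in s -> ~ Z x) ->
  exists K, [/\ closed K, connected K, K `<=` ~` Z & forall x, x \in s -> K x].
Proof.
move=> cZ kZ; have oZ : open (~` Z) by exact: closed_openC.
apply: connected_chain => // x Zx.
by have [N [oN Nx _ _ H]] := cell oZ Zx; exists N; split=> // y Ny _; exact: H.
Qed.

End Cells.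

(** * Two-loops on a marked surface *)

Section Features.
Variables (R : realType) (g h n : nat) (m : h.-tuple nat) (S : marked_surface R g n m).
Local Notation X := (capped S).
Local Notation pi := (@capping R g h S).
Local Notation F := ('I_n + 'I_h)%type.

Lemma punct_inj : injective (punct S). Proof. by case: S. Qed.
Lemma punct_interior k : ~ bdry S (punct S k). Proof. by case: S k. Qed.
Lemma bmark_circ i k : circ S i (bmark S i k). Proof. by case: S i k. Qed.

(** Punctures and boundary circles are treated alike, since both become
    points of the capped surface. *)
Definition feature (a : F) : set S :=
  match a with inl k => [set punct S k] | inr i => circ S i end.

Lemma feature_nonempty a : exists x, feature a x.
Proof. by case: a => [k|i]; [exists (punct S k)|exact: circ_nonempty]. Qed.

Lemma feature_uniq a b x : feature a x -> feature b x -> a = b.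
Proof.
case: a b => [k|i] [l|j] /=.
- by move=> -> /punct_inj ->.
- by move=> -> jx; exfalso; apply: (@punct_interior k); exists j.
- by move=> ix xl; exfalso; apply: (@punct_interior l); exists i => //; rewrite -xl.
- by move=> ix jx; rewrite (circ_uniq ix jx).
Qed.

Definition feature_point (a : F) : X := pi (projT1 (cid (feature_nonempty a))).

Lemma feature_pointP a x : feature a x <-> pi x = feature_point a.
Proof.
rewrite /feature_point; case: (cid _) => y /= ya; split.
  case: a ya => [k|i] /= ya xa; first by rewrite xa ya.
  by apply/cappingP; right; exists i.
case: a ya => [k|i] /= ya /cappingP.
  by case=> [->//|[i [_ iy]]]; exfalso; apply: (@punct_interior k); exists i => //; rewrite -ya.
by case=> [->//|[j [jx jy]]]; rewrite (circ_uniq ya jy).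
Qed.

Lemma feature_point_inj : injective feature_point.
Proof.
move=> a b E; have [x xa] := feature_nonempty a.
by apply: (@feature_uniq _ _ x) => //; apply/feature_pointP; rewrite -E; apply/feature_pointP.
Qed.

Definition feature_points : seq X := [seq feature_point a | a <- enum {: F}].

Lemma mem_feature_points a : feature_point a \in feature_points.
Proof. by apply: map_f; rewrite mem_enum. Qed.

Lemma marked_homeo_feature f a : marked_homeo f -> f @` feature a = feature a.
Proof.
move=> [hf fp fb fc]; case: a => [k|i] /=; last exact: fc.
by rewrite image_set1 fp.
Qed.

Lemma isotopic_image (c c' : set S) : isotopic c c' -> exists f, marked_homeo f /\ c' = f @` c.
Proof.
move=> [H [_ Hm _ ->]]; exists (H 1); split=> //; apply: Hm.
by rewrite /= in_itv /= ler01 lexx.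
Qed.

(** Take a continuum off [Z] through a point of each feature. A deformation of
    [c] that avoids it leaves it on one side; but marked homeomorphisms preserve
    each feature, so the two features stay on different sides. *)
Lemma sided_not_near (c A B Z : set S) a b :
  open A -> open B -> A `&` B = set0 -> ~` c = A `|` B ->
  closed Z -> connected (~` Z) ->
  feature a `<=` A -> feature b `<=` B ->
  ~ feature a `<=` Z -> ~ feature b `<=` Z -> ~ deforms_near c Z.
Proof.
move=> oA oB AB cAB cZ kZ aA bB /existsNP [x /not_implyP [xa xZ]].
move=> /existsNP [y /not_implyP [yb yZ]] near.
have [|K [cK kK KZ Kxy]] := @continuum_through _ _ _ _ Z [:: x; y] cZ kZ.
  by move=> z; rewrite !inE => /orP[]/eqP->.
have [||c' /isotopic_image[f [fm ->]] fcK] := near (~` K).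
- exact: closed_openC.
- by move=> z Zz /KZ.
have [hf _ _ _] := fm.
have fa : (f @` A) x.
  have := marked_homeo_feature a fm => E; have : (f @` feature a) x by rewrite E.
  by move=> [t ta <-]; exists t => //; exact: aA.
have fb : (f @` B) y.
  have := marked_homeo_feature b fm => E; have : (f @` feature b) y by rewrite E.
  by move=> [t tb <-]; exists t => //; exact: bB.
have dis z : (f @` A) z -> (f @` B) z -> False.
  move=> [u Au <-] [v Bv /(homeo_inj hf) E].
  by suff : set0 u by []; rewrite -AB; split=> //; rewrite -E.
move/connectedE2 : kK => /(_ (f @` A) (f @` B) (homeo_open hf oA) (homeo_open hf oB)).
case.
- by apply/seteqP; split=> // z [[_ za] zb]; exact: (dis z).
- move=> z Kz; rewrite -image_setU -cAB homeo_setC// => /fcK; exact.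
- by move=> KA; apply: (dis y) => //; apply: KA; apply: Kxy; rewrite !inE eqxx orbT.
- by move=> KB; apply: (dis x) => //; apply: KB; apply: Kxy; rewrite !inE eqxx.
Qed.

(** What a side of a loop must contain so that the loop cannot be shrunk, on
    that side, to a point or to a boundary circle without marked points. *)
Definition rich (A : set S) : Prop :=
  (exists a b, [/\ a <> b, feature a `<=` A & feature b `<=` A]) \/
  (exists2 i : 'I_h, (0 < tnth m i)%N & circ S i `<=` A).

Lemma rich_point A x : rich A -> exists2 a, feature a `<=` A & ~ feature a `<=` [set x].
Proof.
move=> [[a [b [ab aA bA]]]|[i mi iA]].
  have [ax|] := pselect (feature a `<=` [set x]); last by exists a.
  exists b => // bx; apply: ab.
  have [y ya] := feature_nonempty a; have [z zb] := feature_nonempty b.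
  by apply: (@feature_uniq _ _ x); [rewrite -(ax _ ya)|rewrite -(bx _ zb)].
exists (inr i) => // ix; have [gam [_ gi gE]] := circ_circle S i.
have H t : gam t = x by apply: ix; rewrite /= gE; exists t.
have : gam 0 = gam 2^-1 by rewrite !H.
move/gi => [k]; rewrite sub0r => E.
have k0 : k%:~R < 0 :> R by rewrite -E; lra.
have k1 : (-1)%:~R < k%:~R :> R by rewrite -E mulrN1z; lra.
by move: k0 k1; rewrite ltrz0 ltr_int; lia.
Qed.

Lemma rich_circ A j : rich A -> tnth m j = 0%N ->
  exists2 a, feature a `<=` A & ~ feature a `<=` circ S j.
Proof.
have sub a : feature a `<=` circ S j -> a = inr j.
  move=> aj; have [y ya] := feature_nonempty a.
  by apply: (@feature_uniq _ _ y) => //; exact: aj.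
move=> [[a [b [ab aA bA]]]|[i mi iA]] mj.
  have [/sub ax|] := pselect (feature a `<=` circ S j); last by exists a.
  by exists b => // /sub bx; apply: ab; rewrite ax bx.
by exists (inr i) => // /sub [ij]; move: mi; rewrite ij mj.
Qed.

Lemma sided_two_loop (c A B : set S) : circle_in R c -> c `&` bdry S = set0 ->
  c `&` @marks R g h n m S = set0 -> open A -> open B -> A `&` B = set0 -> ~` c = A `|` B ->
  rich A -> rich B -> two_loop c.
Proof.
move=> hc cD cM oA oB AB cAB rA rB; split.
  split=> // x.
  have [a aA ax] := rich_point x rA; have [b bB bx] := rich_point x rB.
  apply: (sided_not_near oA oB AB cAB _ _ aA bB ax bx).
    exact: surface_point_closed.
  exact: connected_del_point.
move=> [_ [j mj]].
have [a aA ax] := rich_circ rA mj; have [b bB bx] := rich_circ rB mj.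
apply: (sided_not_near oA oB AB cAB _ _ aA bB ax bx).
  exact: circ_closed.
exact: connected_del_circ.
Qed.

(** Away from the collapsed circles the capping map is a homeomorphism. *)
Lemma uncap_circle (c : set X) : circle_in R c -> (forall a, ~ c (feature_point a)) ->
  [/\ circle_in R (pi @^-1` c), pi @^-1` c `&` bdry S = set0 &
      pi @^-1` c `&` @marks R g h n m S = set0].
Proof.
move=> [gam [cg gi cE]] cf.
have cD x : c (pi x) -> ~ bdry S x.
  by move=> cx [i _ ix]; apply: (cf (inr i)); have /feature_pointP <- : feature (inr i) x by [].
have cpt t : c (gam t) by rewrite cE; exists t.
have Dt t : ~ bdry S (uncap (gam t)) by apply: cD; rewrite uncapK.
split.
- exists (fun t => uncap (gam t)); split.
  + apply/continuousP => V oV.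
    have oVD : open (V `&` ~` bdry S).
      by apply: openI => //; apply: closed_openC; apply: surface_closed; exact: bdry_compact.
    have -> : (fun t => uncap (gam t)) @^-1` V = gam @^-1` (pi @` (V `&` ~` bdry S)).
      apply/seteqP; split=> t; rewrite /preimage /=.
        by move=> Vt; exists (uncap (gam t)); [split|rewrite uncapK].
      move=> [x [Vx xD] xt]; suff -> : uncap (gam t) = x by [].
      by symmetry; apply: capping_inj => //; rewrite uncapK.
    apply: open_comp; first by move=> t _; exact: cg.
    apply: capping_interior_open => //.
    by apply/seteqP; split=> // x [[_ ?] ?].
  + move=> s t; rewrite -gi; split=> [E|->//].
    by rewrite -(uncapK (gam s)) -(uncapK (gam t)) E.
  + rewrite cE; apply/seteqP; split=> x.
      move=> [t _ xt]; exists t => //; symmetry; apply: capping_inj.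
        by apply: cD; rewrite -xt.
      by rewrite uncapK.
    by move=> [t _ <-]; exists t => //; rewrite uncapK.
- by apply/seteqP; split=> // x [/cD].
- apply/seteqP; split=> // x [cx [[k xk]|[i [k xk]]]].
    by apply: (cf (inl k)); have /feature_pointP <- : feature (inl k) x by [].
  by apply: (cD _ cx); exists i => //; rewrite xk; exact: bmark_circ.
Qed.

Lemma uncap_two_loop (c A B : set X) : separates R c A B ->
  (forall a, A (feature_point a) \/ B (feature_point a)) ->
  rich (pi @^-1` A) -> rich (pi @^-1` B) -> exists c : set S, two_loop c.
Proof.
move=> [hc oA oB AB cAB] fAB rA rB.
have cf a : ~ c (feature_point a).
  suff : (~` c) (feature_point a) by [].
  by rewrite cAB; exact: fAB.
have [h1 h2 h3] := uncap_circle hc cf.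
exists (pi @^-1` c); apply: (@sided_two_loop _ (pi @^-1` A) (pi @^-1` B)) => //.
- by rewrite -preimage_setI AB preimage_set0.
- have -> : ~` (pi @^-1` c) = pi @^-1` (~` c) by [].
  by rewrite cAB preimage_setU.
Qed.

Lemma feature_pre a (A : set X) : A (feature_point a) -> feature a `<=` pi @^-1` A.
Proof. by move=> Aa x /feature_pointP E; rewrite /preimage /= E. Qed.

(** The loop is parallel to the marked boundary circle. *)
Lemma two_loop_marked i : (0 < tnth m i)%N ->
  (exists b1 b2 : F, [/\ b1 <> b2, b1 <> inr i & b2 <> inr i]) \/
  (exists2 j, (0 < tnth m j)%N & j <> i) -> exists c : set S, two_loop c.
Proof.
move=> mi H.
have [c [A [B [cAB Ai oB _]]]] := enclose_point (capped_boundaryless S) feature_points (feature_point (inr i)).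
have Bb b : b <> inr i -> B (feature_point b).
  by move=> bi; apply: oB; [exact: mem_feature_points|move/feature_point_inj].
apply: (uncap_two_loop cAB).
- by move=> a; have [->|/eqP/Bb] := eqVneq a (inr i); [left|right].
- by right; exists i => //; apply: (@feature_pre (inr i)).
- case: H => [[b1 [b2 [b12 b1i b2i]]]|[j mj ji]].
    by left; exists b1, b2; split=> //; apply: feature_pre; exact: Bb.
  right; exists j => //; apply: (@feature_pre (inr j)); apply: Bb.
  by case.
Qed.

(** The loop surrounds two of the four features. *)
Lemma two_loop_four (s : seq F) : uniq s -> size s = 4 -> exists c : set S, two_loop c.
Proof.
case: s => [|a1 [|a2 [|a3 [|a4 [|? ?]]]]] //= U _.
move: U; rewrite !inE !negb_or => /and4P[/and3P[/eqP n12 /eqP n13 /eqP n14] /andP[/eqP n23 /eqP n24] /eqP n34 _].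
have [|c [A [B [cAB A1 A2 oB]]]] := enclose_pair (capped_boundaryless S)
    (mem_feature_points a1) (mem_feature_points a2).
  by move/feature_point_inj.
have Bb b : b <> a1 -> b <> a2 -> B (feature_point b).
  by move=> b1 b2; apply: oB; [exact: mem_feature_points|move/feature_point_inj|move/feature_point_inj].
apply: (uncap_two_loop cAB).
- move=> a; have [->|/eqP e1] := eqVneq a a1; first by left.
  by have [->|/eqP e2] := eqVneq a a2; [left|right; exact: Bb].
- by left; exists a1, a2; split=> //; exact: feature_pre.
- left; exists a3, a4; split=> //; apply: feature_pre; apply: Bb; exact: nesym.
Qed.

Lemma marked_homeo_bdry f : marked_homeo f -> f @` bdry S = bdry S.
Proof.
move=> [_ _ _ fc]; apply/seteqP; split=> x.
  by move=> [y [i _ iy] <-]; exists i => //; rewrite -fc; exists y.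
by move=> [i _]; rewrite -fc => -[y iy <-]; exists y => //; exists i.
Qed.

Lemma capping_circle (c : set S) : c `&` bdry S = set0 -> circle_in R c ->
  circle_in R (pi @` c).
Proof.
move=> cD [gam [cg gi cE]]; exists (pi \o gam); split.
- exact: (ctscomp cg (@capping_cts _ _ _ S)).
- move=> s t; rewrite -gi; split=> [/= E|/= ->//]; apply: capping_inj E => sD.
  by suff : set0 (gam s) by []; rewrite -cD; split=> //; rewrite cE; exists s.
- by rewrite cE -(image_comp gam pi).
Qed.

Lemma capping_nonseparating (c : set S) : c `&` bdry S = set0 ->
  nonseparating c -> nonseparating (pi @` c).
Proof.
move=> cD nc [ O1 [ O2 [ o1 o2 [x x1] [y y2] [dj cov]]]]; apply: nc.
have cp := @capping_cts _ _ _ S.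
exists (pi @^-1` O1), (pi @^-1` O2); split.
- by apply: open_comp => // ? _; exact: cp.
- by apply: open_comp => // ? _; exact: cp.
- by exists (uncap x); rewrite /preimage /= uncapK.
- by exists (uncap y); rewrite /preimage /= uncapK.
- split; first by rewrite -preimage_setI dj preimage_set0.
  rewrite -preimage_setU -cov; apply/seteqP; split=> z; rewrite /preimage /=.
    move=> zc [w wc E]; apply: zc; suff <- : w = z by [].
    apply: capping_inj E => wD.
    by suff : set0 w by []; rewrite -cD.
  by move=> zc cz; apply: zc; exists z.
Qed.

(** A boundary circle is connected, so it lies on one side of a curve that
    misses it; hence the sides are saturated. *)
Lemma uncap_nonseparating (c : set X) : (forall a, ~ c (feature_point a)) ->
  nonseparating c -> nonseparating (pi @^-1` c).
Proof.
move=> cf nc [ O1 [ O2 [ o1 o2 [x x1] [y y2] [dj cov]]]]; apply: nc.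
have ci i : circ S i `<=` O1 `|` O2.
  rewrite -cov => z iz cz; apply: (cf (inr i)).
  by have /feature_pointP <- : feature (inr i) z by [].
have both z : O1 z -> O2 z -> False by move=> a b; suff : set0 z by []; rewrite -dj.
have side i : circ S i `<=` O1 \/ circ S i `<=` O2.
  have := circle_connected (circ_circle S i); move/connectedE2; apply=> //.
  by apply/seteqP; split=> // z [[_ a] b]; exact: (both z).
have oO1 : open (pi @` O1).
  apply: capping_sat_open => // z i z1 iz.
  by case: (side i) => // H; exfalso; apply: (both z) => //; exact: H.
have oO2 : open (pi @` O2).
  apply: capping_sat_open => // z i z1 iz.
  by case: (side i) => // H; exfalso; apply: (both z) => //; exact: H.
exists (pi @` O1), (pi @` O2); split=> //.
- by exists (pi x); exists x.
- by exists (pi y); exists y.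
- split.
    apply/seteqP; split=> // _ [[u u1 <-] [v v2 /cappingP E]].
    case: E => [E|[i [iv iu]]]; first by apply: (both u) => //; rewrite -E.
    by case: (side i) => H; [apply: (both v) => //; exact: H|apply: (both u) => //; exact: H].
  rewrite -image_setU -cov; apply/seteqP; split=> z.
    by move=> zc; exists (uncap z); rewrite ?uncapK// /preimage /= uncapK.
  by move=> [w wc <-].
Qed.

(** A deformation close to a point or to a boundary circle would lie in a disc
    of the capped surface and separate it. *)
Lemma nonseparating_two_loop (c : set S) : circle_in R c -> c `&` bdry S = set0 ->
  c `&` @marks R g h n m S = set0 -> nonseparating c -> two_loop c.
Proof.
move=> hc cD cM nc.
have key x (Z : set S) : (forall z, Z z -> pi z = pi x) -> ~ deforms_near c Z.
  move=> ZE near; have [psi [psiE p0]] := bl_square (capped_boundaryless S) (pi x).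
  have [||c' /isotopic_image[f [fm ->]] fcU] := near (pi @^-1` (psi @` open_square R)).
  - apply: open_comp; first by move=> z _; exact: capping_cts.
    by case: psiE.
  - move=> z /ZE E; rewrite /preimage /= E -p0; exists 0 => //.
    by rewrite /open_square /= normr0.
  have [hf _ _ _] := fm.
  have fcD : f @` c `&` bdry S = set0.
    apply/seteqP; split=> // _ [[z cz <-]].
    rewrite -(marked_homeo_bdry fm) => -[w wD /(homeo_inj hf) E].
    by suff : set0 z by []; rewrite -cD; split=> //; rewrite -E.
  have hfc := homeo_circle hf hc.
  have hpc := capping_circle fcD hfc.
  have sub : pi @` (f @` c) `<=` psi @` open_square R by move=> _ [z zc <-]; exact: fcU.
  have := jordan_embedded (@capped_hausdorff R g h S) psiE hpc sub.
  apply: capping_nonseparating => //; exact: homeo_nonseparating.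
split.
  by split=> // x; apply: (key x) => z ->.
move=> [_ [i _]]; have [x ix] := circ_nonempty S i.
by apply: (key x) => z iz; apply/cappingP; right; exists i.
Qed.

(** If the curve separated, one of its sides would miss the connected complement
    of the whole system, hence be covered by the other curves; but those have
    empty interior. *)
Lemma cut_nonseparating k (c : 'I_k -> set S) i :
  cut_system R (bdry S) c -> nonseparating (c i).
Proof.
move=> [hc cD cc con] [ O1 [ O2 [ o1 o2 n1 n2 [dj cov]]]].
have main (V : set S) : open V -> V !=set0 -> V `&` c i = set0 -> ~ V `<=` \bigcup_j c j.
  move=> oV [x Vx] Vi Vs; have [j _ jx] := Vs _ Vx.
  have ji : j != i.
    by apply/eqP => ji; suff : set0 x by []; rewrite -Vi -ji.
  have kc : compact (\bigcup_(l in [set l | l != j]) c l).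
    have -> : \bigcup_(l in [set l | l != j]) c l = \big[setU/set0]_(l <- enum 'I_k | l != j) c l.
      rewrite -bigcup_seq_cond; apply/seteqP; split=> z [l /= lj lz]; exists l => //=.
        by rewrite mem_enum.
      by case/andP: lj.
    by apply: bigsetU_compact => l _; exact: (circle_compact (hc l)).
  have oW : open (V `&` ~` (\bigcup_(l in [set l | l != j]) c l)).
    by apply: openI => //; apply: closed_openC; exact: surface_closed.
  have xD : ~ bdry S x by move=> xD; suff : set0 x by []; rewrite -(cD j).
  have [|psi [[cp ip op] p0 pU]] := small_interior_square xD oW.
    split=> // -[l /= /eqP lj lx]; apply: lj; apply: contrapT => /eqP lj.
    by suff : set0 x by []; rewrite -(cc l j lj).
  apply: (circle_no_interior (@surface_hausdorff _ _ _ S) (hc j) cp ip).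
  move=> _ [p ps <-]; have [[pV pn] _] := pU _ ps.
  have [l _ lp] := Vs _ pV; have [<-//|lj] := eqVneq l j.
  by exfalso; apply: pn; exists l.
have d1 : O1 `&` c i = set0.
  apply/seteqP; split=> // x [x1 xc].
  by have : (~` c i) x by rewrite cov; left.
have d2 : O2 `&` c i = set0.
  apply/seteqP; split=> // x [x2 xc].
  by have : (~` c i) x by rewrite cov; right.
have both z : O1 z -> O2 z -> False by move=> a b; suff : set0 z by []; rewrite -dj.
move/connectedE2 : con => /(_ O1 O2 o1 o2) [||H|H].
- by apply/seteqP; split=> // z [[_ a] b]; exact: (both z).
- by move=> x nx; rewrite -cov => xi; apply: nx; exists i.
- apply: (main _ o2 n2 d2) => z z2; apply: contrapT => /H z1; exact: (both z).
- apply: (main _ o1 n1 d1) => z z1; apply: contrapT => /H z2; exact: (both z).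
Qed.

Lemma two_loop_genus : (0 < g)%N -> exists c : set S, two_loop c.
Proof.
move=> g0; have [[c cs] _] := surface_genus S.
pose i : 'I_g := Ordinal g0.
have [hc cD _ _] := cs; have nc := @cut_nonseparating _ c i cs.
have nX := capping_nonseparating (cD i) nc.
have hX := capping_circle (cD i) (hc i).
have [|c' [hc' nc' c'a]] := avoid_seq (capped_boundaryless S) (s := [::]) feature_points hX nX.
  by [].
have cf a : ~ c' (feature_point a) by apply: c'a; rewrite cats0; exact: mem_feature_points.
have [h1 h2 h3] := uncap_circle hc' cf.
exists (pi @^-1` c'); apply: nonseparating_two_loop => //.
exact: uncap_nonseparating.
Qed.

End Features.

(** * Faces of polytopes *)

Section Faces.
Variables (R : realType) (d : nat).
Implicit Types (x y a e : 'rV[R]_d).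

Definition inner x a : R := (x *m a^T) 0 0.

Lemma innerBl x y a : inner (x - y) a = inner x a - inner y a.
Proof. by rewrite /inner mulmxBl !mxE. Qed.
Lemma innerDr x a e : inner x (a + e) = inner x a + inner x e.
Proof. by rewrite /inner linearD mulmxDr mxE. Qed.
Lemma innerZr c x a : inner x (c *: a) = c * inner x a.
Proof. by rewrite /inner linearZ -scalemxAr mxE. Qed.
Lemma inner_sum (I : finType) (w : I -> R) (v : I -> 'rV[R]_d) a :
  inner (\sum_i w i *: v i) a = \sum_i w i * inner (v i) a.
Proof.
rewrite /inner mulmx_suml summxE; apply: eq_bigr => i _.
by rewrite -scalemxAl mxE.
Qed.

Lemma separating_form k (W : 'M[R]_(k, d)) (u : 'rV[R]_d) : ~~ (u <= W)%MS ->
  exists2 e, (forall y, (y <= W)%MS -> inner y e = 0) & inner u e = 1.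
Proof.
rewrite submxE => /eqP u0.
have [l ul] : exists l, (u *m cokermx W) 0 l != 0.
  apply: contrapT => H; apply: u0; apply/rowP => l; rewrite [RHS]mxE.
  by apply: contrapT => /eqP ne; apply: H; exists l.
pose e0 := (col l (cokermx W))^T.
have innerE y : inner y e0 = (y *m cokermx W) 0 l.
  rewrite /inner /e0 trmxK !mxE; apply: eq_bigr => i _; congr (_ * _).
  by rewrite mxE.
exists ((inner u e0)^-1 *: e0).
  by move=> y; rewrite submxE => /eqP yW; rewrite innerZr (innerE y) yW mxE mulr0.
by rewrite innerZr mulVf// innerE.
Qed.

Lemma realized_extend (F : set 'rV[R]_d) k x (V : 'M[R]_(k, d)) y :
  row_free V -> F x -> (forall i, F (x + row i V)) -> F y -> ~~ (y - x <= V)%MS ->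
  exists x' (V' : 'M[R]_(k + 1, d)), [/\ F x', forall i, F (x' + row i V') & row_free V'].
Proof.
move=> fV Fx FV Fy nV.
exists x, (col_mx V (y - x)); split=> //.
- move=> i; case: (split_ordP i) => j ->; first by rewrite rowKu.
  have -> : row (rshift k j) (col_mx V (y - x)) = y - x.
    by rewrite rowKd; apply/rowP => l; rewrite !mxE ord1.
  by rewrite addrC subrK.
- rewrite /row_free eqn_leq rank_leq_row /=.
  have : (V < col_mx V (y - x))%MS.
    by rewrite ltmxE col_mx_sub submx_refl /= nV andbT -addsmxE addsmxSl.
  move/rank_ltmx; rewrite (eqP fV) => lt; lia.
Qed.

(** The supporting form [a] is tilted, keeping the face, until it meets a further
    vertex: the tilting form [e] vanishes along the face, and the vertex [v q]
    maximizes the slope [t]. The form [e] is chosen to vanish at one vertex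
    outside the face and to be positive at another; the first then stays outside
    the new face. *)
Lemma intermediate_face (P F : set 'rV[R]_d) k : convex_polytope P ->
  nonempty_faces P F -> affine_dim F k -> affine_dim P k.+2 ->
  exists G, [/\ nonempty_faces P G, F `<=` G, G <> F & G <> P].
Proof.
move=> [kv [v PE]] [_ [a [b [Pb FE]]]] [[x0 [V [Fx0 FV fV]]] Fmax] [[x1 [V1 [Px1 PV1 fV1]]] _].
have FP y : F y -> P y by rewrite FE => -[].
have Fb y : F y -> inner y a = b by rewrite FE => -[].
have Pv i : P (v i).
  rewrite PE; exists (fun j => (j == i)%:R); split.
  - by move=> j; case: eqP.
  - by rewrite (bigD1 i)//= eqxx big1 ?addr0// => j /negbTE ->.
  - by rewrite (bigD1 i)//= eqxx scale1r big1 ?addr0// => j /negbTE ->; rewrite scale0r.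
have FVs y : F y -> (y - x0 <= V)%MS.
  move=> Fy; apply: contrapT => /negP nV.
  by have /Fmax := realized_extend fV Fx0 FV Fy nV; rewrite addn1 ltnn.
(* The vertices cannot all lie in an affine subspace of smaller dimension. *)
have span l (M : 'M[R]_(l, d)) : (\rank M < k.+2)%N -> exists i, ~~ (v i - x0 <= M)%MS.
  move=> rM; apply: contrapT => H.
  have vM i : (v i - x0 <= M)%MS by apply: contrapT => /negP ?; apply: H; exists i.
  have PM y : P y -> (y - x0 <= M)%MS.
    rewrite PE => -[w [w0 w1 ->]].
    have -> : \sum_i w i *: v i - x0 = \sum_i w i *: (v i - x0).
      under [RHS]eq_bigr do rewrite scalerBr.
      by rewrite sumrB -scaler_suml w1 scale1r.
    by apply: summx_sub => i _; exact: scalemx_sub.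
  have : (V1 <= M)%MS.
    apply/row_subP => i; have -> : row i V1 = (x1 + row i V1 - x0) - (x1 - x0).
      by rewrite opprB addrA subrK addrC addKr.
    by apply: addmx_sub; [exact: PM|rewrite eqmx_opp; exact: PM].
  by move/mxrankS; rewrite (eqP fV1); lia.
have rV : \rank V = k by exact/eqP.
have [i0 i0V] := span _ V (ltac:(by rewrite rV; lia)).
pose W := col_mx V (v i0 - x0).
have VW : (V <= W)%MS by rewrite -addsmxE addsmxSl.
have [|j jW] := span _ W; first by have := rank_leq_row W; lia.
have [e eW ej] := separating_form jW.
pose s i := b - inner (v i) a.
have s0 i : 0 <= s i by rewrite subr_ge0; exact: Pb.
have sF i : s i = 0 -> F (v i).
  by move=> /eqP; rewrite subr_eq0 => /eqP E; rewrite FE; split=> //; exact: esym E.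
have spos i : ~~ (v i - x0 <= V)%MS -> 0 < s i.
  by move=> iV; rewrite lt_def s0 andbT; apply/eqP => /sF/FVs; exact/negP.
have si0 := spos _ i0V.
have sj : 0 < s j by apply: spos; apply: contraNN jW => /submx_trans; apply.
have eV y : (y <= V)%MS -> inner y e = 0 by move=> yV; apply: eW; exact: submx_trans yV VW.
have ei0 : inner (v i0 - x0) e = 0.
  by apply: eW; rewrite -addsmxE addsmxSr.
pose t i := inner (v i - x0) e / s i.
have [q square tq] : exists2 q, 0 < s q & forall i, 0 < s i -> t i <= t q.
  by case: (@arg_maxP _ _ _ i0 (fun i => 0 < s i) t si0) => q square tq; exists q.
have tpos : 0 < t q by apply: lt_le_trans (tq _ sj); rewrite /t ej divr_gt0.
pose a' := e + t q *: a; pose b' := inner x0 e + t q * b.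
have a'E y : inner y a' - b' = inner (y - x0) e - t q * (b - inner y a).
  by rewrite /a' /b' innerDr innerZr innerBl; ring.
have valid i : inner (v i) a' <= b'.
  rewrite -subr_le0 a'E -/(s i) subr_le0; have [/sF/FVs/eV ->|/eqP sn] := pselect (s i = 0).
    by rewrite mulr_ge0// ltW.
  have sp : 0 < s i by rewrite lt_def sn s0.
  by rewrite -ler_pdivrMr//; exact: tq.
exists [set x | P x /\ (x *m a'^T) 0 0 = b']; split.
- split.
    exists x0; split; first exact: FP.
    apply/eqP; rewrite -subr_eq0 -/(inner x0 a') a'E subrr Fb// subrr mulr0 subr0.
    by rewrite /inner mul0mx mxE.
  exists a', b'; split=> // y; rewrite PE => -[w [w0 w1 ->]].
  rewrite -/(inner _ a') inner_sum -[b']mul1r -w1 mulr_suml.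
  by apply: ler_sum => i _; apply: ler_wpM2l.
- move=> y Fy; split; first exact: FP.
  apply/eqP; rewrite -subr_eq0 -/(inner y a') a'E Fb// subrr mulr0 subr0.
  by rewrite eV//; exact: FVs.
- move=> GF; have : F (v q).
    rewrite -GF; split=> //; apply/eqP; rewrite -subr_eq0 -/(inner (v q) a') a'E -/(s q).
    by rewrite /t divfK ?subrr// gt_eqF.
  by move/Fb => E; move: square; rewrite /s E subrr ltxx.
- move=> GP; have : P (v i0) by exact: Pv.
  rewrite -GP => -[_] /eqP; rewrite -subr_eq0 -/(inner (v i0) a') a'E -/(s i0) ei0 sub0r.
  by rewrite oppr_eq0 mulf_eq0 (gt_eqF tpos) (gt_eqF si0).
Qed.

End Faces.

(** * Strata *)

Section Strata.
Variables (R : realType) (g h n : nat) (m : h.-tuple nat) (S : marked_surface R g n m).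

Lemma marked_homeo_id : marked_homeo (@id S).
Proof. by split=> //; [exact: homeo_id|move=> i; rewrite image_id]. Qed.

Lemma isotopic_refl (c : set S) : isotopic c c.
Proof.
exists (fun _ => id); split=> //; last by rewrite image_id.
- by apply: continuous_subspaceT; apply: ctssnd; exact: ctsid.
- by move=> t _; exact: marked_homeo_id.
Qed.

Lemma curve_system0 : @curve_system _ _ _ _ _ S set0.
Proof. by split=> //; exact: finite_set0. Qed.

Lemma loop_system (c : set S) : is_loop c -> curve_system [set isotopy_class c].
Proof.
move=> lc; split.
- exact: finite_set1.
- by move=> _ ->; exists c => //; right.
- by move=> K L -> ->.
Qed.

Lemma two_loop_weight (c : set S) : two_loop c ->
  system_weight [set isotopy_class c] = 2%N.
Proof.
move=> tc; rewrite /system_weight fsbig_set1 /weight.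
case: asboolP => // H; exfalso; apply: H; exists c => //; exact: isotopic_refl.
Qed.

Lemma stratum_empty (B : set (set (set S))) :
  stratum_of B set0 -> stratum_of B = stratum_of (@set0 (set (set S))).
Proof.
move=> [f fm fB]; suff -> : B = set0 by [].
apply/seteqP; split=> // K BK.
have : system_image f B [set f @` c | c in K] by exists K.
by rewrite -fB.
Qed.

Lemma polytopal_dim : moduli_polytopal S -> 0 <= moduli_dim g n m.
Proof.
move=> [d [P [Phi [_ _ _ dims]]]]; have [k _] := dims _ curve_system0.
by rewrite /system_weight fsbig_set0 subr0 => <-.
Qed.

(** The face of the 2-loop would lie in an intermediate face; the curve system of
    the latter is contained in that of the 2-loop, so it is empty or the same. *)
Lemma two_loop_not_polytopal (c : set S) : two_loop c -> ~ moduli_polytopal S.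
Proof.
move=> tc [d [P [Phi [cP [Pf Pi Ps] le dims]]]].
have lc : is_loop c by case: tc.
have sc := loop_system lc.
pose T0 := stratum_of (@set0 (set (set S))); pose X := stratum_of [set isotopy_class c].
have T0s : strata S T0 by exists set0 => //; exact: curve_system0.
have Xs : strata S X by exists [set isotopy_class c].
have [k0 dim0] := dims _ curve_system0; rewrite /system_weight fsbig_set0 subr0 => k0E.
have [k1 dim1] := dims _ sc; rewrite two_loop_weight// => k1E.
have faceP F : nonempty_faces P F -> F `<=` P.
  by move=> [_ [a [b [_ ->]]]] x [].
have nP : nonempty_faces P P.
  have T0f : nonempty_faces P (Phi T0) by exact: Pf.
  have [[x T0x] _] := T0f; split.
    by exists x; exact: (faceP _ T0f).
  exists 0, 0; split; first by move=> y _; rewrite trmx0 mulmx0 mxE.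
  by apply/seteqP; split=> [y Py|y []//]; split=> //; rewrite trmx0 mulmx0 mxE.
have emp Y : strata S Y -> Y set0 -> Y = T0.
  by move=> [B _ <-]; apply: stratum_empty.
have T0P : Phi T0 = P.
  have [Z Zs ZP] := Ps _ nP.
  have /(le _ _ T0s Zs)[A [B [[f _ AE] ZB BA]]] : Phi T0 `<=` Phi Z.
    by rewrite ZP; apply: faceP; exact: Pf.
  have B0 : B = set0.
    by apply/seteqP; split=> // K /BA; rewrite AE => -[].
  by rewrite -ZP -(emp Z Zs) // -B0.
have k01 : k0 = k1.+2 by apply/eqP; rewrite -eqz_nat k0E; apply/eqP; move: k1E; lia.
have dimP : affine_dim P k1.+2 by rewrite -T0P -k01.
have [G [Gf XG GX GP]] := intermediate_face cP (Pf _ Xs) dim1 dimP.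
have [Y Ys YG] := Ps _ Gf.
have /(le _ _ Xs Ys)[A [B [XA YB BA]]] : Phi X `<=` Phi Y by rewrite YG.
have [f fm AE] := XA.
have [B0|[L BL]] : B = set0 \/ B !=set0.
  by have [->|/set0P] := eqVneq B set0; [left|right].
  by apply: GP; rewrite -YG (emp Y Ys) // -B0.
have AL : A = B.
  have A1 K : A K -> K = [set f @` c' | c' in isotopy_class c].
    by rewrite AE => -[_ -> <-].
  apply/seteqP; split=> // K AK.
  by rewrite (A1 _ AK) -(A1 _ (BA _ BL)).
apply: GX; rewrite -YG; apply/seteqP; split; last by rewrite YG.
by apply/(le _ _ Ys Xs); exists A, A; split=> //; rewrite AL.
Qed.

End Strata.

Theorem theorem6 (R : realType) (g h n : nat) (m : h.-tuple nat)
  (S : marked_surface R g n m) (S_stable : stable S)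
  (not_sphere3 : (g, h, n, tval m) <> (0, 0, 3, [::])%N)
  (not_disk2 : (g, h, n, tval m) <> (0, 1, 2, [:: 0])%N)
  (not_annulus1 : (g, h, n, tval m) <> (0, 2, 1, [:: 0; 0])%N)
  (not_pants : (g, h, n, tval m) <> (0, 3, 0, [:: 0; 0; 0])%N)
  (not_disk : forall k : nat, (g, h, n, tval m) <> (0, 1, 0, [:: k])%N)
  (not_punctured_disk :
     forall k : nat, (g, h, n, tval m) <> (0, 1, 1, [:: k])%N)
  (not_annulus : forall k : nat,
     (g, h, n, tval m) <> (0, 2, 0, [:: k; 0])%N /\
     (g, h, n, tval m) <> (0, 2, 0, [:: 0; k])%N) :
  ~ moduli_polytopal S.
Proof.
move=> poly; have dim0 := polytopal_dim poly.
have no2 : ~ exists c : set S, two_loop c by move=> [c tc]; exact: two_loop_not_polytopal tc poly.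
have g0 : g = 0%N.
  by apply/eqP; rewrite -leqn0 leqNgt; apply/negP => /(@two_loop_genus _ _ _ _ _ S).
have sm : size (tval m) = h by exact: size_tuple.
have nthm (i : 'I_h) : tnth m i = nth 0%N (tval m) i by exact: tnth_nth.
have [[i mi]|N] := pselect (exists i : 'I_h, (0 < tnth m i)%N).
  have [big|small] := ltnP 2 (n + h).
    apply: no2; apply: (@two_loop_marked R g h n m S i mi); left.
    have /card_gt1P[b1 [b2 [b1i b2i b12]]] : (1 < #|predC1 (inr i : 'I_n + 'I_h)|)%N.
      by rewrite cardC1 card_sum !card_ord; lia.
    by exists b1, b2; split; apply/eqP.
  have h0 : (0 < h)%N by case: i {mi} => i /=; lia.
  have [h1|h2] : h = 1%N \/ h = 2 by lia.
    have [k mk] : exists k, tval m = [:: k].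
      by case: (tval m) sm => [|k [|? ?]]; rewrite h1 //; exists k.
    have [n0|n1] : n = 0%N \/ n = 1%N by lia.
      by apply: (not_disk k); rewrite mk g0 h1 n0.
    by apply: (not_punctured_disk k); rewrite mk g0 h1 n1.
  have n0 : n = 0%N by lia.
  have [a [b mab]] : exists a b, tval m = [:: a; b].
    by case: (tval m) sm => [|a [|b [|? ?]]]; rewrite h2 //; exists a, b.
  have lt0 : (0 < h)%N by lia.
  have lt1 : (1 < h)%N by lia.
  have [a0|a0] := posnP a.
    by have [_] := not_annulus b; apply; rewrite mab a0 g0 h2 n0.
  have [b0|b0] := posnP b.
    by have [+ _] := not_annulus a; apply; rewrite mab b0 g0 h2 n0.
  apply: no2; apply: (@two_loop_marked _ _ _ _ _ S (Ordinal lt0)).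
    by rewrite nthm mab.
  by right; exists (Ordinal lt1); [rewrite nthm mab|case].
have m0 (i : 'I_h) : tnth m i = 0%N.
  by apply/eqP; rewrite -leqn0 leqNgt; apply/negP => ?; apply: N; exists i.
have mE : tval m = nseq h 0%N.
  apply: (@eq_from_nth _ 0%N); first by rewrite size_nseq.
  by move=> i; rewrite sm => ih; rewrite nth_nseq ih; have := m0 (Ordinal ih); rewrite nthm.
have dim1 : (6 <= 3 * h + 2 * n)%N.
  move: dim0; rewrite /moduli_dim big1; last by move=> i _; exact: m0.
  by rewrite g0; lia.
have [big|small] := ltnP 3 (n + h).
  apply: no2; apply: (@two_loop_four _ _ _ _ _ S (take 4 (enum {: 'I_n + 'I_h}))).
    by apply: take_uniq; exact: enum_uniq.
  by rewrite size_take -cardT card_sum !card_ord; case: ifP; lia.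
have [[h0 n3]|[[h1 n2]|[[h2 n1]|[[h3 n0]|[h2 n0]]]]] : ((h = 0 /\ n = 3) \/ (h = 1 /\ n = 2) \/
    (h = 2 /\ n = 1) \/ (h = 3 /\ n = 0) \/ (h = 2 /\ n = 0))%N by lia.
- by apply: not_sphere3; rewrite mE g0 h0 n3.
- by apply: not_disk2; rewrite mE g0 h1 n2.
- by apply: not_annulus1; rewrite mE g0 h2 n1.
- by apply: not_pants; rewrite mE g0 h3 n0.
- by have [+ _] := not_annulus 0; apply; rewrite mE g0 h2 n0.
Qed.
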